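(* Let $h_3(z)=\eta^2(z)\eta^2(3z)$, and let $\nu_\pm$ be the multiplier systems on $\Gamma^*(3)$ defined below. (a) For every integer $d>0$ with $d\equiv1\pmod3$ and each choice of sign there is a unique form $f_d^{\pm}=q^{-d/3}+\sum_{n>0,\ n\equiv2\bmod3}a_d^\pm(n)q^{n/3}\in M_2^!(\Gamma^*(3),\bar\nu_\pm)$. (b) For every integer $d>0$ with $d\equiv2\pmod3$ there are unique forms $f_d^{+}=q^{-d/3}+\sum_{n>0,\ n\equiv1\bmod3}a_d^+(n)q^{n/3}\in M_2^!(\Gamma^*(3),\nu_+)$ and $f_d^{-}=q^{-d/3}+\sum_{n\ge4,\ n\equiv1\bmod3}a_d^-(n)q^{n/3}\in M_2^!(\Gamma^*(3),\nu_-)$. (c) Let $p\ge5$ be prime and $n\ge1$. Then $f_1^+|T_2^{(3)}(p^n)=p^nf^+_{p^n}$. If $p^n\equiv1\pmod3$ then $f_1^-|T_2^{(3)}(p^n)=p^nf^-_{p^n}$. If $p^n\equiv2\pmod3$ then $f_1^-|T_2^{(3)}(p^n)=p^nf^-_{p^n}+a_1^-(p^n)\,h_3$.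
   Context: $q=e^{2\pi iz}$, $\eta(z)=q^{1/24}\prod_{n\ge1}(1-q^n)$, $\zeta_3=e^{2\pi i/3}$. $\Gamma^*(3)$ is the Fricke group generated by $\Gamma_0(3)$ and $W_3=\begin{pmatrix}0&-1\\3&0\end{pmatrix}$ (equivalently by $\begin{pmatrix}1&1\\0&1\end{pmatrix}$ and $W_3$). $\nu_\pm$ is the character of $\Gamma^*(3)$ given by $\nu_\pm(\gamma)=\zeta_3^{\frac c3(a+d)+bd}$ for $\gamma=\begin{pmatrix}a&b\\c&d\end{pmatrix}\in\Gamma_0(3)$ (the multiplier system of $h_3$ on $\Gamma_0(3)$) and $\nu_\pm(W_3)=\pm1$; $\bar\nu_\pm$ is its complex conjugate. For $\gamma\in GL_2^+(\mathbb{Q})$, $f|_k\gamma(z)=(\det\gamma)^{k/2}(cz+d)^{-k}f(\gamma z)$. $M_k^!(\Gamma,\chi)$ is the space of holomorphic functions on the upper half-plane, meromorphic at the cusps, with $f|_k\gamma=\chi(\gamma)f$ for all $\gamma\in\Gamma$. For a prime $p$, $f|T_k^{(t)}(p)=p^{k/2-1}\left(\sum_{\lambda=0}^{p-1}f|_k\begin{pmatrix}1&t\lambda\\0&p\end{pmatrix}+f|_k\begin{pmatrix}p&0\\0&1\end{pmatrix}\right)$, acting on $f=\sum a(n)q^{n/t}$ by $\sum(a(pn)+p^{k-1}a(n/p))q^{n/t}$; $T_k^{(t)}(1)=\mathrm{id}$, $T_k^{(t)}(p^{n+1})=T_k^{(t)}(p^n)T_k^{(t)}(p)-p^{k-1}T_k^{(t)}(p^{n-1})$.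 In (c), $f^\pm_{p^n}$ are the forms from (a) or (b) according to $p^n\bmod3$, and $a_1^-(m)$ is the coefficient of $q^{m/3}$ in $f_1^-$. *)

(* Defs.v *)
From Stdlib Require Import Reals ZArith Znumtheory.
From Coquelicot Require Import Coquelicot.
Open Scope R_scope.

Definition cexp (w : C) : C :=
  (RtoC (exp (Re w)) * (RtoC (cos (Im w)) + Ci * RtoC (sin (Im w))))%C.

Definition qpow (x : R) (z : C) : C := cexp (RtoC (2 * PI * x) * Ci * z)%C.

Definition zeta3pow (k : Z) : C := cexp (RtoC (2 * PI * IZR k / 3) * Ci)%C.

Definition inH (z : C) : Prop := 0 < Im z.

Definition slash2 (a b c d : Z) (f : C -> C) (z : C) : C :=
  (RtoC (IZR (a * d - b * c)) * / ((RtoC (IZR c) * z + RtoC (IZR d)) ^ 2)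
   * f ((RtoC (IZR a) * z + RtoC (IZR b)) / (RtoC (IZR c) * z + RtoC (IZR d))))%C.

Definition holoH (f : C -> C) : Prop :=
  forall z : C, inH z -> @ex_derive C_AbsRing C_NormedModule f z.

Definition mero_cusps (f : C -> C) : Prop :=
  forall a b c d : Z, (a * d - b * c = 1)%Z ->
  exists (M N : nat) (e : nat -> C), (0 < M)%nat /\
    forall z, inH z ->
      is_series (fun n => (e n * qpow ((INR n - INR N) / INR M) z)%C)
                (slash2 a b c d f z).

Definition Gamma0_3 (a b c d : Z) : Prop := (a * d - b * c = 1)%Z /\ (3 | c)%Z.

(** The multiplier system nu_{+} (s = true) / nu_{-} (s = false) of Gamma^*(3),
    and its complex conjugate (conj = true).  On Gamma_0(3):
    nu(gamma) = zeta_3^{(c/3)(a+d) + b d};  nu(W_3) = +1 / -1. *)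
Definition nu_G0 (conj : bool) (a b c d : Z) : C :=
  let k := ((c / 3) * (a + d) + b * d)%Z in
  zeta3pow (if conj then (- k)%Z else k).
Definition nu_W (s : bool) : C := if s then 1%C else (-1)%C.

(** M_2^!(Gamma^*(3), chi) where chi = nu_s (conj=false) or bar nu_s (conj=true).
    Gamma^*(3) is generated by Gamma_0(3) and W_3 = [[0,-1],[3,0]]; since the
    slash action is a right action and chi a character, the transformation law
    on the group is imposed on these generators. *)
Definition Mweak2 (s conj : bool) (f : C -> C) : Prop :=
  holoH f /\ mero_cusps f /\
  (forall a b c d : Z, Gamma0_3 a b c d ->
     forall z, inH z -> slash2 a b c d f z = (nu_G0 conj a b c d * f z)%C) /\
  (forall z, inH z -> slash2 0 (-1) 3 0 f z = (nu_W s * f z)%C).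

Definition is_f (s : bool) (d : nat) (f : C -> C) (a : nat -> C) : Prop :=
  let r := if (d mod 3 =? 1)%nat then 2%nat else 1%nat in
  Mweak2 s (d mod 3 =? 1)%nat f /\
  a 0%nat = 0%C /\
  (forall n, (n mod 3 <> r)%nat -> a n = 0%C) /\
  ((s = false /\ (d mod 3 = 2)%nat) -> forall n, (n < 4)%nat -> a n = 0%C) /\
  (forall z, inH z ->
     is_series (fun n => (a n * qpow (INR n / 3) z)%C)
               (f z - qpow (- INR d / 3) z)%C).

Fixpoint eta_partial (N : nat) (z : C) : C :=
  match N with
  | O => 1%C
  | S m => (eta_partial m z * (1 - qpow (INR (S m)) z))%C
  end.
Definition eta (z : C) : C :=
  (qpow (1 / 24) z * lim (T := C_CompleteNormedModule) (filtermap (fun N => eta_partial N z) eventually))%C.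

Definition h3 (z : C) : C := (eta z ^ 2 * eta (RtoC 3 * z) ^ 2)%C.

Fixpoint hsum (p : Z) (L : nat) (f : C -> C) (z : C) : C :=
  match L with
  | O => 0%C
  | S l => (hsum p l f z + slash2 1 (3 * Z.of_nat l) 0 p f z)%C
  end.
Definition heckeT (p : nat) (f : C -> C) (z : C) : C :=
  (hsum (Z.of_nat p) p f z + slash2 (Z.of_nat p) 0 0 1 f z)%C.

(** T(p^n): T(1) = id, T(p^{n+1}) = T(p^n) T(p) - p^{k-1} T(p^{n-1}), k = 2. *)
Fixpoint heckeTpow (p n : nat) (f : C -> C) {struct n} : C -> C :=
  match n with
  | O => f
  | S m =>
    match m with
    | O => heckeT p f
    | S k => fun z => (heckeT p (heckeTpow p m f) z
                       - RtoC (INR p) * heckeTpow p k f z)%C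
    end
  end.

(* Main.v *)
Require Import Defs.
From Stdlib Require Import Reals ZArith Znumtheory Lra Lia Psatz ClassicalEpsilon.
From Coquelicot Require Import Coquelicot.
Open Scope R_scope.

(** Writing [h3 = q^(1/3) prod (1 - q^n)^2 (1 - q^(3n))^2] and [t = (eta(z) / eta(3z))^12], the
    form [h3] is nonvanishing of weight 2 with sign [-1] under [W = W_3], [t o W = 729 / t], and
    [A = - theta(t) / t] (with [theta = q d/dq]) has weight 2 and sign [-1].  Hence [A^2 / h3] and
    [theta (A / h3)] lead with [q^(-1/3)], [h3 (t + 729/t)] and [h3 (t - 729/t)] with [q^(-2/3)],
    with the multipliers [nu] required; multiplying by powers of [t + 729/t] and subtracting forms
    of lower order gives every [f_d].  The laws for [T] and [W] imply the law for [Gamma_0(3)],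
    because a Euclidean algorithm on [(c/3, d)] shows that [T], [W T W^(-1)] and [-1] generate it.

    All this rests on [eta(-1/z)^2 = - i z eta(z)^2].  The square partial sums of
    [sum 1 / (m z + n)^2] are exactly invariant under [z -> -1/z], and they differ from the
    Eisenstein series, obtained by summing over [n] first, by boundary sums; the exponential of
    the boundary contribution is a telescoping product with limit [-1].

    For uniqueness, the difference of two solutions divided by [h3] is a function [G] of weight 0,
    with [|G|] invariant under [T] and [W], which vanishes at infinity (for [nu_+] after replacing
    [G] by [G^2 - G(oo)^2], where [G] vanishes at the fixed point [i / sqrt 3]).  Every orbit meets
    [Im z >= 7/25], and Cauchy's estimates on a lower line then turn a bound [|G^2| <= M] into
    [|G^2| <= 99/100 M], so [G = 0].

    The Hecke operators commute with [W] because [W] permutes the cosets, and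
    [f_1 | T(p^n)] has principal part [p^n q^(-p^n/3)] and coefficient [a_1(p^n)] at [q^(1/3)]. *)

(** * Finite sums and limits in [C] *)

(** The exponents of a form in [q^(1/3)] lie in one class modulo 3; this class is the multiplier
    under [T], so only the law under [W_3] is carried separately. Eta products are exponentials of
    Lambert series: they do not vanish, their reciprocals come from a change of sign, and
    logarithmic differentiation yields divisor sums. The boundary sums are Riemann sums tending to a
    logarithm. Exponentiation replaces it by a finite product and loses a multiple of [2 pi i],
    which is constant in [z] and is read off at [z = i]. For uniqueness, [7/25] lies just below
    [1 / (2 sqrt 3)], the least height in the fundamental domain. With [k = rho (1/4) = e^(-pi/6)],
    a series with terms at most [M k^n] that vanishes to order one is only bounded by
    [M k / (1 - k)], which exceeds [M]; order two gives [M k^2 / (1 - k) < M]. This is why squares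
    appear. For [nu_-] and [d = 2 mod 3] the form [h_3] lies in the space itself, whence the extra
    normalization and the extra term in (c). *)

Fixpoint csum (f : nat -> C) (n : nat) : C :=
  match n with O => 0%C | S m => (csum f m + f m)%C end.

Definition clim (u : nat -> C) (l : C) : Prop :=
  forall eps : R, 0 < eps ->
    exists N : nat, forall n, (N <= n)%nat -> Cmod (u n - l) < eps.

Definition cser (a : nat -> C) (l : C) : Prop := clim (csum a) l.

Lemma csum_ext (f g : nat -> C) (n : nat) :
  (forall k, (k < n)%nat -> f k = g k) -> csum f n = csum g n.
Proof.
  induction n as [|n IH]; intros H; simpl; [reflexivity|].
  rewrite IH, (H n) by (intros; try apply H; lia). reflexivity.
Qed.

Lemma csum_plus (f g : nat -> C) (n : nat) :
  csum (fun k => f k + g k)%C n = (csum f n + csum g n)%C.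
Proof. induction n as [|n IH]; simpl; [ring | rewrite IH; ring]. Qed.

Lemma csum_scal (c : C) (f : nat -> C) (n : nat) :
  csum (fun k => c * f k)%C n = (c * csum f n)%C.
Proof. induction n as [|n IH]; simpl; [ring | rewrite IH; ring]. Qed.

Lemma csum_zero (f : nat -> C) (n : nat) :
  (forall k, (k < n)%nat -> f k = 0%C) -> csum f n = 0%C.
Proof.
  induction n as [|n IH]; intros H; simpl; [reflexivity|].
  rewrite IH, (H n) by (intros; try apply H; lia). ring.
Qed.

Lemma csum_swap (f : nat -> nat -> C) (n m : nat) :
  csum (fun i => csum (f i) m) n = csum (fun j => csum (fun i => f i j) n) m.
Proof.
  induction n as [|n IH]; simpl.
  - symmetry; apply csum_zero; reflexivity.
  - rewrite IH, <- csum_plus. reflexivity.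
Qed.

Lemma csum_add (f : nat -> C) (n m : nat) :
  csum f (n + m) = (csum f n + csum (fun k => f (n + k)%nat) m)%C.
Proof.
  induction m as [|m IH]; simpl; [rewrite Nat.add_0_r; ring|].
  rewrite Nat.add_succ_r; simpl; rewrite IH; ring.
Qed.

Lemma csum_Sl (f : nat -> C) (n : nat) :
  csum f (S n) = (f 0%nat + csum (fun k => f (S k)) n)%C.
Proof.
  pose proof (csum_add f 1 n) as E. simpl in E |- *. rewrite E. ring.
Qed.

Lemma csum_rev (f : nat -> C) (n : nat) :
  csum (fun k => f (n - S k)%nat) n = csum f n.
Proof.
  induction n as [|n IH]; [reflexivity|].
  rewrite csum_Sl. simpl csum at 2. rewrite <- IH.
  replace (S n - 1)%nat with n by lia. simpl. ring.
Qed.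

Lemma csum_delta (f : nat -> C) (n i : nat) :
  (i < n)%nat -> (forall k, (k < n)%nat -> k <> i -> f k = 0%C) -> csum f n = f i.
Proof.
  induction n as [|n IH]; intros Hi H; [lia|]. simpl.
  destruct (Nat.eq_dec i n) as [->|Hn].
  - rewrite csum_zero by (intros; apply H; lia). ring.
  - rewrite IH, (H n) by (intros; try apply H; lia). ring.
Qed.

Lemma Cmod_sub_sym (x y : C) : Cmod (x - y) = Cmod (y - x).
Proof. rewrite <- Cmod_opp. f_equal. ring. Qed.

Lemma Cmod_triangle3 (x y z : C) : Cmod (x - z) <= Cmod (x - y) + Cmod (y - z).
Proof. replace (x - z)%C with ((x - y) + (y - z))%C by ring. apply Cmod_triangle. Qed.

Lemma Cmod_rev_triangle (x y : C) : Cmod x - Cmod y <= Cmod (x - y).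
Proof.
  replace x with ((x - y) + y)%C at 1 by ring.
  pose proof (Cmod_triangle (x - y) y). lra.
Qed.

Lemma Cmod_sub_le (x y : C) : Cmod (x - y) <= Cmod x + Cmod y.
Proof. pose proof (Cmod_triangle x (- y)). rewrite Cmod_opp in H. exact H. Qed.

Lemma csum_bound (f : nat -> C) (B : R) (n : nat) :
  (forall k, (k < n)%nat -> Cmod (f k) <= B) -> Cmod (csum f n) <= INR n * B.
Proof.
  induction n as [|n IH]; intros H.
  - simpl. rewrite Cmod_0; lra.
  - rewrite S_INR. simpl csum. eapply Rle_trans; [apply Cmod_triangle|].
    pose proof (IH (fun k Hk => H k (Nat.lt_lt_succ_r _ _ Hk))).
    pose proof (H n (Nat.lt_succ_diag_r n)). lra.
Qed.

Lemma csum_geom_bound (f : nat -> C) (A r : R) (n : nat) :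
  0 <= r < 1 -> (forall k, Cmod (f k) <= A * r ^ k) ->
  Cmod (csum f n) <= A * (1 - r ^ n) / (1 - r).
Proof.
  intros Hr H. induction n as [|n IH]; simpl.
  - rewrite Cmod_0. replace (A * (1 - 1) / (1 - r)) with 0 by (field; lra). lra.
  - eapply Rle_trans; [apply Cmod_triangle|].
    replace (A * (1 - r * r ^ n) / (1 - r))
      with (A * (1 - r ^ n) / (1 - r) + A * r ^ n) by (field; lra).
    specialize (H n). lra.
Qed.

Lemma clim_ext (u v : nat -> C) (l : C) :
  (forall n, u n = v n) -> clim u l -> clim v l.
Proof.
  intros E H eps He. destruct (H eps He) as [N HN]. exists N. intros n Hn.
  rewrite <- E. auto.
Qed.

Lemma clim_const (c : C) : clim (fun _ => c) c.
Proof. intros eps He. exists 0%nat. intros n _. replace (c - c)%C with (RtoC 0) by ring.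
  rewrite Cmod_0; exact He. Qed.

Lemma clim_unique (u : nat -> C) (l l' : C) : clim u l -> clim u l' -> l = l'.
Proof.
  intros H H'. apply Ceq_minus, Cmod_eq_0.
  destruct (Rle_lt_or_eq_dec 0 _ (Cmod_ge_0 (l - l'))) as [Hp|Hp]; [|auto].
  destruct (H (Cmod (l - l') / 2)) as [N HN]; [lra|].
  destruct (H' (Cmod (l - l') / 2)) as [N' HN']; [lra|].
  specialize (HN (N + N')%nat ltac:(lia)). specialize (HN' (N + N')%nat ltac:(lia)).
  pose proof (Cmod_triangle3 l (u (N + N')%nat) l').
  rewrite (Cmod_sub_sym l (u (N + N')%nat)) in H0. lra.
Qed.

Lemma clim_plus (u v : nat -> C) (l m : C) :
  clim u l -> clim v m -> clim (fun n => u n + v n)%C (l + m)%C.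
Proof.
  intros H H' eps He.
  destruct (H (eps / 2)) as [N HN]; [lra|]. destruct (H' (eps / 2)) as [N' HN']; [lra|].
  exists (N + N')%nat. intros n Hn.
  replace (u n + v n - (l + m))%C with ((u n - l) + (v n - m))%C by ring.
  eapply Rle_lt_trans; [apply Cmod_triangle|].
  specialize (HN n ltac:(lia)). specialize (HN' n ltac:(lia)). lra.
Qed.

Lemma clim_scal (c : C) (u : nat -> C) (l : C) :
  clim u l -> clim (fun n => c * u n)%C (c * l)%C.
Proof.
  intros H eps He. pose proof (Cmod_ge_0 c) as Hc.
  destruct (H (eps / (Cmod c + 1))) as [N HN]; [apply Rdiv_lt_0_compat; lra|].
  exists N. intros n Hn. replace (c * u n - c * l)%C with (c * (u n - l))%C by ring.
  rewrite Cmod_mult. specialize (HN n Hn).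
  pose proof (Cmod_ge_0 (u n - l)).
  apply Rle_lt_trans with ((Cmod c + 1) * Cmod (u n - l)); [nra|].
  replace eps with ((Cmod c + 1) * (eps / (Cmod c + 1))) by (field; lra).
  apply Rmult_lt_compat_l; lra.
Qed.

Lemma clim_minus (u v : nat -> C) (l m : C) :
  clim u l -> clim v m -> clim (fun n => u n - v n)%C (l - m)%C.
Proof.
  intros H H'. pose proof (clim_plus _ _ _ _ H (clim_scal (-1) _ _ H')) as P.
  replace (l - m)%C with (l + -1 * m)%C by ring.
  eapply clim_ext; [|exact P]. intros n; simpl; ring.
Qed.

Lemma clim_shift (u : nat -> C) (l : C) : clim u l -> clim (fun n => u (S n)) l.
Proof.
  intros H eps He. destruct (H eps He) as [N HN]. exists N. intros n Hn. apply HN; lia.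
Qed.

Lemma clim_unshift (u : nat -> C) (l : C) : clim (fun n => u (S n)) l -> clim u l.
Proof.
  intros H eps He. destruct (H eps He) as [N HN]. exists (S N). intros n Hn.
  destruct n as [|n]; [lia|]. apply HN; lia.
Qed.

Lemma clim_subseq (u : nat -> C) (l : C) (s : nat -> nat) :
  (forall n, (n <= s n)%nat) -> clim u l -> clim (fun n => u (s n)) l.
Proof.
  intros Hs H eps He. destruct (H eps He) as [N HN]. exists N. intros n Hn.
  apply HN. specialize (Hs n); lia.
Qed.

Lemma clim_le (u : nat -> C) (l : C) (B : R) :
  clim u l -> (forall n, Cmod (u n) <= B) -> Cmod l <= B.
Proof.
  intros H HB. apply Rnot_lt_le. intros Hlt.
  destruct (H (Cmod l - B)) as [N HN]; [lra|]. specialize (HN N (le_n _)). specialize (HB N).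
  pose proof (Cmod_rev_triangle l (u N)). rewrite (Cmod_sub_sym l) in H0. lra.
Qed.

Lemma clim_dist (u v : nat -> C) (l : C) :
  clim u l -> clim (fun n => v n - u n)%C 0%C -> clim v l.
Proof.
  intros H H'. pose proof (clim_plus _ _ _ _ H H') as P.
  replace l with (l + 0)%C by ring. eapply clim_ext; [|exact P]. intros; simpl; ring.
Qed.

Lemma clim_bounded (u : nat -> C) (l : C) :
  clim u l -> exists B, 0 <= B /\ forall n, Cmod (u n) <= B.
Proof.
  intros H. destruct (H 1) as [N HN]; [lra|].
  assert (Hf : forall M, exists B, 0 <= B /\ forall n, (n < M)%nat -> Cmod (u n) <= B).
  { induction M as [|M [B [HB0 HB]]]; [exists 0; split; [lra|intros; lia]|].
    exists (Rmax B (Cmod (u M))). split; [eapply Rle_trans; [exact HB0|apply Rmax_l]|].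
    intros n Hn. destruct (Nat.eq_dec n M) as [->|]; [apply Rmax_r|].
    eapply Rle_trans; [apply HB; lia|apply Rmax_l]. }
  destruct (Hf N) as [B [HB0 HB]]. exists (Rmax B (Cmod l + 1)).
  split; [eapply Rle_trans; [exact HB0|apply Rmax_l]|]. intros n.
  destruct (le_lt_dec N n) as [Hn|Hn].
  - eapply Rle_trans; [|apply Rmax_r]. pose proof (Cmod_rev_triangle (u n) l).
    specialize (HN n Hn). lra.
  - eapply Rle_trans; [apply HB; exact Hn|apply Rmax_l].
Qed.

Lemma clim_mult (u v : nat -> C) (l m : C) :
  clim u l -> clim v m -> clim (fun n => u n * v n)%C (l * m)%C.
Proof.
  intros H H'. destruct (clim_bounded _ _ H') as [B [HB0 HB]].
  apply clim_dist with (fun n => l * v n)%C; [apply clim_scal; exact H'|].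
  intros eps He. destruct (H (eps / (B + 1))) as [N HN]; [apply Rdiv_lt_0_compat; lra|].
  exists N. intros n Hn. replace (u n * v n - l * v n - 0)%C with ((u n - l) * v n)%C by ring.
  rewrite Cmod_mult. specialize (HN n Hn). specialize (HB n).
  pose proof (Cmod_ge_0 (u n - l)). pose proof (Cmod_ge_0 (v n)).
  apply Rle_lt_trans with (Cmod (u n - l) * (B + 1)); [nra|].
  replace eps with (eps / (B + 1) * (B + 1)) by (field; lra).
  apply Rmult_lt_compat_r; lra.
Qed.

Lemma sum_n_csum (a : nat -> C) (n : nat) :
  @sum_n C_AbelianMonoid a n = csum a (S n).
Proof.
  induction n as [|n IH].
  - rewrite sum_O. simpl. ring.
  - rewrite sum_Sn, IH. reflexivity.
Qed.

(** Balls in [C] are squares, taken coordinatewise, while [clim] uses the modulus; the two are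
    comparable up to the factor [sqrt 2]. *)
Lemma filterlim_clim (u : nat -> C) (l : C) :
  filterlim u eventually (@locally C_UniformSpace l) <-> clim u l.
Proof.
  split; intros H.
  - intros eps He.
    assert (Hs : 0 < eps / sqrt 2) by (apply Rdiv_lt_0_compat; [lra|apply sqrt_lt_R0; lra]).
    destruct (H (fun y => ball l (mkposreal _ Hs) y)) as [N HN].
    { exists (mkposreal _ Hs). auto. }
    exists N. intros n Hn. pose proof (C_NormedModule_mixin_compat2 l (u n) (mkposreal _ Hs) (HN n Hn)) as P.
    simpl in P. replace eps with (sqrt 2 * (eps / sqrt 2)).
    + exact P.
    + field. apply Rgt_not_eq, sqrt_lt_R0; lra.
  - intros P [eps HP]. destruct (H eps (cond_pos eps)) as [N HN]. exists N. intros n Hn.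
    apply HP, C_NormedModule_mixin_compat1. apply (HN n Hn).
Qed.

Lemma is_series_cser (a : nat -> C) (l : C) :
  @is_series C_AbsRing C_NormedModule a l <-> cser a l.
Proof.
  unfold is_series, cser. split; intros H.
  - apply clim_unshift. apply filterlim_clim.
    eapply filterlim_ext; [|exact H]. intros n; simpl. apply sum_n_csum.
  - apply (filterlim_ext (fun n => csum a (S n))).
    + intros n; symmetry; apply sum_n_csum.
    + apply filterlim_clim. apply clim_shift; exact H.
Qed.

Lemma cser_ext (a b : nat -> C) (l : C) :
  (forall n, a n = b n) -> cser a l -> cser b l.
Proof. intros E. apply clim_ext. intros n. apply csum_ext. auto. Qed.

Lemma cser_plus (a b : nat -> C) (l m : C) :
  cser a l -> cser b m -> cser (fun n => a n + b n)%C (l + m)%C.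
Proof.
  intros H H'. eapply clim_ext; [|exact (clim_plus _ _ _ _ H H')].
  intros n; simpl; symmetry; apply csum_plus.
Qed.

Lemma cser_scal (c : C) (a : nat -> C) (l : C) :
  cser a l -> cser (fun n => c * a n)%C (c * l)%C.
Proof.
  intros H. eapply clim_ext; [|exact (clim_scal c _ _ H)].
  intros n; simpl; symmetry; apply csum_scal.
Qed.

Lemma cser_minus (a b : nat -> C) (l m : C) :
  cser a l -> cser b m -> cser (fun n => a n - b n)%C (l - m)%C.
Proof.
  intros H H'. pose proof (cser_plus _ _ _ _ H (cser_scal (-1) _ _ H')) as P.
  replace (l - m)%C with (l + -1 * m)%C by ring.
  eapply cser_ext; [|exact P]. intros n; simpl; ring.
Qed.

Lemma cser_shift (a : nat -> C) (l : C) :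
  cser a l -> cser (fun n => a (S n)) (l - a 0%nat)%C.
Proof.
  intros H. apply clim_ext with (fun n => csum a (S n) - a 0%nat)%C.
  - intros n. rewrite csum_Sl. ring.
  - apply clim_minus; [apply clim_shift; exact H | apply clim_const].
Qed.

Lemma cser_unshift (a : nat -> C) (l : C) :
  cser (fun n => a (S n)) l -> cser a (a 0%nat + l)%C.
Proof.
  intros H. apply clim_unshift.
  apply clim_ext with (fun n => a 0%nat + csum (fun k => a (S k)) n)%C.
  - intros n. rewrite csum_Sl. ring.
  - apply clim_plus; [apply clim_const | exact H].
Qed.

Definition geo (A r : R) (a : nat -> C) : Prop :=
  0 <= r < 1 /\ forall n, Cmod (a n) <= A * r ^ n.

Lemma geo_A_nonneg (A r : R) (a : nat -> C) : geo A r a -> 0 <= A.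
Proof. intros [_ H]. specialize (H 0%nat). pose proof (Cmod_ge_0 (a 0%nat)). simpl in H. lra. Qed.

Lemma geo_cser (A r : R) (a : nat -> C) : geo A r a -> exists l, cser a l.
Proof.
  intros [Hr H].
  assert (E : @ex_series C_AbsRing C_NormedModule a).
  { apply (@ex_series_le C_AbsRing C_CompleteNormedModule a (fun n => A * r ^ n)).
    - intros n. apply H.
    - assert (Hg : is_series (fun n => r ^ n) (/ (1 - r)))
        by (apply is_series_geom; rewrite Rabs_pos_eq; lra).
      exists (A * / (1 - r)). exact (@is_series_scal_l _ R_NormedModule A _ _ Hg). }
  destruct E as [l Hl]. exists l. apply is_series_cser; exact Hl.
Qed.

Lemma cser_le (A r : R) (a : nat -> C) (l : C) :
  geo A r a -> cser a l -> Cmod l <= A / (1 - r).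
Proof.
  intros G H. pose proof (geo_A_nonneg _ _ _ G). destruct G as [Hr HG].
  apply (clim_le _ _ _ H). intros n.
  eapply Rle_trans; [apply (csum_geom_bound a A r n Hr HG)|].
  unfold Rdiv. apply Rmult_le_compat_r; [apply Rlt_le, Rinv_0_lt_compat; lra|].
  assert (0 <= r ^ n) by (apply pow_le; lra). nra.
Qed.

Lemma cser_drop (a : nat -> C) (l : C) (n : nat) :
  cser a l -> cser (fun k => a (n + k)%nat) (l - csum a n)%C.
Proof.
  intros H. apply clim_ext with (fun m => csum a (n + m) - csum a n)%C.
  - intros m. rewrite csum_add. ring.
  - apply clim_minus; [|apply clim_const].
    apply (clim_subseq _ _ (fun m => (n + m)%nat)); [intros; lia | exact H].
Qed.

Lemma cser_rem (A r : R) (a : nat -> C) (l : C) (n : nat) :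
  geo A r a -> cser a l -> Cmod (l - csum a n) <= A * r ^ n / (1 - r).
Proof.
  intros [Hr H] Hl. apply (cser_le (A * r ^ n) r (fun k => a (n + k)%nat)).
  - split; [exact Hr|]. intros k. rewrite Rmult_assoc, <- pow_add. apply H.
  - apply cser_drop; exact Hl.
Qed.

(** * The exponential function and complex derivatives *)

Lemma Ceq (x y : C) : Re x = Re y -> Im x = Im y -> x = y.
Proof. destruct x, y; simpl; intros -> ->; reflexivity. Qed.

Lemma cexp_pair (w : C) :
  cexp w = (exp (Re w) * cos (Im w), exp (Re w) * sin (Im w)).
Proof. unfold cexp. apply Ceq; simpl; ring. Qed.

Lemma cexp_add (x y : C) : cexp (x + y) = (cexp x * cexp y)%C.
Proof.
  rewrite !cexp_pair, re_plus, im_plus, exp_plus, cos_plus, sin_plus.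
  apply Ceq; simpl; ring.
Qed.

Lemma cexp_0 : cexp 0 = 1%C.
Proof. rewrite cexp_pair. simpl. rewrite exp_0, cos_0, sin_0. apply Ceq; simpl; ring. Qed.

Lemma Cmod_cexp (w : C) : Cmod (cexp w) = exp (Re w).
Proof.
  rewrite cexp_pair. unfold Cmod. simpl fst; simpl snd.
  replace (_ + _) with (exp (Re w) ^ 2).
  - apply sqrt_pow2. apply Rlt_le, exp_pos.
  - pose proof (sin2_cos2 (Im w)) as E. unfold Rsqr in E.
    transitivity (exp (Re w) ^ 2 * (sin (Im w) * sin (Im w) + cos (Im w) * cos (Im w)));
      [rewrite E; ring | ring].
Qed.

Lemma cexp_neq_0 (w : C) : cexp w <> 0%C.
Proof. apply Cmod_gt_0. rewrite Cmod_cexp. apply exp_pos. Qed.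

Lemma cexp_opp (w : C) : cexp (- w) = (/ cexp w)%C.
Proof.
  pose proof (cexp_neq_0 w). assert (E : (cexp (- w) * cexp w = 1)%C).
  { rewrite <- cexp_add. replace (- w + w)%C with (RtoC 0) by ring. apply cexp_0. }
  replace (cexp (- w))%C with (cexp (- w) * cexp w / cexp w)%C by (field; auto).
  rewrite E. field; auto.
Qed.

Lemma cexp_pow (w : C) (n : nat) : (cexp w ^ n)%C = cexp (INR n * w).
Proof.
  induction n as [|n IH].
  - simpl Cpow. replace (INR 0 * w)%C with (RtoC 0) by (simpl; ring). symmetry; apply cexp_0.
  - rewrite Cpow_S, IH, <- cexp_add, S_INR, RtoC_plus. f_equal. ring.
Qed.

Lemma Cmod_pair_sq (x y : R) : Cmod (x, y) * Cmod (x, y) = x * x + y * y.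
Proof. unfold Cmod; simpl. rewrite sqrt_sqrt; nra. Qed.

(** A plane curve has no exact mean value theorem. The real one is applied to the scalar product of
    the curve with its total increment [(a, b)], and Cauchy-Schwarz removes one factor
    [|(a, b)|]. *)
Lemma mean_value_ineq (g1 g2 d1 d2 : R -> R) (M : R) :
  (forall t, 0 <= t <= 1 -> is_derive g1 t (d1 t)) ->
  (forall t, 0 <= t <= 1 -> is_derive g2 t (d2 t)) ->
  (forall t, 0 <= t <= 1 -> Cmod (d1 t, d2 t) <= M) ->
  Cmod (g1 1 - g1 0, g2 1 - g2 0) <= M.
Proof.
  intros H1 H2 HM. set (a := g1 1 - g1 0). set (b := g2 1 - g2 0).
  assert (HD : forall t, 0 <= t <= 1 ->
    is_derive (fun t => a * g1 t + b * g2 t) t (a * d1 t + b * d2 t)).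
  { intros t Ht. apply (is_derive_plus (V := R_NormedModule)).
    - apply is_derive_scal, H1, Ht.
    - apply is_derive_scal, H2, Ht. }
  destruct (MVT_gen (fun t => a * g1 t + b * g2 t) 0 1 (fun t => a * d1 t + b * d2 t))
    as [c [Hc E]]; rewrite ?Rmin_left, ?Rmax_right in * by lra.
  - intros x Hx. apply HD; lra.
  - intros x Hx. apply continuity_pt_filterlim.
    apply (ex_derive_continuous (fun t => a * g1 t + b * g2 t)).
    eexists; apply HD; exact Hx.
  - specialize (HM c Hc). pose proof (Cmod_pair_sq a b) as Sab.
    pose proof (Cmod_pair_sq (d1 c) (d2 c)) as Sd.
    pose proof (Cmod_ge_0 (a, b)) as P1. pose proof (Cmod_ge_0 (d1 c, d2 c)) as P2.
    set (N := Cmod (a, b)) in *. set (D := Cmod (d1 c, d2 c)) in *.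
    assert (E2 : N * N = a * d1 c + b * d2 c) by (rewrite Sab; unfold a, b in *; lra).
    assert (CS : (a * d1 c + b * d2 c) <= N * D).
    { apply Rsqr_incr_0_var; [unfold Rsqr | nra].
      replace (N * D * (N * D)) with ((N * N) * (D * D)) by ring. rewrite Sab, Sd.
      pose proof (Rle_0_sqr (a * d2 c - b * d1 c)). unfold Rsqr in *. nra. }
    destruct (Rle_lt_or_eq_dec 0 N P1) as [HN|HN]; [|lra].
    apply Rle_trans with D; [|exact HM]. apply Rmult_le_reg_l with N; [exact HN|]. lra.
Qed.

Lemma Re_le_Cmod (w : C) : Re w <= Cmod w.
Proof. eapply Rle_trans; [apply Rle_abs | apply re_le_Cmod]. Qed.

Lemma Cmod_cexp_le (w : C) : Cmod (cexp w) <= exp (Cmod w).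
Proof.
  rewrite Cmod_cexp. destruct (Rle_lt_or_eq_dec _ _ (Re_le_Cmod w)) as [H| ->]; [|lra].
  apply Rlt_le, exp_increasing, H.
Qed.

Lemma exp_mono (x y : R) : x <= y -> exp x <= exp y.
Proof. intros [H| ->]; [apply Rlt_le, exp_increasing, H | lra]. Qed.

Lemma Cmod_scal_le (t : R) (v : C) : 0 <= t <= 1 -> Cmod (t * v) <= Cmod v.
Proof.
  intros Ht. rewrite Cmod_mult, Cmod_R, Rabs_pos_eq by lra.
  pose proof (Cmod_ge_0 v). nra.
Qed.

Lemma cexp_bound0 (v : C) : Cmod (cexp v - 1) <= Cmod v * exp (Cmod v).
Proof.
  destruct v as [a b]. set (v := (a, b)).
  pose proof (mean_value_ineq (fun t => exp (t * a) * cos (t * b))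
    (fun t => exp (t * a) * sin (t * b))
    (fun t => Re (v * cexp (t * v))) (fun t => Im (v * cexp (t * v)))
    (Cmod v * exp (Cmod v))) as H.
  replace (cexp v - 1)%C with (exp (1 * a) * cos (1 * b) - exp (0 * a) * cos (0 * b),
    exp (1 * a) * sin (1 * b) - exp (0 * a) * sin (0 * b)).
  - apply H; intros t Ht.
    + auto_derive; [auto|]. rewrite cexp_pair. unfold v; simpl.
      rewrite !Rmult_0_l, !Rminus_0_r, !Rplus_0_r. ring.
    + auto_derive; [auto|]. rewrite cexp_pair. unfold v; simpl.
      rewrite !Rmult_0_l, !Rminus_0_r, !Rplus_0_r. ring.
    + change (Cmod (v * cexp (t * v)) <= Cmod v * exp (Cmod v)). rewrite Cmod_mult.
      apply Rmult_le_compat_l; [apply Cmod_ge_0|].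
      eapply Rle_trans; [apply Cmod_cexp_le | apply exp_mono, Cmod_scal_le, Ht].
  - rewrite cexp_pair. unfold v; simpl.
    rewrite !Rmult_0_l, !Rmult_1_l, exp_0, cos_0, sin_0. apply Ceq; simpl; ring.
Qed.

(** Along [t v] the remainder has derivative [v] times the remainder of one order less, so each
    bound follows from the preceding one by [mean_value_ineq]; the factorials are given up. *)
Lemma cexp_bound1 (v : C) : Cmod (cexp v - 1 - v) <= Cmod v ^ 2 * exp (Cmod v).
Proof.
  destruct v as [a b]. set (v := (a, b)).
  pose proof (mean_value_ineq (fun t => exp (t * a) * cos (t * b) - t * a)
    (fun t => exp (t * a) * sin (t * b) - t * b)
    (fun t => Re (v * (cexp (t * v) - 1))) (fun t => Im (v * (cexp (t * v) - 1)))
    (Cmod v ^ 2 * exp (Cmod v))) as H.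
  replace (cexp v - 1 - v)%C with
    (exp (1 * a) * cos (1 * b) - 1 * a - (exp (0 * a) * cos (0 * b) - 0 * a),
    exp (1 * a) * sin (1 * b) - 1 * b - (exp (0 * a) * sin (0 * b) - 0 * b)).
  - apply H; intros t Ht.
    + auto_derive; [auto|]. rewrite cexp_pair. unfold v; simpl.
      rewrite !Rmult_0_l, !Rminus_0_r, !Rplus_0_r. ring.
    + auto_derive; [auto|]. rewrite cexp_pair. unfold v; simpl.
      rewrite !Rmult_0_l, !Rminus_0_r, !Rplus_0_r. ring.
    + change (Cmod (v * (cexp (t * v) - 1)) <= Cmod v ^ 2 * exp (Cmod v)). rewrite Cmod_mult.
      simpl pow. rewrite Rmult_1_r, Rmult_assoc.
      apply Rmult_le_compat_l; [apply Cmod_ge_0|].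
      eapply Rle_trans; [apply cexp_bound0 |].
      pose proof (Cmod_scal_le t v Ht). apply Rmult_le_compat; auto using Cmod_ge_0, exp_mono.
      apply Rlt_le, exp_pos.
  - rewrite cexp_pair. unfold v; simpl.
    rewrite !Rmult_0_l, !Rmult_1_l, exp_0, cos_0, sin_0. apply Ceq; simpl; ring.
Qed.

Lemma cexp_bound2 (v : C) :
  Cmod (cexp v - 1 - v - v ^ 2 / 2) <= Cmod v ^ 3 * exp (Cmod v).
Proof.
  destruct v as [a b]. set (v := (a, b)).
  pose proof (mean_value_ineq
    (fun t => exp (t * a) * cos (t * b) - t * a - t ^ 2 * (a * a - b * b) / 2)
    (fun t => exp (t * a) * sin (t * b) - t * b - t ^ 2 * (a * b))
    (fun t => Re (v * (cexp (t * v) - 1 - t * v))) (fun t => Im (v * (cexp (t * v) - 1 - t * v)))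
    (Cmod v ^ 3 * exp (Cmod v))) as H.
  replace (cexp v - 1 - v - v ^ 2 / 2)%C with
    (exp (1 * a) * cos (1 * b) - 1 * a - 1 ^ 2 * (a * a - b * b) / 2 -
     (exp (0 * a) * cos (0 * b) - 0 * a - 0 ^ 2 * (a * a - b * b) / 2),
    exp (1 * a) * sin (1 * b) - 1 * b - 1 ^ 2 * (a * b) -
     (exp (0 * a) * sin (0 * b) - 0 * b - 0 ^ 2 * (a * b))).
  - apply H; intros t Ht.
    + auto_derive; [auto|]. rewrite cexp_pair. unfold v; simpl.
      rewrite !Rmult_0_l, !Rminus_0_r, !Rplus_0_r. field.
    + auto_derive; [auto|]. rewrite cexp_pair. unfold v; simpl.
      rewrite !Rmult_0_l, !Rminus_0_r, !Rplus_0_r. ring.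
    + change (Cmod (v * (cexp (t * v) - 1 - t * v)) <= Cmod v ^ 3 * exp (Cmod v)).
      rewrite Cmod_mult.
      replace (Cmod v ^ 3 * exp (Cmod v)) with (Cmod v * (Cmod v ^ 2 * exp (Cmod v))) by ring.
      apply Rmult_le_compat_l; [apply Cmod_ge_0|].
      eapply Rle_trans; [apply cexp_bound1 |].
      pose proof (Cmod_scal_le t v Ht). apply Rmult_le_compat; auto using exp_mono.
      * apply pow_le, Cmod_ge_0.
      * apply Rlt_le, exp_pos.
      * apply pow_incr. split; [apply Cmod_ge_0 | auto].
  - rewrite cexp_pair. unfold v; simpl.
    rewrite !Rmult_0_l, !Rmult_1_l, exp_0, cos_0, sin_0. apply Ceq; simpl; field.
Qed.

(** * Complex differentiability *)

Definition cder (f : C -> C) (z l : C) : Prop :=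
  forall eps : R, 0 < eps -> exists delta : R, 0 < delta /\
    forall h, Cmod h < delta -> Cmod (f (z + h)%C - f z - l * h) <= eps * Cmod h.

Lemma cder_is_derive (f : C -> C) (z l : C) :
  cder f z l -> @is_derive C_AbsRing C_NormedModule f z l.
Proof.
  intros H. split; [apply is_linear_scal_l|].
  intros x Hx.
  apply (@is_filter_lim_locally_unique C_AbsRing (AbsRing_NormedModule C_AbsRing)) in Hx.
  subst x.
  intros eps. destruct (H eps (cond_pos eps)) as [delta [Hd HH]].
  exists (mkposreal _ Hd). intros y0 Hy.
  set (y := (y0 : C)). assert (Hm : Cmod (y - z) < delta) by exact Hy.
  specialize (HH (y - z)%C Hm). replace (z + (y - z))%C with y in HH by ring.
  replace (l * (y - z))%C with ((y - z) * l)%C in HH by ring. exact HH.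
Qed.

Lemma cder_const (c z : C) : cder (fun _ => c) z 0.
Proof.
  intros eps He. exists 1. split; [lra|]. intros h _.
  replace (c - c - 0 * h)%C with (RtoC 0) by ring. rewrite Cmod_0.
  pose proof (Cmod_ge_0 h). nra.
Qed.

Lemma cder_id (z : C) : cder (fun x => x) z 1.
Proof.
  intros eps He. exists 1. split; [lra|]. intros h _.
  replace (z + h - z - 1 * h)%C with (RtoC 0) by ring. rewrite Cmod_0.
  pose proof (Cmod_ge_0 h). nra.
Qed.

Lemma cder_lip (f : C -> C) (z l : C) : cder f z l ->
  exists delta, 0 < delta /\ forall h, Cmod h < delta ->
    Cmod (f (z + h)%C - f z) <= (Cmod l + 1) * Cmod h.
Proof.
  intros H. destruct (H 1) as [d [Hd HH]]; [lra|]. exists d. split; [exact Hd|].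
  intros h Hh. specialize (HH h Hh).
  replace (f (z + h)%C - f z)%C with ((f (z + h)%C - f z - l * h) + l * h)%C by ring.
  eapply Rle_trans; [apply Cmod_triangle|]. rewrite Cmod_mult. lra.
Qed.

Lemma cder_plus (f g : C -> C) (z l m : C) :
  cder f z l -> cder g z m -> cder (fun x => f x + g x)%C z (l + m)%C.
Proof.
  intros Hf Hg eps He. destruct (Hf (eps / 2)) as [d [Hd H]]; [lra|].
  destruct (Hg (eps / 2)) as [d' [Hd' H']]; [lra|].
  exists (Rmin d d'). split; [apply Rmin_pos; auto|]. intros h Hh.
  specialize (H h (Rlt_le_trans _ _ _ Hh (Rmin_l _ _))).
  specialize (H' h (Rlt_le_trans _ _ _ Hh (Rmin_r _ _))).
  replace (f (z + h)%C + g (z + h)%C - (f z + g z) - (l + m) * h)%C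
    with ((f (z + h)%C - f z - l * h) + (g (z + h)%C - g z - m * h))%C by ring.
  eapply Rle_trans; [apply Cmod_triangle|]. lra.
Qed.

(** The form in which the exponential, the inverse and power series supply their remainders. *)
Lemma cder_quad (f : C -> C) (z l : C) (K d : R) : 0 < d -> 0 <= K ->
  (forall h, Cmod h < d -> Cmod (f (z + h)%C - f z - l * h) <= K * Cmod h ^ 2) ->
  cder f z l.
Proof.
  intros Hd HK H eps He. exists (Rmin d (eps / (K + 1))).
  split; [apply Rmin_pos; [auto | apply Rdiv_lt_0_compat; lra]|].
  intros h Hh. pose proof (Rmin_l d (eps / (K + 1))). pose proof (Rmin_r d (eps / (K + 1))).
  eapply Rle_trans; [apply H; lra|]. pose proof (Cmod_ge_0 h).
  assert (Hl : (K + 1) * Cmod h <= eps).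
  { replace eps with ((K + 1) * (eps / (K + 1))) by (field; lra).
    apply Rmult_le_compat_l; lra. }
  simpl. rewrite Rmult_1_r, <- Rmult_assoc. apply Rmult_le_compat_r; nra.
Qed.

Lemma cder_cexp (z : C) : cder cexp z (cexp z).
Proof.
  apply (cder_quad _ _ _ (Cmod (cexp z) * exp 1) 1); [lra| |].
  - apply Rmult_le_pos; [apply Cmod_ge_0 | apply Rlt_le, exp_pos].
  - intros h Hh. rewrite cexp_add.
    replace (cexp z * cexp h - cexp z - cexp z * h)%C with (cexp z * (cexp h - 1 - h))%C by ring.
    rewrite Cmod_mult, Rmult_assoc. apply Rmult_le_compat_l; [apply Cmod_ge_0|].
    eapply Rle_trans; [apply cexp_bound1|]. rewrite Rmult_comm.
    apply Rmult_le_compat_r; [apply pow_le, Cmod_ge_0 | apply exp_mono; lra].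
Qed.

Lemma cder_comp (f g : C -> C) (z l m : C) :
  cder f (g z)%C l -> cder g z m -> cder (fun x => f (g x)) z (l * m)%C.
Proof.
  intros Hf Hg eps He.
  destruct (cder_lip _ _ _ Hg) as [d0 [Hd0 L]].
  pose proof (Cmod_ge_0 l) as Pl. pose proof (Cmod_ge_0 m) as Pm.
  set (e1 := eps / (2 * (Cmod m + 1))). set (e2 := eps / (2 * (Cmod l + 1))).
  assert (He1 : 0 < e1) by (apply Rdiv_lt_0_compat; lra).
  assert (He2 : 0 < e2) by (apply Rdiv_lt_0_compat; lra).
  destruct (Hf e1 He1) as [d1 [Hd1 H1]]. destruct (Hg e2 He2) as [d2 [Hd2 H2]].
  exists (Rmin d0 (Rmin d2 (d1 / (Cmod m + 1)))).
  assert (Hq : 0 < d1 / (Cmod m + 1)) by (apply Rdiv_lt_0_compat; lra).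
  split; [repeat apply Rmin_pos; auto|]. intros h Hh.
  assert (Hh0 : Cmod h < d0) by (eapply Rlt_le_trans; [exact Hh | apply Rmin_l]).
  assert (Hh2 : Cmod h < d2).
  { eapply Rlt_le_trans; [exact Hh|]. eapply Rle_trans; [apply Rmin_r | apply Rmin_l]. }
  assert (Hh1 : Cmod h < d1 / (Cmod m + 1)).
  { eapply Rlt_le_trans; [exact Hh|]. eapply Rle_trans; [apply Rmin_r | apply Rmin_r]. }
  specialize (L h Hh0). specialize (H2 h Hh2).
  set (k := (g (z + h)%C - g z)%C) in *.
  assert (Hk : Cmod k < d1).
  { eapply Rle_lt_trans; [exact L|].
    replace d1 with ((Cmod m + 1) * (d1 / (Cmod m + 1))) by (field; lra).
    apply Rmult_lt_compat_l; lra. }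
  specialize (H1 k Hk). replace (g z + k)%C with (g (z + h)%C) in H1 by (unfold k; ring).
  replace (f (g (z + h)%C)%C - f (g z)%C - l * m * h)%C
    with ((f (g (z + h)%C)%C - f (g z)%C - l * k) + l * (k - m * h))%C by ring.
  eapply Rle_trans; [apply Cmod_triangle|]. rewrite Cmod_mult.
  pose proof (Cmod_ge_0 h).
  apply Rle_trans with (e1 * ((Cmod m + 1) * Cmod h) + (Cmod l + 1) * (e2 * Cmod h)).
  - apply Rplus_le_compat.
    + eapply Rle_trans; [exact H1|]. apply Rmult_le_compat_l; lra.
    + apply Rmult_le_compat; auto using Cmod_ge_0; lra.
  - right. unfold e1, e2. field. split; lra.
Qed.

Lemma cder_mult (f g : C -> C) (z l m : C) :
  cder f z l -> cder g z m -> cder (fun x => f x * g x)%C z (l * g z + f z * m)%C.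
Proof.
  intros Hf Hg eps He.
  destruct (cder_lip _ _ _ Hf) as [d0 [Hd0 L]].
  pose proof (Cmod_ge_0 (f z)) as Pf. pose proof (Cmod_ge_0 (g z)) as Pg.
  pose proof (Cmod_ge_0 l) as Pl. pose proof (Cmod_ge_0 m) as Pm.
  set (e1 := eps / (3 * (Cmod (g z) + 1))). set (e2 := eps / (3 * (Cmod (f z) + 1))).
  assert (He1 : 0 < e1) by (apply Rdiv_lt_0_compat; lra).
  assert (He2 : 0 < e2) by (apply Rdiv_lt_0_compat; lra).
  destruct (cder_lip _ _ _ Hg) as [d3 [Hd3 L3]].
  destruct (Hf e1 He1) as [d1 [Hd1 H1]]. destruct (Hg e2 He2) as [d2 [Hd2 H2]].
  set (e3 := eps / (3 * ((Cmod l + 1) * (Cmod m + 1)))).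
  assert (Hlm : 0 < (Cmod l + 1) * (Cmod m + 1)) by (apply Rmult_lt_0_compat; lra).
  assert (He3 : 0 < e3) by (apply Rdiv_lt_0_compat; lra).
  set (d := Rmin (Rmin d0 d1) (Rmin d2 (Rmin d3 e3))).
  exists d. split; [unfold d; repeat apply Rmin_pos; auto|]. intros h Hh.
  assert (Hle : d <= d0 /\ d <= d1 /\ d <= d2 /\ d <= d3 /\ d <= e3).
  { unfold d. pose proof (Rmin_l (Rmin d0 d1) (Rmin d2 (Rmin d3 e3))).
    pose proof (Rmin_r (Rmin d0 d1) (Rmin d2 (Rmin d3 e3))).
    pose proof (Rmin_l d0 d1). pose proof (Rmin_r d0 d1).
    pose proof (Rmin_l d2 (Rmin d3 e3)). pose proof (Rmin_r d2 (Rmin d3 e3)).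
    pose proof (Rmin_l d3 e3). pose proof (Rmin_r d3 e3). repeat split; lra. }
  specialize (L h ltac:(lra)). specialize (L3 h ltac:(lra)).
  specialize (H1 h ltac:(lra)). specialize (H2 h ltac:(lra)).
  replace (f (z + h)%C * g (z + h)%C - f z * g z - (l * g z + f z * m) * h)%C
    with ((f (z + h)%C - f z - l * h) * g z + f z * (g (z + h)%C - g z - m * h)
          + (f (z + h)%C - f z) * (g (z + h)%C - g z))%C by ring.
  pose proof (Cmod_ge_0 h) as Ph.
  eapply Rle_trans; [apply Cmod_triangle|].
  eapply Rle_trans; [apply Rplus_le_compat_r, Cmod_triangle|]. rewrite !Cmod_mult.
  apply Rle_trans with ((e1 * Cmod h) * (Cmod (g z) + 1) + (Cmod (f z) + 1) * (e2 * Cmod h)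
    + ((Cmod l + 1) * Cmod h) * ((Cmod m + 1) * e3)).
  - repeat apply Rplus_le_compat.
    + apply Rmult_le_compat; auto using Cmod_ge_0; lra.
    + apply Rmult_le_compat; auto using Cmod_ge_0; lra.
    + apply Rmult_le_compat; auto using Cmod_ge_0.
      eapply Rle_trans; [exact L3|]. apply Rmult_le_compat_l; lra.
  - right. unfold e1, e2, e3. field. repeat split; lra.
Qed.

Lemma cder_scal (c : C) (f : C -> C) (z l : C) :
  cder f z l -> cder (fun x => c * f x)%C z (c * l)%C.
Proof.
  intros H. replace (c * l)%C with (0 * f z + c * l)%C by ring.
  apply (cder_mult (fun _ => c)); [apply cder_const | exact H].
Qed.

Lemma cder_inv_id (z : C) : z <> 0%C -> cder (fun x => / x)%C z (- / (z * z))%C.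
Proof.
  intros Hz. pose proof (proj1 (Cmod_gt_0 z) Hz) as P.
  apply (cder_quad _ _ _ (2 / Cmod z ^ 3) (Cmod z / 2)); [lra| |].
  - apply Rlt_le, Rdiv_lt_0_compat; [lra | apply pow_lt; lra].
  - intros h Hh.
    assert (Hm : Cmod z / 2 <= Cmod (z + h)).
    { pose proof (Cmod_rev_triangle z (- h)). rewrite Cmod_opp in H.
      replace (z - - h)%C with (z + h)%C in H by ring. lra. }
    assert (Hzh : (z + h)%C <> 0%C) by (apply Cmod_gt_0; lra).
    replace (/ (z + h) - / z - - / (z * z) * h)%C with (h * h / (z * z * (z + h)))%C
      by (field; auto).
    rewrite Cmod_div by (repeat apply Cmult_neq_0; auto). rewrite !Cmod_mult.
    pose proof (Cmod_ge_0 h).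
    apply Rle_trans with (Cmod h * Cmod h / (Cmod z * Cmod z * (Cmod z / 2))).
    + unfold Rdiv at 1 2. apply Rmult_le_compat_l; [nra|].
      apply Rinv_le_contravar; [repeat apply Rmult_lt_0_compat; lra|].
      apply Rmult_le_compat_l; [nra | exact Hm].
    + right. field. lra.
Qed.

Lemma cder_ext (f g : C -> C) (z l : C) :
  (forall x, f x = g x) -> cder f z l -> cder g z l.
Proof.
  intros E H eps He. destruct (H eps He) as [d [Hd HH]]. exists d; split; [auto|].
  intros h Hh. rewrite <- !E. auto.
Qed.

Lemma cder_inv (f : C -> C) (z l : C) :
  f z <> 0%C -> cder f z l -> cder (fun x => / f x)%C z (- l / (f z * f z))%C.
Proof.
  intros Hz H. replace (- l / (f z * f z))%C with (- / (f z * f z) * l)%C by (field; auto).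
  apply (cder_comp (fun x => / x)%C); [apply cder_inv_id; auto | exact H].
Qed.

Lemma im_le_Cmod (w : C) : Rabs (Im w) <= Cmod w.
Proof. eapply Rle_trans; [apply (Rmax_r (Rabs (fst w))) | apply Rmax_Cmod]. Qed.

Lemma inH_near (z h : C) : Cmod h < Im z -> inH (z + h).
Proof.
  intros H. unfold inH. rewrite im_plus. pose proof (im_le_Cmod h) as P.
  apply Rabs_le_between in P. lra.
Qed.

Lemma cder_ext_H (f g : C -> C) (z l : C) : inH z ->
  (forall x, inH x -> f x = g x) -> cder f z l -> cder g z l.
Proof.
  intros Hz E H eps He. destruct (H eps He) as [d [Hd HH]].
  exists (Rmin d (Im z)). split; [apply Rmin_pos; auto|].
  intros h Hh. pose proof (Rmin_l d (Im z)). pose proof (Rmin_r d (Im z)).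
  rewrite <- !E; [apply HH; lra | exact Hz | apply inH_near; lra].
Qed.

(** This is what allows functional equations to be differentiated: two computations of one
    derivative must agree. *)
Lemma cder_unique (f : C -> C) (z l m : C) : cder f z l -> cder f z m -> l = m.
Proof.
  intros Hl Hm. apply Ceq_minus, Cmod_eq_0.
  destruct (Rle_lt_or_eq_dec 0 _ (Cmod_ge_0 (l - m))) as [P|P]; [|auto]. exfalso.
  destruct (Hl (Cmod (l - m) / 4)) as [d [Hd H]]; [lra|].
  destruct (Hm (Cmod (l - m) / 4)) as [d' [Hd' H']]; [lra|].
  set (e := Rmin d d' / 2). assert (He : 0 < e) by (pose proof (Rmin_pos d d' Hd Hd'); unfold e; lra).
  assert (Hc : Cmod (RtoC e) = e) by (rewrite Cmod_R, Rabs_pos_eq; lra).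
  pose proof (Rmin_l d d'). pose proof (Rmin_r d d').
  specialize (H (RtoC e) ltac:(rewrite Hc; unfold e in *; lra)).
  specialize (H' (RtoC e) ltac:(rewrite Hc; unfold e in *; lra)). rewrite Hc in *.
  pose proof (Cmod_triangle3 (l * e)%C (f (z + e)%C - f z)%C (m * e)%C) as T.
  rewrite (Cmod_sub_sym (l * e)%C (f (z + e)%C - f z)%C) in T.
  replace (l * e - m * e)%C with ((l - m) * e)%C in T by ring.
  rewrite Cmod_mult, Hc in T. nra.
Qed.

(* [Re (conj c * F)] is a real function with zero derivative along the segment,
   for [c] the difference of the end values. *)
Lemma cder_zero_const (F : C -> C) :
  (forall z, inH z -> cder F z 0) -> forall z z', inH z -> inH z' -> F z = F z'.
Proof.
  intros H z z' Hz Hz'. symmetry. apply Ceq_minus, Cmod_eq_0.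
  set (v := (z' - z)%C). set (c := (F z' - F z)%C).
  set (phi := fun t : R => Re (Cconj c * F (z + t * v)%C)).
  assert (HD : forall t, 0 <= t <= 1 -> is_derive phi t 0).
  { intros t Ht. apply is_derive_Reals. intros eps He.
    assert (Hin : inH (z + t * v)).
    { unfold inH, v in *. rewrite im_plus, im_scal_l. unfold Cminus. rewrite im_plus, im_opp. nra. }
    set (K := Cmod c * Cmod v + 1).
    assert (HK : 0 < K) by (unfold K; pose proof (Cmod_ge_0 c); pose proof (Cmod_ge_0 v); nra).
    destruct (H _ Hin (eps / (2 * K))) as [d [Hd HH]]; [apply Rdiv_lt_0_compat; lra|].
    assert (Hd' : 0 < d / (Cmod v + 1))
      by (apply Rdiv_lt_0_compat; pose proof (Cmod_ge_0 v); lra).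
    exists (mkposreal _ Hd'). intros h Hh0 Hh. simpl in Hh.
    assert (Hhv : Cmod (h * v) < d).
    { rewrite Cmod_mult, Cmod_R. pose proof (Cmod_ge_0 v). pose proof (Rabs_pos h).
      apply Rle_lt_trans with (Rabs h * (Cmod v + 1)); [nra|].
      replace d with (d / (Cmod v + 1) * (Cmod v + 1)) by (field; lra).
      apply Rmult_lt_compat_r; lra. }
    specialize (HH _ Hhv). replace (z + t * v + h * v)%C with (z + RtoC (t + h) * v)%C in HH
      by (rewrite RtoC_plus; ring).
    replace (F (z + RtoC (t + h) * v)%C - F (z + t * v)%C - 0 * (h * v))%C
      with (F (z + RtoC (t + h) * v)%C - F (z + t * v)%C)%C in HH by ring.
    rewrite Rminus_0_r. unfold Rdiv. rewrite Rabs_mult, Rabs_inv. unfold phi.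
    replace (Re (Cconj c * F (z + RtoC (t + h) * v)%C) - Re (Cconj c * F (z + t * v)%C))
      with (Re (Cconj c * (F (z + RtoC (t + h) * v)%C - F (z + t * v)%C))) by (simpl; ring).
    pose proof (re_le_Cmod (Cconj c * (F (z + RtoC (t + h) * v)%C - F (z + t * v)%C))) as RR.
    rewrite Cmod_mult, Cmod_conj in RR. rewrite Cmod_mult, Cmod_R in HH.
    pose proof (Rabs_pos_lt h Hh0) as Ph. pose proof (Cmod_ge_0 c). pose proof (Cmod_ge_0 v).
    apply Rle_lt_trans with (Cmod c * (eps / (2 * K) * (Rabs h * Cmod v)) * / Rabs h).
    - apply Rmult_le_compat_r; [apply Rlt_le, Rinv_0_lt_compat, Ph|].
      eapply Rle_trans; [exact RR|]. apply Rmult_le_compat_l; lra.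
    - replace (Cmod c * (eps / (2 * K) * (Rabs h * Cmod v)) * / Rabs h)
        with (eps * ((Cmod c * Cmod v) / (2 * K))) by (field; split; lra).
      rewrite <- (Rmult_1_r eps) at 2. apply Rmult_lt_compat_l; [lra|].
      apply Rmult_lt_reg_r with (2 * K); [lra|]. unfold Rdiv. rewrite Rmult_assoc, Rinv_l by lra.
      unfold K. nra. }
  destruct (MVT_gen phi 0 1 (fun _ => 0)) as [x [_ E]];
    rewrite ?Rmin_left, ?Rmax_right in * by lra.
  - intros x Hx; apply HD; lra.
  - intros x Hx. apply continuity_pt_filterlim.
    apply (ex_derive_continuous phi). eexists; apply HD; exact Hx.
  - unfold phi in E.
    replace (z + 1%R * v)%C with z' in E by (unfold v; ring).
    replace (z + 0%R * v)%C with z in E by ring.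
    assert (E2 : Re (Cconj c * c) = 0) by (unfold c at 2; simpl in E |- *; lra).
    pose proof (Cmod2_alt c) as Q. simpl in E2, Q. nra.
Qed.

(** * Expansions in powers of [q^(1/3)] *)

(* [ring] does not treat [RtoC x] as an atom when [x] contains numerals. *)
Ltac gen_RtoC := repeat match goal with
  | |- context [RtoC ?x] =>
      lazymatch x with IZR _ => fail | _ => generalize (RtoC x); intro end
  end.
Ltac Cring := gen_RtoC; ring.

Lemma pow_to_zero (r eps : R) : 0 <= r < 1 -> 0 < eps ->
  exists N, forall n, (N <= n)%nat -> r ^ n < eps.
Proof.
  intros Hr He. destruct (pow_lt_1_zero r) with (y := eps) as [N HN]; auto.
  - rewrite Rabs_pos_eq; lra.
  - exists N. intros n Hn. specialize (HN n Hn). rewrite Rabs_pos_eq in HN; auto.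
    apply pow_le; lra.
Qed.

(** [(1 - s^n) / (1 - s)] is the sum of [s^k] over [k < n], and each of these terms is at least
    [s^n]. *)
Lemma INR_pow_bound (s : R) (n : nat) : 0 <= s < 1 -> INR n * s ^ n <= / (1 - s).
Proof.
  intros Hs. assert (H : INR n * s ^ n <= (1 - s ^ n) / (1 - s)).
  { induction n as [|n IH].
    - simpl. right; field; lra.
    - rewrite S_INR. simpl pow.
      assert (P : 0 <= s ^ n) by (apply pow_le; lra).
      assert (Q : INR n * s ^ n * s <= INR n * s ^ n).
      { pose proof (pos_INR n). assert (0 <= INR n * s ^ n) by nra. nra. }
      replace ((1 - s * s ^ n) / (1 - s)) with ((1 - s ^ n) / (1 - s) + s ^ n) by (field; lra).
      nra. }
  eapply Rle_trans; [exact H|]. unfold Rdiv. rewrite <- (Rmult_1_l (/ (1 - s))) at 2.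
  apply Rmult_le_compat_r; [apply Rlt_le, Rinv_0_lt_compat; lra|].
  assert (P : 0 <= s ^ n) by (apply pow_le; lra). lra.
Qed.

Lemma csum_ones (k : nat) : csum (fun _ => 1%C) k = INR k.
Proof. induction k as [|k IH]; [reflexivity|]. cbn [csum]. rewrite IH, S_INR, RtoC_plus. ring. Qed.

Definition conv (a b : nat -> C) (n : nat) : C :=
  csum (fun k => a k * b (n - k)%nat)%C (S n).

Lemma csum_conv (a b : nat -> C) (N : nat) :
  csum (conv a b) N = csum (fun k => a k * csum b (N - k)%nat)%C N.
Proof.
  induction N as [|N IH]; [reflexivity|].
  simpl csum at 1. rewrite IH. unfold conv.
  replace (csum (fun k => a k * csum b (S N - k)%nat)%C (S N))
    with (csum (fun k => a k * csum b (N - k)%nat + a k * b (N - k)%nat)%C (S N)).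
  - rewrite csum_plus. f_equal. simpl. rewrite Nat.sub_diag. simpl. ring.
  - apply csum_ext. intros k Hk. replace (S N - k)%nat with (S (N - k)) by lia. simpl. ring.
Qed.

Lemma geo_weaken (A r A' r' : R) (a : nat -> C) :
  A <= A' -> r <= r' < 1 -> geo A r a -> geo A' r' a.
Proof.
  intros HA Hr G. pose proof (geo_A_nonneg _ _ _ G). destruct G as [Hr0 G]. split; [lra|].
  intros n. eapply Rle_trans; [apply G|]. apply Rmult_le_compat; auto.
  - apply pow_le; lra.
  - apply pow_incr; lra.
Qed.

(* Mertens: each term of [sum a_k (B_(N-k) - lb)] is [O(r^N)]. *)
Lemma cser_conv (A r : R) (a b : nat -> C) (la lb : C) :
  geo A r a -> geo A r b -> cser a la -> cser b lb -> cser (conv a b) (la * lb)%C.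
Proof.
  intros Ga Gb Ha Hb. pose proof (geo_A_nonneg _ _ _ Ga) as HA.
  apply clim_dist with (fun n => lb * csum a n)%C.
  { replace (la * lb)%C with (lb * la)%C by ring. apply clim_scal, Ha. }
  (* The error is of size [n r^n]; with [s = sqrt r] this is [(n s^n) s^n], a bounded factor times
     one that tends to 0. *)
  pose proof Ga as [Hr Ga']. set (s := sqrt r).
  assert (Hs : 0 <= s < 1).
  { split; [apply sqrt_pos|]. rewrite <- sqrt_1. apply sqrt_lt_1; lra. }
  assert (Hss : forall n, r ^ n = s ^ n * s ^ n).
  { intros n. rewrite <- Rpow_mult_distr. unfold s. rewrite sqrt_sqrt by lra. reflexivity. }
  set (K := A * (A / (1 - r)) / (1 - s) + 1).
  assert (HAr : 0 <= A / (1 - r)) by (apply Rdiv_le_0_compat; lra).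
  assert (HK : 0 < K).
  { unfold K. assert (0 <= A * (A / (1 - r)) / (1 - s)); [|lra].
    apply Rdiv_le_0_compat; [apply Rmult_le_pos; lra | lra]. }
  intros eps He. destruct (pow_to_zero s (eps / K) Hs) as [N HN]; [apply Rdiv_lt_0_compat; lra|].
  exists N. intros n Hn. rewrite csum_conv.
  replace (csum (fun k => a k * csum b (n - k)%nat)%C n - lb * csum a n - 0)%C
    with (csum (fun k => a k * (csum b (n - k)%nat - lb))%C n).
  2:{ rewrite <- csum_scal.
      rewrite (csum_ext (fun k => a k * (csum b (n - k)%nat - lb))%C
        (fun k => a k * csum b (n - k)%nat + (-1) * (lb * a k))%C) by (intros; ring).
      rewrite csum_plus, csum_scal. ring. }
  eapply Rle_lt_trans.
  { apply (csum_bound _ (A * (A / (1 - r)) * r ^ n)). intros k Hk.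
    rewrite Cmod_mult, Cmod_sub_sym.
    pose proof (cser_rem A r b lb (n - k) Gb Hb) as Q. specialize (Ga' k).
    replace (r ^ n) with (r ^ k * r ^ (n - k)) by (rewrite <- pow_add; f_equal; lia).
    replace (A * (A / (1 - r)) * (r ^ k * r ^ (n - k)))
      with ((A * r ^ k) * (A * r ^ (n - k) / (1 - r))) by (field; lra).
    apply Rmult_le_compat; auto using Cmod_ge_0. }
  rewrite Hss.
  pose proof (INR_pow_bound s n Hs) as Q. specialize (HN n Hn).
  assert (P : 0 <= s ^ n) by (apply pow_le; lra).
  apply Rle_lt_trans with (K * s ^ n).
  - replace (INR n * (A * (A / (1 - r)) * (s ^ n * s ^ n)))
      with ((A * (A / (1 - r))) * (INR n * s ^ n) * s ^ n) by ring.
    apply Rmult_le_compat_r; [exact P|].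
    apply Rle_trans with (A * (A / (1 - r)) * / (1 - s)); [|unfold K, Rdiv; lra].
    apply Rmult_le_compat_l; [apply Rmult_le_pos; lra | exact Q].
  - replace eps with (K * (eps / K)) by (field; lra). apply Rmult_lt_compat_l; lra.
Qed.

(** The local parameter [q^(1/3)]; the action of [W_3] is called [fr]. *)
Definition W (z : C) : C := qpow (1 / 3) z.

Lemma qpow_plus (x y : R) (z : C) : qpow (x + y) z = (qpow x z * qpow y z)%C.
Proof. unfold qpow. rewrite <- cexp_add. f_equal. rewrite Rmult_plus_distr_l, RtoC_plus. ring. Qed.

Lemma qpow_neq_0 (x : R) (z : C) : qpow x z <> 0%C.
Proof. apply cexp_neq_0. Qed.

Lemma qpow_opp (x : R) (z : C) : qpow (- x) z = (/ qpow x z)%C.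
Proof.
  unfold qpow. rewrite <- cexp_opp. f_equal.
  rewrite Ropp_mult_distr_r_reverse, RtoC_opp. Cring.
Qed.

Lemma qpow_INR (n : nat) (x : R) (z : C) : qpow (INR n * x) z = (qpow x z ^ n)%C.
Proof.
  unfold qpow. rewrite cexp_pow. f_equal.
  replace (2 * PI * (INR n * x)) with (INR n * (2 * PI * x)) by ring.
  rewrite RtoC_mult. Cring.
Qed.

Lemma qpow_W (n : nat) (z : C) : qpow (INR n / 3) z = (W z ^ n)%C.
Proof. unfold W. rewrite <- qpow_INR. f_equal. field. Qed.

Lemma Cmod_qpow (x : R) (z : C) : Cmod (qpow x z) = exp (- (2 * PI * x * Im z)).
Proof. unfold qpow. rewrite Cmod_cexp. f_equal. unfold Re, Im. simpl. ring. Qed.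

Lemma W_neq_0 (z : C) : W z <> 0%C.
Proof. apply qpow_neq_0. Qed.

Lemma exp_pow_INR (x : R) (n : nat) : exp (INR n * x) = exp x ^ n.
Proof.
  induction n as [|n IH]; [simpl; rewrite Rmult_0_l; apply exp_0|].
  rewrite S_INR, Rmult_plus_distr_r, exp_plus, IH, Rmult_1_l. simpl. ring.
Qed.

Definition rho (y : R) : R := exp (- (2 * PI / 3 * y)).

Lemma Cmod_W (z : C) : Cmod (W z) = rho (Im z).
Proof. unfold W, rho. rewrite Cmod_qpow. f_equal. field. Qed.

Lemma Cmod_W_pow (z : C) (n : nat) : Cmod (W z ^ n) = rho (Im z) ^ n.
Proof. rewrite Cmod_pow, Cmod_W. reflexivity. Qed.

Lemma rho_pos (y : R) : 0 < rho y.
Proof. apply exp_pos. Qed.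

Lemma rho_plus (x y : R) : rho (x + y) = rho x * rho y.
Proof. unfold rho. rewrite <- exp_plus. f_equal. ring. Qed.

Lemma rho_lt_1 (y : R) : 0 < y -> rho y < 1.
Proof.
  intros Hy. unfold rho. rewrite <- exp_0. apply exp_increasing.
  pose proof PI_RGT_0. assert (0 < 2 * PI / 3 * y) by (apply Rmult_lt_0_compat; lra). lra.
Qed.

Lemma rho_01 (y : R) : 0 < y -> 0 <= rho y < 1.
Proof. intros H. pose proof (rho_pos y). pose proof (rho_lt_1 y H). lra. Qed.

Lemma rho_half (y : R) : rho y = rho (y / 2) * rho (y / 2).
Proof. rewrite <- rho_plus. f_equal. field. Qed.

Lemma rho_anti (x y : R) : x <= y -> rho y <= rho x.
Proof.
  intros H. unfold rho. apply exp_mono. pose proof PI_RGT_0. apply Ropp_le_contravar.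
  apply Rmult_le_compat_l; lra.
Qed.

(** Only nonnegative exponents occur: a form with a pole enters as [W z ^ d * F z], or with its
    polar term subtracted. *)
Definition QS (a : nat -> C) (F : C -> C) : Prop :=
  forall z, inH z -> cser (fun n => a n * W z ^ n)%C (F z).

(** Bounded terms at every height are equivalent to convergence on the whole half-plane: the bound
    at height [y / 2] supplies the geometric factor [rho (y / 2) ^ n] at height [y]. *)
Definition adm (a : nat -> C) : Prop :=
  forall y, 0 < y -> exists A, 0 <= A /\ forall n, Cmod (a n) * rho y ^ n <= A.

Lemma cser_terms_bounded (a : nat -> C) (l : C) :
  cser a l -> exists B, 0 <= B /\ forall n, Cmod (a n) <= B.
Proof.
  intros H. destruct (clim_bounded _ _ H) as [B [HB0 HB]].
  exists (B + B). split; [lra|]. intros n.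
  pose proof (HB (S n)) as H1. pose proof (HB n) as H2. simpl csum in H1.
  replace (a n) with ((csum a n + a n) - csum a n)%C by ring.
  pose proof (Cmod_sub_le (csum a n + a n) (csum a n)). lra.
Qed.

Lemma inH_Ci (y : R) : 0 < y -> inH (RtoC y * Ci).
Proof. intros H. unfold inH. simpl. lra. Qed.

Lemma QS_adm (a : nat -> C) (F : C -> C) : QS a F -> adm a.
Proof.
  intros H y Hy. destruct (cser_terms_bounded _ _ (H _ (inH_Ci y Hy))) as [B [HB0 HB]].
  exists B. split; [exact HB0|]. intros n. specialize (HB n).
  rewrite Cmod_mult, Cmod_W_pow in HB. simpl Im in HB.
  replace (y * 1 + 0 * 0) with y in HB by ring. exact HB.
Qed.

Lemma adm_geo (a : nat -> C) (y : R) : adm a -> 0 < y ->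
  exists A, 0 <= A /\ forall n, Cmod (a n) * rho y ^ n <= A * rho (y / 2) ^ n.
Proof.
  intros H Hy. destruct (H (y / 2)) as [A [HA0 HA]]; [lra|]. exists A. split; [exact HA0|].
  intros n. rewrite rho_half, Rpow_mult_distr, <- Rmult_assoc.
  apply Rmult_le_compat_r; [apply pow_le, Rlt_le, rho_pos | apply HA].
Qed.

Lemma adm_geo_W (a : nat -> C) (z : C) : adm a -> inH z ->
  exists A, geo A (rho (Im z / 2)) (fun n => a n * W z ^ n)%C.
Proof.
  intros H Hz. destruct (adm_geo a (Im z) H Hz) as [A [HA0 HA]]. exists A. split.
  - apply rho_01. unfold inH in Hz. lra.
  - intros n. rewrite Cmod_mult, Cmod_W_pow. apply HA.
Qed.

Definition qsum (a : nat -> C) (z : C) : C :=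
  epsilon (inhabits (RtoC 0)) (cser (fun n => a n * W z ^ n)%C).

Lemma QS_qsum (a : nat -> C) : adm a -> QS a (qsum a).
Proof.
  intros H z Hz. unfold qsum. apply epsilon_spec. destruct (adm_geo_W a z H Hz) as [A G].
  exact (geo_cser _ _ _ G).
Qed.

Lemma adm_QS (a : nat -> C) : adm a -> exists F, QS a F.
Proof. intros H. exists (qsum a). apply QS_qsum, H. Qed.

Lemma adm_INR (a : nat -> C) : adm a -> adm (fun n => INR n * a n)%C.
Proof.
  intros H y Hy. destruct (adm_geo a y H Hy) as [A [HA0 HA]].
  assert (Hy2 : 0 < y / 2) by lra.
  exists (A * / (1 - rho (y / 2))). split.
  { apply Rmult_le_pos; [auto|]. apply Rlt_le, Rinv_0_lt_compat.
    pose proof (rho_lt_1 _ Hy2); lra. }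
  intros n. rewrite Cmod_mult, Cmod_R, Rabs_pos_eq by apply pos_INR.
  rewrite Rmult_assoc. eapply Rle_trans; [apply Rmult_le_compat_l; [apply pos_INR | apply HA]|].
  replace (INR n * (A * rho (y / 2) ^ n)) with (A * (INR n * rho (y / 2) ^ n)) by ring.
  apply Rmult_le_compat_l; [auto|]. apply INR_pow_bound, rho_01, Hy2.
Qed.

Lemma adm_pow_bound (a : nat -> C) (K : R) (d : nat) :
  (forall n, Cmod (a n) <= K * INR n ^ d) -> adm a.
Proof.
  revert a. induction d as [|d IH]; intros a H y Hy.
  - exists K. assert (HK : 0 <= K) by (specialize (H 0%nat); simpl in H;
      pose proof (Cmod_ge_0 (a 0%nat)); lra).
    split; [exact HK|]. intros n. specialize (H n). simpl in H. rewrite Rmult_1_r in H.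
    rewrite <- (Rmult_1_r K). apply Rmult_le_compat; auto using Cmod_ge_0.
    + apply pow_le, Rlt_le, rho_pos.
    + rewrite <- (pow1 n). apply pow_incr. pose proof (rho_01 y Hy). lra.
  - assert (HK : 0 <= K).
    { specialize (H 1%nat). simpl INR in H. rewrite pow1 in H.
      pose proof (Cmod_ge_0 (a 1%nat)). lra. }
    assert (Hb : adm (fun n => RtoC (K * INR n ^ d))).
    { apply IH. intros n. rewrite Cmod_R, Rabs_pos_eq; [lra|].
      apply Rmult_le_pos; [auto | apply pow_le, pos_INR]. }
    destruct (adm_INR _ Hb y Hy) as [A [HA0 HA]]. exists A. split; [exact HA0|].
    intros n. eapply Rle_trans; [|apply (HA n)].
    apply Rmult_le_compat_r; [apply pow_le, Rlt_le, rho_pos|].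
    rewrite Cmod_mult, !Cmod_R, !Rabs_pos_eq; [| |apply pos_INR].
    + eapply Rle_trans; [apply H|]. simpl. right; ring.
    + apply Rmult_le_pos; [auto | apply pow_le, pos_INR].
Qed.

Lemma QS_ext (a b : nat -> C) (F G : C -> C) :
  (forall n, a n = b n) -> (forall z, inH z -> F z = G z) -> QS a F -> QS b G.
Proof.
  intros E1 E2 H z Hz. rewrite <- E2 by auto. eapply cser_ext; [|apply H; exact Hz].
  intros n; simpl. rewrite E1. reflexivity.
Qed.

Lemma QS_plus (a b : nat -> C) (F G : C -> C) :
  QS a F -> QS b G -> QS (fun n => a n + b n)%C (fun z => F z + G z)%C.
Proof.
  intros H H' z Hz. eapply cser_ext; [|apply (cser_plus _ _ _ _ (H z Hz) (H' z Hz))].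
  intros n; simpl; ring.
Qed.

Lemma QS_scal (c : C) (a : nat -> C) (F : C -> C) :
  QS a F -> QS (fun n => c * a n)%C (fun z => c * F z)%C.
Proof.
  intros H z Hz. eapply cser_ext; [|apply (cser_scal c _ _ (H z Hz))].
  intros n; simpl; ring.
Qed.

Lemma QS_minus (a b : nat -> C) (F G : C -> C) :
  QS a F -> QS b G -> QS (fun n => a n - b n)%C (fun z => F z - G z)%C.
Proof.
  intros H H' z Hz. eapply cser_ext; [|apply (cser_minus _ _ _ _ (H z Hz) (H' z Hz))].
  intros n; simpl; ring.
Qed.

Lemma QS_mult (a b : nat -> C) (F G : C -> C) :
  QS a F -> QS b G -> QS (conv a b) (fun z => F z * G z)%C.
Proof.
  intros H H' z Hz.
  destruct (adm_geo_W a z (QS_adm _ _ H) Hz) as [A GA].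
  destruct (adm_geo_W b z (QS_adm _ _ H') Hz) as [B GB].
  assert (Hr : rho (Im z / 2) < 1) by (destruct GA; lra).
  eapply cser_ext; [|apply (cser_conv (Rmax A B) (rho (Im z / 2)) _ _ _ _
    (geo_weaken _ _ _ _ _ (Rmax_l A B) (conj (Rle_refl _) Hr) GA)
    (geo_weaken _ _ _ _ _ (Rmax_r A B) (conj (Rle_refl _) Hr) GB) (H z Hz) (H' z Hz))].
  intros n. unfold conv. rewrite Cmult_comm, <- csum_scal. apply csum_ext. intros k Hk.
  replace n with (k + (n - k))%nat at 3 by lia. rewrite Cpow_add_r. ring.
Qed.

Lemma QS_const (c : C) : QS (fun n => if Nat.eqb n 0 then c else 0%C) (fun _ => c).
Proof.
  intros z Hz. apply clim_unshift. eapply clim_ext; [|apply clim_const].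
  intros n. rewrite csum_Sl. rewrite csum_zero; simpl; [ring | intros; simpl; ring].
Qed.

Lemma QS_mul_W (a : nat -> C) (F : C -> C) : QS a F ->
  QS (fun n => match n with O => 0%C | S k => a k end) (fun z => W z * F z)%C.
Proof.
  intros H z Hz.
  pose proof (cser_unshift (fun n => match n with O => 0%C | S k => a k end * W z ^ n)%C
    (W z * F z)%C) as P.
  simpl in P. replace (0 * 1 + W z * F z)%C with (W z * F z)%C in P by ring.
  apply P. eapply cser_ext; [|apply (cser_scal (W z) _ _ (H z Hz))]. intros n; simpl; ring.
Qed.

Lemma QS_div_W (a : nat -> C) (F : C -> C) : QS a F -> a 0%nat = 0%C ->
  QS (fun n => a (S n)) (fun z => F z / W z)%C.
Proof.
  intros H H0 z Hz. pose proof (cser_scal (/ W z) _ _ (cser_shift _ _ (H z Hz))) as P.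
  simpl in P. rewrite H0 in P.
  replace (/ W z * (F z - 0 * 1))%C with (F z / W z)%C in P by (unfold Cdiv; ring).
  eapply cser_ext; [|exact P]. intros n; simpl. field. apply W_neq_0.
Qed.

Lemma QS_mul_Wn (k : nat) (a : nat -> C) (F : C -> C) : QS a F ->
  QS (fun n => if (n <? k)%nat then 0%C else a (n - k)%nat) (fun z => W z ^ k * F z)%C.
Proof.
  revert a F. induction k as [|k IH]; intros a F H.
  - eapply QS_ext; [| |exact H]; intros; simpl; [rewrite Nat.sub_0_r; reflexivity | ring].
  - eapply QS_ext; [| |apply (IH _ _ (QS_mul_W _ _ H))].
    + intros n. cbv beta.
      destruct (Nat.ltb_spec n k), (Nat.ltb_spec n (S k)); try lia; auto.
      * replace (n - k)%nat with 0%nat by lia. reflexivity.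
      * replace (n - k)%nat with (S (n - S k)) by lia. reflexivity.
    + intros; simpl; ring.
Qed.

Lemma QS_div_Wn (k : nat) (a : nat -> C) (F : C -> C) : QS a F ->
  (forall n, (n < k)%nat -> a n = 0%C) ->
  QS (fun n => a (n + k)%nat) (fun z => F z / W z ^ k)%C.
Proof.
  revert a F. induction k as [|k IH]; intros a F H H0.
  - eapply QS_ext; [| |exact H]; intros; simpl; [rewrite Nat.add_0_r; reflexivity | field].
  - eapply QS_ext; [| |apply (QS_div_W _ _ (IH a F H (fun n Hn => H0 n ltac:(lia))))].
    + intros n; simpl. f_equal. lia.
    + intros z Hz; simpl. field. split; [apply Cpow_nz|]; apply W_neq_0.
    + apply H0; lia.
Qed.

Definition th : C := (2 * PI / 3 * Ci)%C.

Lemma W_cexp (z : C) : W z = cexp (th * z).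
Proof.
  unfold W, qpow, th. f_equal. rewrite <- !RtoC_mult, <- RtoC_div by lra.
  do 3 f_equal. field.
Qed.

Lemma W_add (z h : C) : W (z + h) = (W z * cexp (th * h))%C.
Proof. rewrite !W_cexp, <- cexp_add. f_equal. ring. Qed.

Lemma Cmod_th : Cmod th = 2 * PI / 3.
Proof.
  unfold th. rewrite <- RtoC_mult, <- RtoC_div, Cmod_mult, Cmod_Ci, Cmod_R, Rabs_pos_eq; try lra.
  pose proof PI_RGT_0; lra.
Qed.

Lemma QS_der (a : nat -> C) (F : C -> C) : QS a F ->
  exists G, QS (fun n => INR n * a n)%C G /\
    forall z, inH z -> cder F z (th * G z).
Proof.
  intros H. pose proof (QS_adm _ _ H) as Ha. pose proof (adm_INR _ Ha) as Ha1.
  pose proof (adm_INR _ Ha1) as Ha2.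
  destruct (adm_QS _ Ha1) as [G HG]. exists G. split; [exact HG|].
  intros z Hz. set (y := Im z). assert (Hy : 0 < y) by exact Hz.
  destruct (adm_geo _ (y / 2) Ha2) as [A [HA0 HA]]; [lra|].
  set (r := rho (y / 2 / 2)) in *.
  assert (Hr : 0 <= r < 1) by (apply rho_01; lra).
  apply (cder_quad _ _ _ (Cmod th ^ 2 * A / (1 - r)) (y / 2)); [lra| |].
  { apply Rdiv_le_0_compat; [|lra]. apply Rmult_le_pos; [apply pow_le, Cmod_ge_0 | exact HA0]. }
  intros h Hh.
  assert (Hzh : inH (z + h)) by (apply inH_near; fold y; lra).
  pose proof (cser_minus _ _ _ _ (cser_minus _ _ _ _ (H _ Hzh) (H z Hz))
    (cser_scal (th * h) _ _ (HG z Hz))) as S.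
  replace (F (z + h)%C - F z - th * h * G z)%C with (F (z + h)%C - F z - th * G z * h)%C in S by ring.
  replace (Cmod th ^ 2 * A / (1 - r) * Cmod h ^ 2)
    with ((Cmod th ^ 2 * A * Cmod h ^ 2) / (1 - r)) by (field; lra).
  refine (cser_le _ r _ _ _ S). split; [exact Hr|]. intros n.
  replace (a n * W (z + h) ^ n - a n * W z ^ n - th * h * (INR n * a n * W z ^ n))%C
    with (a n * W z ^ n * (cexp (INR n * (th * h)) - 1 - INR n * (th * h)))%C.
  2:{ rewrite W_add, Cpow_mult_l, cexp_pow. ring. }
  rewrite !Cmod_mult, Cmod_W_pow. fold y.
  specialize (HA n). rewrite !Cmod_mult, !Cmod_R, !Rabs_pos_eq in HA by apply pos_INR.
  pose proof (cexp_bound1 (INR n * (th * h))) as B.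
  rewrite !Cmod_mult, Cmod_R, Rabs_pos_eq in B by apply pos_INR.
  set (N := INR n) in *. assert (HN : 0 <= N) by apply pos_INR.
  pose proof (Cmod_ge_0 h) as Ph. pose proof (Cmod_ge_0 th) as Pt.
  (* Since [|h| < y / 2], the growth of the exponential remainder uses up half of the decay
     [rho y ^ n]; the other half is left for the coefficients [n^2 a n]. *)
  assert (E : rho y ^ n * exp (N * (Cmod th * Cmod h)) <= rho (y / 2) ^ n).
  { rewrite (rho_half y), Rpow_mult_distr.
    rewrite <- (Rmult_1_r (rho (y / 2) ^ n)) at 3. rewrite Rmult_assoc.
    apply Rmult_le_compat_l; [apply pow_le, Rlt_le, rho_pos|].
    unfold rho. rewrite <- exp_pow_INR, <- exp_plus. rewrite <- exp_0. apply exp_mono.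
    fold N. rewrite Cmod_th. pose proof PI_RGT_0.
    assert (2 * PI / 3 * Cmod h <= 2 * PI / 3 * (y / 2)) by (apply Rmult_le_compat_l; lra).
    nra. }
  eapply Rle_trans.
  { apply Rmult_le_compat_l; [|exact B].
    apply Rmult_le_pos; [apply Cmod_ge_0 | apply pow_le, Rlt_le, rho_pos]. }
  replace (Cmod (a n) * rho y ^ n * ((N * (Cmod th * Cmod h)) ^ 2 * exp (N * (Cmod th * Cmod h))))
    with ((Cmod th ^ 2 * Cmod h ^ 2) * (N * (N * Cmod (a n)) *
      (rho y ^ n * exp (N * (Cmod th * Cmod h))))) by ring.
  replace (Cmod th ^ 2 * A * Cmod h ^ 2 * r ^ n) with (Cmod th ^ 2 * Cmod h ^ 2 * (A * r ^ n)) by ring.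
  apply Rmult_le_compat_l; [apply Rmult_le_pos; apply pow_le; auto|].
  eapply Rle_trans; [|exact HA]. apply Rmult_le_compat_l; [|exact E].
  pose proof (Cmod_ge_0 (a n)). repeat apply Rmult_le_pos; auto.
Qed.

(** The value at the cusp, approached along [i (n + 1)]. It fixes the constants of integration in
    [QS_exp] and [cexp_log_sum]. *)
Lemma QS_lim (a : nat -> C) (F : C -> C) :
  QS a F -> clim (fun n => F (INR (S n) * Ci)%C) (a 0%nat).
Proof.
  intros H. pose proof (QS_minus _ _ _ _ H (QS_const (a 0%nat))) as H1.
  assert (H2 : QS (fun n => a (S n)) (fun z => (F z - a 0%nat) / W z)%C).
  { eapply QS_ext; [| |apply (QS_div_W _ _ H1)]; intros; simpl; ring. }
  destruct (adm_geo _ 1 (QS_adm _ _ H2)) as [A [HA0 HA]]; [lra|].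
  set (r := rho (1 / 2)) in *. assert (Hr : 0 <= r < 1) by (apply rho_01; lra).
  set (K := A / (1 - r) + 1).
  assert (HK : 0 < K) by (unfold K; pose proof (Rdiv_le_0_compat A (1 - r) HA0 ltac:(lra)); lra).
  intros eps He.
  destruct (pow_to_zero (rho 1) (eps / K) (rho_01 1 ltac:(lra))) as [N HN].
  { apply Rdiv_lt_0_compat; auto. }
  exists N. intros n Hn. specialize (HN (S n) ltac:(lia)).
  set (z := (RtoC (INR (S n)) * Ci)%C).
  assert (Hz : inH z) by (apply inH_Ci, lt_0_INR; lia).
  assert (Hi : Im z = INR (S n)) by (unfold z, Im; simpl; ring).
  assert (HI1 : 1 <= INR (S n)) by (rewrite S_INR; pose proof (pos_INR n); lra).
  assert (L : Cmod ((F z - a 0%nat) / W z) <= A / (1 - r)).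
  { refine (cser_le _ r _ _ _ (H2 z Hz)). split; [exact Hr|]. intros k.
    rewrite Cmod_mult, Cmod_W_pow. eapply Rle_trans; [|apply HA].
    apply Rmult_le_compat_l; [apply Cmod_ge_0|]. apply pow_incr.
    split; [apply Rlt_le, rho_pos | apply rho_anti; lra]. }
  rewrite Cmod_div, Cmod_W in L by apply W_neq_0.
  assert (E : rho (Im z) = rho 1 ^ S n).
  { rewrite Hi. unfold rho. rewrite <- exp_pow_INR. f_equal. ring. }
  rewrite E in L. set (u := rho 1 ^ S n) in *.
  assert (Pu : 0 < u) by (apply pow_lt, rho_pos).
  assert (L2 : Cmod (F z - a 0%nat) <= A / (1 - r) * u).
  { apply Rmult_le_compat_r with (r := u) in L; [|lra].
    replace (Cmod (F z - a 0%nat) / u * u) with (Cmod (F z - a 0%nat)) in L by (field; lra). exact L. }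
  apply Rle_lt_trans with (K * u); [unfold K; nra|].
  replace eps with (K * (eps / K)) by (field; lra). apply Rmult_lt_compat_l; auto.
Qed.

Definition supp (r : nat) (a : nat -> C) : Prop :=
  forall n, (n mod 3 <> r mod 3)%nat -> a n = 0%C.

Lemma supp_conv (r s : nat) (a b : nat -> C) :
  supp r a -> supp s b -> supp (r + s) (conv a b).
Proof.
  intros Ha Hb n Hn. apply csum_zero. intros k Hk.
  destruct (Nat.eq_dec (k mod 3) (r mod 3)) as [E|E]; [|rewrite Ha by auto; ring].
  destruct (Nat.eq_dec ((n - k) mod 3) (s mod 3)) as [E'|E']; [|rewrite Hb by auto; ring].
  exfalso. apply Hn. replace n with (k + (n - k))%nat by lia.
  rewrite Nat.Div0.add_mod, E, E', <- Nat.Div0.add_mod. reflexivity.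
Qed.

(** Coefficients of the exponential of a power series, from [n g_n = sum j l_j g_(n-j)]. The
    recursion refers to all earlier values, so the structural recursion returns a function that
    holds every coefficient up to [n]. *)
Fixpoint exp_table (l : nat -> C) (n : nat) : nat -> C :=
  match n with
  | O => fun _ => 1%C
  | S m => fun k =>
      if (k <=? m)%nat then exp_table l m k
      else (csum (fun j => INR (S j) * l (S j) * exp_table l m (m - j)%nat)%C (S m)
            / INR (S m))%C
  end.

Definition exp_coef (l : nat -> C) (n : nat) : C := exp_table l n n.

Lemma exp_table_coef (l : nat -> C) (n k : nat) :
  (k <= n)%nat -> exp_table l n k = exp_coef l k.
Proof.
  induction n as [|n IH]; intros H.
  - replace k with 0%nat by lia. reflexivity.
  - destruct (Nat.eq_dec k (S n)) as [->|E]; [reflexivity|].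
    simpl. destruct (Nat.leb_spec k n); [|lia]. apply IH; lia.
Qed.

(* [theta (exp L) = theta L * exp L] compared coefficientwise. *)
Lemma exp_coef_S (l : nat -> C) (n : nat) :
  (INR (S n) * exp_coef l (S n))%C =
  csum (fun j => INR (S j) * l (S j) * exp_coef l (n - j)%nat)%C (S n).
Proof.
  unfold exp_coef at 1. cbn [exp_table].
  destruct (Nat.leb_spec (S n) n); [lia|].
  rewrite (csum_ext (fun j => INR (S j) * l (S j) * exp_table l n (n - j)%nat)%C
    (fun j => INR (S j) * l (S j) * exp_coef l (n - j)%nat)%C).
  - field. intros E. apply RtoC_inj in E. apply (not_0_INR (S n)); [lia | exact E].
  - intros k Hk. rewrite exp_table_coef by lia. reflexivity.
Qed.

Lemma exp_coef_conv (l : nat -> C) (n : nat) :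
  (INR n * exp_coef l n)%C = conv (fun k => INR k * l k)%C (exp_coef l) n.
Proof.
  unfold conv. rewrite csum_Sl. simpl INR at 2. rewrite Cmult_0_l, Cmult_0_l, Cplus_0_l.
  destruct n as [|n]; [simpl; ring|]. rewrite exp_coef_S. apply csum_ext. intros k Hk.
  reflexivity.
Qed.

(** If [|j l_j| rho^j <= A r^j] and [B] bounds [|g_k| rho^k] for all [k < n], the recursion gives
    [n |g_n| rho^n <= B A / (1 - r)]. Once [n] exceeds [A / (1 - r)] the same [B] persists, so it
    can be taken from finitely many terms. *)
Lemma exp_coef_adm (l : nat -> C) : adm l -> adm (exp_coef l).
Proof.
  intros H y Hy. destruct (adm_geo _ y (adm_INR _ H) Hy) as [A [HA0 HA]].
  set (r := rho (y / 2)) in *. assert (Hr : 0 <= r < 1) by (apply rho_01; lra).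
  set (s := A / (1 - r)). assert (Hs : 0 <= s) by (apply Rdiv_le_0_compat; lra).
  destruct (archimed s) as [Hup _]. set (N := Z.to_nat (up s)).
  assert (HN : s <= INR N).
  { unfold N. rewrite INR_IZR_INZ, Z2Nat.id; [lra|]. apply le_IZR. lra. }
  assert (Hf : exists B, 0 <= B /\
    forall n, (n < S N)%nat -> Cmod (exp_coef l n) * rho y ^ n <= B).
  { generalize (S N) as M. induction M as [|M [B [HB0 HB]]]; [exists 0; split; [lra|intros; lia]|].
    exists (Rmax B (Cmod (exp_coef l M) * rho y ^ M)).
    split; [eapply Rle_trans; [exact HB0|apply Rmax_l]|].
    intros n Hn. destruct (Nat.eq_dec n M) as [->|]; [apply Rmax_r|].
    eapply Rle_trans; [apply HB; lia|apply Rmax_l]. }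
  destruct Hf as [B [HB0 HB]]. exists B. split; [exact HB0|].
  intros n. induction n as [n IH] using (well_founded_induction lt_wf).
  destruct (le_lt_dec n N) as [Hn|Hn]; [apply HB; lia|].
  destruct n as [|n]; [lia|].
  assert (Hp : 0 < INR (S n)) by (apply lt_0_INR; lia).
  assert (P : Cmod (INR (S n) * exp_coef l (S n)) * rho y ^ S n <= INR (S n) * B).
  2:{ rewrite Cmod_mult, Cmod_R, Rabs_pos_eq, Rmult_assoc in P by lra.
      apply Rmult_le_reg_l in P; auto. }
  rewrite exp_coef_S.
  replace (Cmod (csum (fun j => INR (S j) * l (S j) * exp_coef l (n - j)%nat)%C (S n)) * rho y ^ S n)
    with (Cmod (csum (fun j => (rho y ^ S n)%R * (INR (S j) * l (S j) * exp_coef l (n - j)%nat))%C (S n))).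
  2:{ rewrite csum_scal, Cmod_mult, Cmod_R, Rabs_pos_eq; [ring|].
      apply pow_le, Rlt_le, rho_pos. }
  set (f := fun j => ((rho y ^ S n)%R * (INR (S j) * l (S j) * exp_coef l (n - j)%nat))%C).
  rewrite (csum_ext f (fun j => if (j <=? n)%nat then f j else 0%C)).
  2:{ intros k Hk. destruct (Nat.leb_spec k n); [reflexivity | lia]. }
  eapply Rle_trans; [apply (csum_geom_bound _ (B * A) r (S n) Hr)|].
  - intros k. destruct (Nat.leb_spec k n).
    2:{ rewrite Cmod_0. repeat apply Rmult_le_pos; auto. apply pow_le; lra. }
    unfold f. rewrite Cmod_mult, Cmod_R, Rabs_pos_eq by (apply pow_le, Rlt_le, rho_pos).
    rewrite Cmod_mult.
    replace (S n) with (S k + (n - k))%nat by lia. rewrite pow_add.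
    replace (rho y ^ S k * rho y ^ (n - k) *
      (Cmod (INR (S k) * l (S k)) * Cmod (exp_coef l (n - k)%nat)))
      with ((Cmod (exp_coef l (n - k)%nat) * rho y ^ (n - k)) *
        (Cmod (INR (S k) * l (S k)) * rho y ^ S k)) by ring.
    replace (B * A * r ^ k) with (B * (A * r ^ k)) by ring. apply Rmult_le_compat.
    + apply Rmult_le_pos; [apply Cmod_ge_0 | apply pow_le, Rlt_le, rho_pos].
    + apply Rmult_le_pos; [apply Cmod_ge_0 | apply pow_le, Rlt_le, rho_pos].
    + apply IH; lia.
    + eapply Rle_trans; [apply (HA (S k))|]. apply Rmult_le_compat_l; [auto|].
      simpl. assert (0 <= r ^ k) by (apply pow_le; lra). nra.
  - assert (0 <= r ^ S n) by (apply pow_le; lra).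
    apply Rle_trans with (B * s).
    + unfold s. replace (B * A * (1 - r ^ S n) / (1 - r)) with (B * (A / (1 - r)) * (1 - r ^ S n))
        by (field; lra).
      assert (0 <= B * (A / (1 - r))) by (apply Rmult_le_pos; auto). nra.
    + rewrite Rmult_comm. apply Rmult_le_compat_r; [auto|].
      apply lt_INR in Hn. lra.
Qed.

Lemma supp_exp_coef (l : nat -> C) : supp 0 l -> supp 0 (exp_coef l).
Proof.
  intros H n. induction n as [n IH] using (well_founded_induction lt_wf). intros Hn.
  destruct n as [|n]; [simpl in Hn; lia|].
  assert (E : (INR (S n) * exp_coef l (S n))%C = 0%C).
  { rewrite exp_coef_S. apply csum_zero. intros k Hk.
    destruct (Nat.eq_dec (S k mod 3) (0 mod 3)) as [E|E]; [|rewrite H by auto; ring].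
    rewrite (IH (n - k)%nat); [ring | lia |]. intros E'. apply Hn.
    replace (S n) with (S k + (n - k))%nat by lia.
    rewrite Nat.Div0.add_mod, E, E'. reflexivity. }
  replace (exp_coef l (S n)) with (INR (S n) * exp_coef l (S n) / INR (S n))%C.
  - rewrite E. field. intros E'. apply RtoC_inj in E'. apply (not_0_INR (S n)); [lia | exact E'].
  - field. intros E'. apply RtoC_inj in E'. apply (not_0_INR (S n)); [lia | exact E'].
Qed.

Lemma clim_cexp_0 (u : nat -> C) :
  clim u 0 -> clim (fun n => cexp (u n)) 1.
Proof.
  intros H eps He. set (e := Rmin 1 (eps / exp 1)). pose proof (exp_pos 1) as P1.
  assert (He' : 0 < e) by (apply Rmin_pos; [lra | apply Rdiv_lt_0_compat; lra]).
  destruct (H e He') as [N HN]. exists N. intros n Hn. specialize (HN n Hn).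
  replace (u n - 0)%C with (u n) in HN by ring.
  pose proof (Rmin_l 1 (eps / exp 1)). pose proof (Rmin_r 1 (eps / exp 1)). fold e in H0, H1.
  eapply Rle_lt_trans; [apply cexp_bound0|]. pose proof (Cmod_ge_0 (u n)).
  apply Rle_lt_trans with (Cmod (u n) * exp 1).
  - apply Rmult_le_compat_l; [auto | apply exp_mono; lra].
  - replace eps with (eps / exp 1 * exp 1) by (field; lra). apply Rmult_lt_compat_r; lra.
Qed.

(** The series [G] with coefficients [exp_coef l] satisfies [G' = L' G], so [G exp(-L)] is constant,
    and it tends to 1 at the cusp. No power series is composed with another. *)
Lemma QS_exp (l : nat -> C) (L : C -> C) : QS l L -> l 0%nat = 0%C ->
  QS (exp_coef l) (fun z => cexp (L z)).
Proof.
  intros H H0. pose proof (exp_coef_adm _ (QS_adm _ _ H)) as Ag.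
  destruct (adm_QS _ Ag) as [G HG].
  destruct (QS_der _ _ H) as [L' [HL' DL]]. destruct (QS_der _ _ HG) as [G' [HG' DG]].
  assert (EG : forall z, inH z -> G' z = (L' z * G z)%C).
  { intros z Hz. pose proof (QS_mult _ _ _ _ HL' HG z Hz) as M.
    refine (clim_unique _ _ _ (HG' z Hz) _). eapply cser_ext; [|exact M].
    intros n; simpl. rewrite <- exp_coef_conv. reflexivity. }
  assert (DX : forall z, inH z -> cder (fun x => G x * cexp (- L x))%C z 0).
  { intros z Hz.
    assert (D1 : cder (fun x => cexp (- L x))%C z (cexp (- L z) * (-1 * (th * L' z)))%C).
    { apply (cder_comp cexp); [apply cder_cexp|].
      apply cder_ext with (fun x => -1 * L x)%C; [intros; ring|]. apply cder_scal, DL, Hz. }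
    pose proof (cder_mult _ _ _ _ _ (DG z Hz) D1) as P.
    replace (RtoC 0) with (th * G' z * cexp (- L z) + G z * (cexp (- L z) * (-1 * (th * L' z))))%C;
      [exact P | rewrite EG by exact Hz; ring]. }
  assert (Hi : inH (1 * Ci)) by (apply inH_Ci; lra).
  assert (HX : forall z, inH z -> G z = (G (1 * Ci)%C * cexp (- L (1 * Ci)%C) * cexp (L z))%C).
  { intros z Hz. rewrite <- (cder_zero_const _ DX z _ Hz Hi).
    rewrite cexp_opp. field. apply cexp_neq_0. }
  set (c := (G (1 * Ci)%C * cexp (- L (1 * Ci)%C))%C) in *.
  assert (Hc : c = 1%C).
  { pose proof (QS_lim _ _ HG) as LG. pose proof (QS_lim _ _ H) as LL. rewrite H0 in LL.
    pose proof (clim_scal c _ _ (clim_cexp_0 _ LL)) as LE.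
    rewrite Cmult_1_r in LE. refine (clim_unique _ _ _ _ LG).
    eapply clim_ext; [|exact LE]. intros n. cbv beta. symmetry. apply HX.
    apply inH_Ci, lt_0_INR; lia. }
  eapply QS_ext; [reflexivity| |exact HG]. intros z Hz. rewrite HX by exact Hz.
  rewrite Hc. ring.
Qed.

(** * Cube roots of unity and the translation by 1 *)

Definition zeta : C := cexp th.

Lemma zeta_cube : (zeta ^ 3)%C = 1%C.
Proof.
  unfold zeta. rewrite cexp_pow, cexp_pair.
  assert (E : (INR 3 * th)%C = (0, 2 * PI)).
  { unfold th. apply Ceq; unfold Re, Im; simpl; field. }
  rewrite E. unfold Re, Im; simpl. rewrite exp_0, cos_2PI, sin_2PI. apply Ceq; simpl; ring.
Qed.

Lemma zeta_pow_mod (n : nat) : (zeta ^ n)%C = (zeta ^ (n mod 3))%C.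
Proof.
  rewrite (Nat.div_mod_eq n 3) at 1.
  rewrite Cpow_add_r, Cpow_mult_r, zeta_cube, Cpow_1_l. ring.
Qed.

Lemma zeta_neq_0 : zeta <> 0%C.
Proof. apply cexp_neq_0. Qed.

Lemma Cmod_zeta_pow (n : nat) : Cmod (zeta ^ n) = 1.
Proof.
  assert (H : Cmod zeta = 1).
  { unfold zeta. rewrite Cmod_cexp, <- exp_0. f_equal. unfold th, Re; simpl. field. }
  rewrite Cmod_pow, H. apply pow1.
Qed.

Lemma W_T (z : C) : W (z + 1) = (zeta * W z)%C.
Proof. rewrite W_add, Cmult_1_r. unfold zeta. ring. Qed.

Lemma inH_T (z : C) : inH z -> inH (z + 1).
Proof. unfold inH, Im. simpl. intros; lra. Qed.

Lemma QS_T (r : nat) (a : nat -> C) (F : C -> C) : QS a F -> supp r a ->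
  forall z, inH z -> F (z + 1)%C = (zeta ^ r * F z)%C.
Proof.
  intros H Hs z Hz. refine (clim_unique _ _ _ (H _ (inH_T z Hz)) _).
  eapply cser_ext; [|apply (cser_scal (zeta ^ r) _ _ (H z Hz))].
  intros n; simpl. rewrite W_T, Cpow_mult_l.
  destruct (Nat.eq_dec (n mod 3) (r mod 3)) as [E|E].
  - rewrite (zeta_pow_mod n), E, <- zeta_pow_mod. ring.
  - rewrite Hs by auto. ring.
Qed.

(** * Dilations and Lambert series *)

Lemma cser_sparse (p : nat) (a b : nat -> C) (l : C) : (0 < p)%nat ->
  (forall k, b (p * k)%nat = a k) -> (forall n, (n mod p <> 0)%nat -> b n = 0%C) ->
  (cser a l <-> cser b l).
Proof.
  intros Hp Hb Hb0.
  assert (E0 : forall q r, (0 < r <= p)%nat ->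
    csum (fun k => b (p * q + k)%nat) r = a q).
  { intros q r Hr. rewrite (csum_delta _ r 0); [rewrite Nat.add_0_r; apply Hb | lia |].
    intros k Hk Hk0. apply Hb0.
    replace (p * q + k)%nat with (k + q * p)%nat by lia.
    rewrite Nat.Div0.mod_add, Nat.mod_small by lia. exact Hk0. }
  assert (E1 : forall q, csum b (p * q) = csum a q).
  { induction q as [|q IH]; [rewrite Nat.mul_0_r; reflexivity|].
    rewrite Nat.mul_succ_r, csum_add, IH, E0 by lia. reflexivity. }
  split; intros H.
  - intros eps He. destruct (H eps He) as [N HN]. exists (p * N + 1)%nat. intros n Hn.
    (* Dividing [n - 1] instead of [n] gives the last block a length between 1 and [p], so that it
       always contains its one term that may be nonzero. *)
    assert (E : n = (p * ((n - 1) / p) + S ((n - 1) mod p))%nat)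
      by (pose proof (Nat.div_mod_eq (n - 1) p); lia).
    assert (Hm : ((n - 1) mod p < p)%nat) by (apply Nat.mod_upper_bound; lia).
    rewrite E, csum_add, E1, E0 by lia. apply (HN (S ((n - 1) / p))).
    assert (N <= (n - 1) / p)%nat by (apply Nat.div_le_lower_bound; lia). lia.
  - assert (Hq : forall q, (q <= p * q)%nat) by (intros; nia).
    eapply clim_ext; [|apply (clim_subseq _ _ (fun q => (p * q)%nat) Hq H)].
    intros n; simpl. apply E1.
Qed.

Definition dilate (p : nat) (a : nat -> C) (n : nat) : C :=
  if (n mod p =? 0)%nat then a (n / p)%nat else 0%C.

Lemma inH_scal (y : R) (z : C) : 0 < y -> inH z -> inH (y * z).
Proof. intros Hy H. unfold inH in *. rewrite im_scal_l. apply Rmult_lt_0_compat; auto. Qed.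

Lemma W_INR (p : nat) (z : C) : W (INR p * z) = (W z ^ p)%C.
Proof. rewrite !W_cexp, cexp_pow. f_equal. ring. Qed.

Lemma QS_dilate (p : nat) (a : nat -> C) (F : C -> C) : (0 < p)%nat -> QS a F ->
  QS (dilate p a) (fun z => F (INR p * z)%C).
Proof.
  intros Hp H z Hz.
  assert (Hpz : inH (INR p * z)) by (apply inH_scal; [apply lt_0_INR; lia | auto]).
  refine (proj1 (cser_sparse p _ _ _ Hp _ _) (H _ Hpz)).
  - intros k; simpl. unfold dilate.
    rewrite Nat.mul_comm, Nat.Div0.mod_mul, Nat.div_mul by lia. simpl.
    rewrite W_INR, <- Cpow_mult_r. do 2 f_equal. lia.
  - intros n Hn; simpl. unfold dilate. apply Nat.eqb_neq in Hn. rewrite Hn. ring.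
Qed.

(** Coefficients of the sum of [F (m z)] over [1 <= m <= N], when [F] has the coefficients [al]. For
    [n >= 1] and [al 0 = 0] the full sum [lambert al n] runs over the divisors [m] of [n], with
    terms [al (n / m)]. *)
Definition lambert_part (al : nat -> C) (N n : nat) : C :=
  csum (fun m => dilate (S m) al n) N.

Definition lambert (al : nat -> C) (n : nat) : C := lambert_part al n n.

Lemma dilate_small (al : nat -> C) (m n : nat) :
  al 0%nat = 0%C -> (n < m)%nat -> dilate m al n = 0%C.
Proof.
  intros H0 H. unfold dilate. rewrite Nat.mod_small by auto.
  destruct n; [|reflexivity]. simpl. rewrite Nat.Div0.div_0_l. exact H0.
Qed.

Lemma lambert_part_stable (al : nat -> C) (N n : nat) :
  al 0%nat = 0%C -> (n <= N)%nat -> lambert_part al N n = lambert al n.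
Proof.
  intros H0 H. unfold lambert, lambert_part. replace N with (n + (N - n))%nat by lia.
  rewrite csum_add. rewrite (csum_zero (fun k => dilate (S (n + k)) al n)); [ring|].
  intros k Hk. apply dilate_small; [auto | lia].
Qed.

Lemma lambert_part_bound (al : nat -> C) (K : R) (d N n : nat) : al 0%nat = 0%C ->
  (forall k, Cmod (al k) <= K * INR k ^ d) ->
  Cmod (lambert_part al N n) <= K * INR n ^ S d.
Proof.
  intros H0 H. assert (HK : 0 <= K).
  { specialize (H 1%nat). simpl INR in H. rewrite pow1 in H.
    pose proof (Cmod_ge_0 (al 1%nat)). lra. }
  assert (Hb : forall M, Cmod (lambert_part al M n) <= INR M * (K * INR n ^ d)).
  { intros M. apply csum_bound. intros k Hk. unfold dilate.
    destruct (Nat.eqb_spec (n mod S k) 0).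
    - eapply Rle_trans; [apply H|]. apply Rmult_le_compat_l; [auto|]. apply pow_incr.
      split; [apply pos_INR|]. apply le_INR. apply Nat.Div0.div_le_upper_bound; nia.
    - rewrite Cmod_0. apply Rmult_le_pos; [auto | apply pow_le, pos_INR]. }
  assert (E : lambert_part al N n = lambert_part al (Nat.min N n) n).
  { destruct (le_lt_dec n N); [rewrite Nat.min_r by lia; apply lambert_part_stable; auto|].
    rewrite Nat.min_l by lia. reflexivity. }
  rewrite E. eapply Rle_trans; [apply Hb|]. simpl.
  replace (K * (INR n * INR n ^ d)) with (INR n * (K * INR n ^ d)) by ring.
  apply Rmult_le_compat_r; [apply Rmult_le_pos; [auto | apply pow_le, pos_INR]|].
  apply le_INR; lia.
Qed.

Lemma QS_lambert_part (al : nat -> C) (F : C -> C) (N : nat) : QS al F ->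
  QS (lambert_part al N) (fun z => csum (fun m => F (INR (S m) * z)%C) N).
Proof.
  intros H. induction N as [|N IH].
  - eapply QS_ext; [| |apply (QS_const 0)]; [|reflexivity].
    intros n; simpl. destruct (n =? 0)%nat; reflexivity.
  - exact (QS_plus _ _ _ _ IH (QS_dilate (S N) al F ltac:(lia) H)).
Qed.

(* Both sides agree up to [q^(N/3)] and have coefficients [O(n^(d+1))]. *)
Lemma QS_lambert (al : nat -> C) (F G : C -> C) (K : R) (d : nat) :
  QS al F -> al 0%nat = 0%C -> (forall k, Cmod (al k) <= K * INR k ^ d) ->
  QS (lambert al) G ->
  forall z, inH z -> clim (csum (fun m => F (INR (S m) * z)%C)) (G z).
Proof.
  intros H H0 HK HG z Hz.
  assert (HKp : 0 <= K).
  { specialize (HK 1%nat). simpl INR in HK. rewrite pow1 in HK.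
    pose proof (Cmod_ge_0 (al 1%nat)). lra. }
  assert (Hb : adm (fun n => RtoC (2 * K * INR n ^ S d))).
  { apply (adm_pow_bound _ (2 * K) (S d)). intros n.
    rewrite Cmod_R, Rabs_pos_eq; [lra|]. apply Rmult_le_pos; [lra | apply pow_le, pos_INR]. }
  destruct (adm_geo _ (Im z) Hb Hz) as [A [HA0 HA]].
  set (r := rho (Im z / 2)) in *.
  assert (Hr : 0 <= r < 1) by (apply rho_01; unfold inH in Hz; lra).
  assert (P : forall N, Cmod (csum (fun m => F (INR (S m) * z)%C) N - G z) <= A / (1 - r) * r ^ N).
  { intros N. rewrite Cmod_sub_sym.
    pose proof (QS_minus _ _ _ _ HG (QS_lambert_part al F N H) z Hz) as S. cbv beta in S.
    assert (E : csum (fun n => (lambert al n - lambert_part al N n) * W z ^ n)%C N = 0%C).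
    { apply csum_zero. intros k Hk. rewrite lambert_part_stable by (auto; lia). ring. }
    assert (GG : geo A r (fun n => (lambert al n - lambert_part al N n) * W z ^ n)%C).
    { split; [exact Hr|]. intros n. eapply Rle_trans; [|apply (HA n)].
      rewrite Cmod_mult, Cmod_W_pow.
      apply Rmult_le_compat_r; [apply pow_le, Rlt_le, rho_pos|].
      rewrite Cmod_R, Rabs_pos_eq by (apply Rmult_le_pos; [lra | apply pow_le, pos_INR]).
      eapply Rle_trans; [apply Cmod_sub_le|].
      pose proof (lambert_part_bound al K d n n H0 HK).
      pose proof (lambert_part_bound al K d N n H0 HK). unfold lambert. lra. }
    pose proof (cser_rem A r _ _ N GG S) as Q. rewrite E in Q.
    match type of Q with Cmod ?x <= _ =>
      replace x with (G z - csum (fun m => F (INR (Datatypes.S m) * z)%C) N)%C in Q by ring end.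
    replace (A / (1 - r) * r ^ N) with (A * r ^ N / (1 - r)) by (field; lra). exact Q. }
  assert (Hc : 0 <= A / (1 - r)) by (apply Rdiv_le_0_compat; lra).
  intros eps He. destruct (pow_to_zero r (eps / (A / (1 - r) + 1)) Hr) as [N HN].
  { apply Rdiv_lt_0_compat; lra. }
  exists N. intros n Hn. eapply Rle_lt_trans; [apply P|]. specialize (HN n Hn).
  assert (0 <= r ^ n) by (apply pow_le; lra).
  apply Rle_lt_trans with ((A / (1 - r) + 1) * r ^ n); [nra|].
  replace eps with ((A / (1 - r) + 1) * (eps / (A / (1 - r) + 1))) by (field; lra).
  apply Rmult_lt_compat_l; lra.
Qed.

(** * The partial fraction expansion of [pi^2 / sin^2] *)

Fixpoint zsum (f : Z -> C) (N : nat) : C :=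
  match N with
  | O => f 0%Z
  | S n => (zsum f n + (f (Z.of_nat (S n)) + f (- Z.of_nat (S n))%Z))%C
  end.

Lemma zsum_csum (f : Z -> C) (N : nat) :
  zsum f N = (csum (fun k => f (Z.of_nat k)) (S N)
              + csum (fun j => f (- Z.of_nat (S j))%Z) N)%C.
Proof.
  induction N as [|N IH]; [simpl; ring|].
  cbn [zsum]. rewrite IH. cbn [csum]. ring.
Qed.

Lemma zsum_ext (f g : Z -> C) (N : nat) :
  (forall k, (Z.abs k <= Z.of_nat N)%Z -> f k = g k) -> zsum f N = zsum g N.
Proof.
  intros H. induction N as [|N IH]; cbn [zsum]; [apply H; simpl; lia|].
  rewrite IH, !H by (intros; try apply H; lia). reflexivity.
Qed.

Lemma zsum_plus (f g : Z -> C) (N : nat) :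
  zsum (fun k => f k + g k)%C N = (zsum f N + zsum g N)%C.
Proof. induction N as [|N IH]; cbn [zsum]; [reflexivity | rewrite IH; ring]. Qed.

Lemma zsum_scal (c : C) (f : Z -> C) (N : nat) :
  zsum (fun k => c * f k)%C N = (c * zsum f N)%C.
Proof. induction N as [|N IH]; cbn [zsum]; [reflexivity | rewrite IH; ring]. Qed.

Lemma zsum_minus (f g : Z -> C) (N : nat) :
  zsum (fun k => f k - g k)%C N = (zsum f N - zsum g N)%C.
Proof. induction N as [|N IH]; cbn [zsum]; [reflexivity | rewrite IH; ring]. Qed.

Lemma zsum_opp (f : Z -> C) (N : nat) : zsum (fun k => f (- k)%Z) N = zsum f N.
Proof.
  induction N as [|N IH]; cbn [zsum]; [reflexivity|].
  rewrite IH, Z.opp_involutive. ring.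
Qed.

Lemma zsum_swap (f : Z -> Z -> C) (N M : nat) :
  zsum (fun i => zsum (f i) M) N = zsum (fun j => zsum (fun i => f i j) N) M.
Proof.
  induction N as [|N IH]; cbn [zsum]; [reflexivity|].
  rewrite IH, <- !zsum_plus. reflexivity.
Qed.

Lemma zsum_bound (f : Z -> C) (B : R) (N : nat) :
  (forall k, (Z.abs k <= Z.of_nat N)%Z -> Cmod (f k) <= B) ->
  Cmod (zsum f N) <= (2 * INR N + 1) * B.
Proof.
  induction N as [|N IH]; intros H.
  - cbn [zsum]. simpl INR. pose proof (H 0%Z ltac:(simpl; lia)). lra.
  - cbn [zsum]. eapply Rle_trans; [apply Cmod_triangle|].
    pose proof (Cmod_triangle (f (Z.of_nat (S N))) (f (- Z.of_nat (S N))%Z)).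
    pose proof (IH (fun k Hk => H k ltac:(lia))).
    pose proof (H (Z.of_nat (S N)) ltac:(lia)). pose proof (H (- Z.of_nat (S N))%Z ltac:(lia)).
    rewrite S_INR. lra.
Qed.

Lemma Cinv_0 : (/ 0)%C = 0%C.
Proof. unfold Cinv, RtoC; simpl. f_equal; unfold Rdiv; ring. Qed.

(* [pi^2 / sin^2 (pi u)], except that it is [0] at the integers, where [/ 0 = 0]. *)
Definition pf (u : C) : C :=
  (- (4 * (PI * PI)) * qpow 1 u / ((1 - qpow 1 u) * (1 - qpow 1 u)))%C.

Lemma qpow_arg_add (x : R) (u v : C) : qpow x (u + v) = (qpow x u * qpow x v)%C.
Proof. unfold qpow. rewrite <- cexp_add. f_equal. ring. Qed.

Lemma qpow1_1 : qpow 1 1 = 1%C.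
Proof.
  unfold qpow. rewrite cexp_pair.
  assert (E : (RtoC (2 * PI * 1) * Ci * 1)%C = (0, 2 * PI)).
  { apply Ceq; unfold Re, Im; simpl; ring. }
  rewrite E. unfold Re, Im; simpl. rewrite exp_0, cos_2PI, sin_2PI. apply Ceq; simpl; ring.
Qed.

Lemma qpow1_half : qpow 1 (/ 2) = (-1)%C.
Proof.
  unfold qpow. rewrite cexp_pair.
  assert (E : (RtoC (2 * PI * 1) * Ci * / 2)%C = (0, PI)).
  { apply Ceq; unfold Re, Im; simpl; field. }
  rewrite E. unfold Re, Im; simpl. rewrite exp_0, cos_PI, sin_PI. apply Ceq; simpl; ring.
Qed.

Lemma qpow1_neq_1 (w : C) : Im w <> 0 -> qpow 1 w <> 1%C.
Proof.
  intros H E. apply (f_equal Cmod) in E. rewrite Cmod_qpow, Cmod_1 in E.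
  apply (f_equal ln) in E. rewrite ln_exp, ln_1 in E. pose proof PI_RGT_0.
  assert (2 * PI * 1 * Im w = 0) by lra.
  apply Rmult_integral in H1 as [H1|H1]; [lra | auto].
Qed.

Lemma qpow1_real_neq_1 (x : R) : 0 < x < 1 -> qpow 1 (RtoC x) <> 1%C.
Proof.
  intros Hx E. unfold qpow in E. rewrite cexp_pair in E.
  assert (E1 : (RtoC (2 * PI * 1) * Ci * x)%C = (0, 2 * (PI * x))).
  { apply Ceq; unfold Re, Im; simpl; ring. }
  rewrite E1 in E. unfold Re, Im in E; simpl in E. rewrite exp_0, Rmult_1_l in E.
  apply (f_equal fst) in E. simpl in E. rewrite cos_2a_sin in E.
  pose proof PI_RGT_0.
  assert (P : 0 < sin (PI * x)) by (apply sin_gt_0; nra). nra.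
Qed.

Lemma pf_0 : pf 0 = 0%C.
Proof.
  unfold pf. replace (qpow 1 0) with (RtoC 1).
  - replace ((1 - 1) * (1 - 1))%C with (RtoC 0) by ring. unfold Cdiv. rewrite Cinv_0. ring.
  - unfold qpow. rewrite Cmult_0_r. symmetry; apply cexp_0.
Qed.

Lemma pf_T (u : C) : pf (u + 1) = pf u.
Proof. unfold pf. rewrite qpow_arg_add, qpow1_1, Cmult_1_r. reflexivity. Qed.

Lemma Cminus_neq_0 (x y : C) : x <> y -> (x - y)%C <> 0%C.
Proof. intros H E. apply H. apply Ceq_minus. exact E. Qed.

(** The half arguments belong to the two square roots [x] and [-x] of [e^(2 pi i u)], and the
    identity is [x / (1-x)^2 - x / (1+x)^2 = 4 x^2 / (1-x^2)^2]. *)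
Lemma pf_dup (u : C) : qpow 1 u <> 1%C ->
  (pf (u / 2) + pf ((u + 1) / 2))%C = (4 * pf u)%C.
Proof.
  intros H. unfold pf.
  replace ((u + 1) / 2)%C with (u / 2 + / 2)%C by field.
  rewrite qpow_arg_add, qpow1_half.
  replace (qpow 1 u) with (qpow 1 (u / 2) * qpow 1 (u / 2))%C in *.
  2:{ rewrite <- qpow_arg_add. f_equal. field. }
  set (x := qpow 1 (u / 2)) in *.
  assert (H1 : (1 - x)%C <> 0%C).
  { intros E. apply H. replace x with (1 - (1 - x))%C by ring. rewrite E. ring. }
  assert (H2 : (1 + x)%C <> 0%C).
  { intros E. apply H. replace x with ((1 + x) - 1)%C by ring. rewrite E. ring. }
  assert (H3 : (1 - x * x)%C <> 0%C).
  { replace (1 - x * x)%C with ((1 - x) * (1 + x))%C by ring. apply Cmult_neq_0; auto. }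
  generalize (RtoC PI). intros P. field. repeat split; auto.
  replace (1 - x * -1)%C with (1 + x)%C by ring. auto.
Qed.

Lemma pf_half : pf (/ 2) = (PI * PI)%C.
Proof. unfold pf. rewrite qpow1_half. generalize (RtoC PI). intros P. field. Qed.

Lemma pf_opp (u : C) : pf (- u) = pf u.
Proof.
  unfold pf. assert (E : qpow 1 (- u) = (/ qpow 1 u)%C).
  { unfold qpow. rewrite <- cexp_opp. f_equal. ring. }
  rewrite E. pose proof (qpow_neq_0 1 u) as H0.
  destruct (Ceq_dec (qpow 1 u) 1) as [H|H].
  - rewrite H. replace (/ 1)%C with (RtoC 1) by field. reflexivity.
  - apply Cminus_neq_0 in H. generalize (RtoC PI). intros P. field. repeat split; auto.
    intros E'. apply H. replace (qpow 1 u - 1)%C with (- (1 - qpow 1 u))%C by ring. rewrite E'. ring.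
Qed.

(** Iterated duplication: off the real axis this equals [4^n pf w], while for large [n], after half
    of the points are moved by a period, its terms are close to [4^n / (w + k)^2]. Comparing the two
    yields the partial fraction expansion. *)
Definition dup_sum (w : C) (n : nat) : C :=
  csum (fun k => pf ((w + INR k) / 2 ^ n))%C (2 ^ n).

Lemma pow2_neq_0 (n : nat) : (2 ^ n)%C <> 0%C.
Proof. apply Cpow_nz. intros E. apply RtoC_inj in E. lra. Qed.

Lemma INR_pow2 (n : nat) : RtoC (INR (2 ^ n)) = (2 ^ n)%C.
Proof. rewrite pow_INR, RtoC_pow. reflexivity. Qed.

Lemma dup_sum_step (w : C) (n : nat) :
  dup_sum w (S n) = csum (fun k => pf ((w + INR k) / 2 ^ n / 2)
                                 + pf (((w + INR k) / 2 ^ n + 1) / 2))%C (2 ^ n).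
Proof.
  unfold dup_sum. replace (2 ^ S n)%nat with (2 ^ n + 2 ^ n)%nat by (simpl; lia).
  rewrite csum_add, csum_plus. f_equal; apply csum_ext; intros k Hk; f_equal;
    rewrite ?plus_INR, ?RtoC_plus, ?INR_pow2, Cpow_S; field; apply pow2_neq_0.
Qed.

Lemma dup_sum_H (w : C) (n : nat) : Im w <> 0 -> dup_sum w n = (4 ^ n * pf w)%C.
Proof.
  intros Hw. induction n as [|n IH].
  - unfold dup_sum. simpl. replace ((w + 0) / 1)%C with w by field. ring.
  - rewrite dup_sum_step. rewrite (csum_ext _ (fun k => 4 * pf ((w + INR k) / 2 ^ n))%C).
    + rewrite csum_scal. fold (dup_sum w n). rewrite IH, Cpow_S. ring.
    + intros k Hk. apply pf_dup, qpow1_neq_1.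
      rewrite <- INR_pow2. unfold Cdiv.
      rewrite <- RtoC_inv by (apply not_0_INR, Nat.pow_nonzero; lia).
      rewrite im_scal_r, im_plus, im_RtoC, Rplus_0_r.
      apply Rmult_integral_contrapositive_currified; [auto|].
      apply Rinv_neq_0_compat, not_0_INR, Nat.pow_nonzero; lia.
Qed.

(** The value 0 of [pf] at its pole removes the term [k = 0]; at each duplication this term gives
    rise to [pf (1/2) = pi^2] instead. Dividing by [4^n] leaves [pi^2 / 3] in the limit, twice the
    sum of [1 / n^2]. *)
Lemma dup_sum_0 (n : nat) : dup_sum 0 n = ((4 ^ n - 1) * (PI * PI / 3))%C.
Proof.
  induction n as [|n IH].
  - unfold dup_sum. simpl. replace ((0 + 0) / 1)%C with (RtoC 0) by field. rewrite pf_0. ring.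
  - rewrite dup_sum_step. destruct (2 ^ n)%nat as [|M] eqn:EM; [pose proof (Nat.pow_nonzero 2 n); lia|].
    rewrite csum_Sl.
    rewrite (csum_ext _ (fun k => 4 * pf ((0 + INR (S k)) / 2 ^ n))%C).
    + rewrite csum_scal.
      assert (E : dup_sum 0 n = csum (fun k => pf ((0 + INR (S k)) / 2 ^ n))%C M).
      { unfold dup_sum. rewrite EM, csum_Sl. simpl INR at 1.
        replace ((0 + 0) / 2 ^ n)%C with (RtoC 0) by (field; apply pow2_neq_0).
        rewrite pf_0. ring. }
      rewrite <- E, IH. simpl INR.
      replace ((0 + 0) / 2 ^ n / 2)%C with (RtoC 0) by (field; apply pow2_neq_0).
      replace (((0 + 0) / 2 ^ n + 1) / 2)%C with (/ 2)%C by (field; apply pow2_neq_0).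
      rewrite pf_0, pf_half, Cpow_S. generalize (RtoC PI) (4 ^ n)%C. intros; field.
    + intros k Hk. apply pf_dup.
      replace ((0 + INR (S k)) / 2 ^ n)%C with (RtoC (INR (S k) / INR (S M))).
      * apply qpow1_real_neq_1.
        assert (0 < INR (S k)) by (apply lt_0_INR; lia).
        assert (INR (S k) < INR (S M)) by (apply lt_INR; lia).
        split; [apply Rdiv_lt_0_compat; lra|]. apply Rmult_lt_reg_r with (INR (S M)); [lra|].
        unfold Rdiv. rewrite Rmult_assoc, Rinv_l; lra.
      * rewrite RtoC_div by (apply not_0_INR; lia). rewrite <- EM, INR_pow2.
        rewrite Cplus_0_l. reflexivity.
Qed.

Ltac rpos := repeat first
  [ lra | apply Cmod_ge_0 | apply pow_le | apply Rmult_le_pos | apply Rmult_lt_0_compat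
  | apply Rlt_le, Rinv_0_lt_compat | apply Rinv_0_lt_compat ].

(** * Bounds near the double pole *)

Lemma sin_lower (t : R) : 0 <= t <= 9 / 4 -> 3 / 20 * t <= sin t.
Proof.
  intros Ht. assert (HP : 9 / 4 <= PI) by (pose proof PI2_3_2; lra).
  destruct (sin_bound t 0) as [H _]; [lra | lra |].
  unfold sin_approx, sin_term in H. simpl in H.
  (* At the end point [1 - (9/4)^2 / 6 = 5/32 > 3/20]. The range 9/4 covers [|pi i u|] for
     [|u| <= 9/16], because [pi <= 4]. *)
  apply Rle_trans with (t - t * t * t / 6); [nra|].
  eapply Rle_trans; [|exact H]. right. field.
Qed.

Lemma sin_sq_lower (t : R) : Rabs t <= 9 / 4 -> 9 / 400 * (t * t) <= sin t * sin t.
Proof.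
  intros H. apply Rabs_le_between in H. destruct (Rle_lt_dec 0 t) as [P|P].
  - pose proof (sin_lower t ltac:(lra)). nra.
  - pose proof (sin_lower (- t) ltac:(lra)) as Q. rewrite sin_neg in Q. nra.
Qed.

Lemma exp_diff_lower (s : R) : s * s <= (exp s - exp (- s)) * (exp s - exp (- s)).
Proof.
  assert (P : forall x, 0 <= x -> x <= exp x - exp (- x)).
  { intros x Hx. pose proof (exp_ineq1_le x) as H1.
    assert (H2 : exp (- x) <= 1) by (rewrite <- exp_0; apply exp_mono; lra). lra. }
  destruct (Rle_lt_dec 0 s) as [H|H].
  - specialize (P s H). nra.
  - specialize (P (- s) ltac:(lra)). rewrite Ropp_involutive in P. nra.
Qed.

(** For [v = s + i t] one has [|e^v - e^(-v)|^2 = (e^s - e^(-s))^2 + 4 sin^2 t], and the summands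
    are at least [s^2] and [(9/100) t^2]. *)
Lemma sinh_lower (v : C) : Cmod v <= 9 / 4 ->
  3 / 10 * Cmod v <= Cmod (cexp v - cexp (- v)).
Proof.
  intros H. destruct v as [s t]. rewrite !cexp_pair.
  assert (Ht : Rabs t <= 9 / 4) by (eapply Rle_trans; [apply (im_le_Cmod (s, t)) | exact H]).
  pose proof (sin_sq_lower t Ht) as S. pose proof (exp_diff_lower s) as E.
  apply Rsqr_incr_0_var; [|apply Cmod_ge_0]. unfold Rsqr.
  match goal with |- _ <= Cmod ?x * Cmod ?x => replace x with
    ((exp s - exp (- s)) * cos t, (exp s + exp (- s)) * sin t) end.
  2:{ unfold Re, Im; simpl. rewrite cos_neg, sin_neg. apply Ceq; simpl; ring. }
  rewrite Cmod_pair_sq.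
  replace (3 / 10 * Cmod (s, t) * (3 / 10 * Cmod (s, t)))
    with (9 / 100 * (Cmod (s, t) * Cmod (s, t))) by field.
  rewrite Cmod_pair_sq.
  pose proof (sin2_cos2 t) as SC. unfold Rsqr in SC.
  assert (EE : exp s * exp (- s) = 1) by (rewrite <- exp_plus, Rplus_opp_r; apply exp_0).
  replace ((exp s - exp (- s)) * cos t * ((exp s - exp (- s)) * cos t) +
    (exp s + exp (- s)) * sin t * ((exp s + exp (- s)) * sin t))
    with ((exp s - exp (- s)) * (exp s - exp (- s)) * (sin t * sin t + cos t * cos t)
      + 4 * (exp s * exp (- s)) * (sin t * sin t)) by ring.
  rewrite SC, EE. pose proof (Rle_0_sqr s). unfold Rsqr in *. nra.
Qed.

(** The even terms cancel, which makes the error cubic; [pf_near_pole] needs this order. *)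
Lemma sinh_taylor (v : C) : Cmod v <= 9 / 4 ->
  Cmod (cexp v - cexp (- v) - 2 * v) <= 2 * exp (9 / 4) * Cmod v ^ 3.
Proof.
  intros H. replace (cexp v - cexp (- v) - 2 * v)%C
    with ((cexp v - 1 - v - v ^ 2 / 2) - (cexp (- v) - 1 - (- v) - (- v) ^ 2 / 2))%C by field.
  eapply Rle_trans; [apply Cmod_sub_le|].
  pose proof (cexp_bound2 v) as B1. pose proof (cexp_bound2 (- v)) as B2.
  rewrite Cmod_opp in B2. pose proof (exp_mono _ _ H) as E.
  pose proof (pow_le (Cmod v) 3 (Cmod_ge_0 v)). nra.
Qed.

(** With [v = pi i u] and [f = e^v - e^(-v)] the difference is
    [-pi^2 (2v - f) (2v + f) / (f^2 v^2)]: a cubic and a linear factor over a quartic one. *)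
Lemma pf_near_pole : exists K, 0 <= K /\
  forall u, Cmod u <= 9 / 16 -> Cmod (pf u - / (u * u)) <= K.
Proof.
  set (E := exp (9 / 4)). pose proof (exp_pos (9 / 4)) as PE. fold E in PE.
  (* Here 6 bounds [(9/4)^2], and 4 comes from [2 v + f = 4 v - (2 v - f)]. *)
  set (K1 := 2 * E * 6 + 4).
  exists (PI * PI * (2 * E * K1) / (9 / 100)).
  pose proof PI_RGT_0 as PP. pose proof PI_4 as P4.
  assert (HK : 0 <= PI * PI * (2 * E * K1) / (9 / 100)).
  { assert (0 < K1) by (unfold K1; lra). apply Rdiv_le_0_compat; [|lra]. rpos. }
  split; [exact HK|]. intros u Hu.
  destruct (Ceq_dec u 0) as [->|Hu0].
  { rewrite pf_0. replace (0 * 0)%C with (RtoC 0) by ring. rewrite Cinv_0.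
    replace (0 - 0)%C with (RtoC 0) by ring. rewrite Cmod_0. exact HK. }
  set (v := (PI * Ci * u)%C).
  assert (Hcv : Cmod v = PI * Cmod u).
  { unfold v. rewrite !Cmod_mult, Cmod_Ci, Cmod_R, Rabs_pos_eq by lra. ring. }
  assert (Hv : Cmod v <= 9 / 4) by (rewrite Hcv; pose proof (Cmod_ge_0 u); nra).
  assert (Pv : 0 < Cmod v).
  { rewrite Hcv. apply Rmult_lt_0_compat; [lra|]. apply Cmod_gt_0; auto. }
  assert (Hv0 : v <> 0%C) by (apply Cmod_gt_0; auto).
  set (f := (cexp v - cexp (- v))%C).
  pose proof (sinh_lower v Hv) as L. pose proof (sinh_taylor v Hv) as T. fold f E in L, T.
  assert (Hf0 : f <> 0%C) by (apply Cmod_gt_0; lra).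
  assert (Eq : (pf u - / (u * u) = - (PI * PI) * (2 * v - f) * (2 * v + f) / (f * f * (v * v)))%C).
  { assert (EU : (/ (u * u) = - (PI * PI) / (v * v))%C).
    { unfold v. replace (PI * Ci * u * (PI * Ci * u))%C
        with (- (PI * PI * (u * u)))%C.
      - assert (RtoC PI <> 0%C) by (intros Q; apply RtoC_inj in Q; lra).
        generalize dependent (RtoC PI). intros; field; auto.
      - replace (PI * Ci * u * (PI * Ci * u))%C with ((Ci * Ci) * (PI * PI * (u * u)))%C by ring.
        replace (Ci * Ci)%C with (RtoC (-1)) by (apply Ceq; simpl; ring). ring. }
    assert (EF : (pf u = - (4 * (PI * PI)) / (f * f))%C).
    { unfold pf. replace (qpow 1 u) with (cexp v * cexp v)%C.
      2:{ rewrite <- cexp_add. unfold qpow. f_equal. unfold v. rewrite Rmult_1_r, RtoC_mult. ring. }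
      unfold f in *. rewrite cexp_opp in *. pose proof (cexp_neq_0 v) as N.
      set (x := cexp v) in *.
      assert (N1 : (1 - x * x)%C <> 0%C).
      { intros Q. apply Hf0. replace (x - / x)%C with (- (1 - x * x) / x)%C by (field; auto).
        rewrite Q. field; auto. }
      generalize (RtoC PI). intros P. field. repeat split; auto.
      intros Q. apply N1. replace (1 - x * x)%C with (- (x * x - 1))%C by ring. rewrite Q. ring. }
    rewrite EU, EF. generalize (RtoC PI). intros P. field. auto. }
  rewrite Eq.
  rewrite Cmod_div by (apply Cmult_neq_0; apply Cmult_neq_0; assumption).
  rewrite !Cmod_mult, Cmod_opp, Cmod_mult, Cmod_R, Rabs_pos_eq by lra.
  rewrite Cmod_sub_sym in T.
  assert (T2 : Cmod (2 * v + f) <= K1 * Cmod v).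
  { replace (2 * v + f)%C with (4 * v - (2 * v - f))%C by ring.
    eapply Rle_trans; [apply Cmod_sub_le|]. rewrite Cmod_mult, Cmod_R, Rabs_pos_eq by lra.
    eapply Rle_trans; [apply Rplus_le_compat_l, T|]. unfold K1.
    assert (Cmod v ^ 3 <= 6 * Cmod v) by (simpl; nra). nra. }
  set (n := Cmod v) in *. set (F := Cmod f) in *.
  apply Rle_trans with (PI * PI * (2 * E * n ^ 3) * (K1 * n) / (3 / 10 * n * (3 / 10 * n) * (n * n))).
  - unfold Rdiv. apply Rmult_le_compat.
    + rpos.
    + apply Rlt_le, Rinv_0_lt_compat. rpos.
    + apply Rmult_le_compat; try apply Cmod_ge_0; auto.
      * rpos.
      * apply Rmult_le_compat_l; [nra | exact T].
    + apply Rinv_le_contravar; [rpos|].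
      apply Rmult_le_compat_r; [nra|]. apply Rmult_le_compat; lra.
  - right. field. lra.
Qed.

(** * Convergence of the partial fractions with an error of order [1/N^2] *)

Lemma pow2_large (x : R) : exists n, forall m, (n <= m)%nat -> x < 2 ^ m.
Proof.
  destruct (Pow_x_infinity 2) with (b := x + 1) as [N HN]; [rewrite Rabs_pos_eq; lra|].
  exists N. intros m Hm. specialize (HN m Hm). rewrite Rabs_pos_eq in HN; [lra|].
  apply pow_le; lra.
Qed.

(** Moving the upper half of the points by the period 1 brings all arguments to within about 1/2 of
    the pole at 0; for large [n] this is inside the radius 9/16 of [pf_near_pole]. *)
Lemma dup_sum_split (w : C) (n : nat) :
  dup_sum w (S n) = (csum (fun k => pf ((w + INR k) / 2 ^ S n))%C (2 ^ n)
    + csum (fun j => pf ((w - INR (S j)) / 2 ^ S n))%C (2 ^ n))%C.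
Proof.
  unfold dup_sum. replace (2 ^ S n)%nat with (2 ^ n + 2 ^ n)%nat by (simpl; lia).
  rewrite csum_add. f_equal. rewrite <- csum_rev. apply csum_ext. intros k Hk.
  rewrite <- (pf_T ((w - INR (S k)) / 2 ^ S n)). f_equal.
  replace (2 ^ n + (2 ^ n - S k))%nat with (2 ^ S n - S k)%nat by (simpl; lia).
  rewrite minus_INR by (simpl; lia). rewrite RtoC_minus, INR_pow2.
  field. apply pow2_neq_0.
Qed.

Lemma pf_scaled (K : R) (x : C) (n : nat) :
  (forall u, Cmod u <= 9 / 16 -> Cmod (pf u - / (u * u)) <= K) ->
  Cmod x <= 9 / 16 * 2 ^ n ->
  Cmod (/ 4 ^ n * pf (x / 2 ^ n) - / (x * x)) <= K / 4 ^ n.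
Proof.
  intros HK Hx. pose proof (pow2_neq_0 n) as N2.
  assert (P2 : 0 < 2 ^ n) by (apply pow_lt; lra).
  assert (P4 : 0 < 4 ^ n) by (apply pow_lt; lra).
  assert (E4 : (4 ^ n = 2 ^ n * 2 ^ n)%C).
  { rewrite <- Cpow_mult_l. f_equal. ring. }
  assert (C2 : Cmod (2 ^ n) = 2 ^ n) by (rewrite Cmod_pow, Cmod_R, Rabs_pos_eq; lra).
  assert (C4 : Cmod (/ 4 ^ n) = / 4 ^ n).
  { rewrite Cmod_inv by (rewrite E4; apply Cmult_neq_0; auto).
    rewrite Cmod_pow, Cmod_R, Rabs_pos_eq; lra. }
  assert (Hu : Cmod (x / 2 ^ n) <= 9 / 16).
  { rewrite Cmod_div, C2 by auto. apply Rmult_le_reg_r with (2 ^ n); [auto|].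
    unfold Rdiv at 1. rewrite Rmult_assoc, Rinv_l; lra. }
  replace (/ 4 ^ n * pf (x / 2 ^ n) - / (x * x))%C
    with (/ 4 ^ n * (pf (x / 2 ^ n) - / (x / 2 ^ n * (x / 2 ^ n))))%C.
  - rewrite Cmod_mult, C4. unfold Rdiv. rewrite Rmult_comm.
    apply Rmult_le_compat_r; [apply Rlt_le, Rinv_0_lt_compat; auto | apply HK, Hu].
  - destruct (Ceq_dec x 0) as [->|Hx0].
    + replace (0 / 2 ^ n)%C with (RtoC 0) by (field; auto).
      replace (0 * 0)%C with (RtoC 0) by ring. rewrite Cinv_0. ring.
    + rewrite E4. field. auto.
Qed.

Definition pole_sum (w : C) (N : nat) : C :=
  (csum (fun k => / ((w + INR k) * (w + INR k))) N
   + csum (fun j => / ((w - INR (S j)) * (w - INR (S j)))) N)%C.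

(** There are [2^(n+1)] terms, each with an error of at most [K / 4^(n+1)]. *)
Lemma pole_sum_lim (w L : C) :
  clim (fun n => / 4 ^ n * dup_sum w n)%C L -> clim (fun n => pole_sum w (2 ^ n)) L.
Proof.
  intros H. apply clim_dist with (fun n => / 4 ^ S n * dup_sum w (S n))%C;
    [exact (clim_shift _ _ H)|].
  destruct pf_near_pole as [K [HK0 HK]].
  destruct (pow2_large (8 * Cmod w)) as [N0 HN0].
  intros eps He. destruct (pow2_large (K / eps)) as [N1 HN1].
  exists (N0 + N1)%nat. intros n Hn.
  specialize (HN0 n ltac:(lia)). specialize (HN1 n ltac:(lia)).
  assert (P2 : 0 < 2 ^ n) by (apply pow_lt; lra).
  assert (P4 : 4 ^ S n = 4 * (2 ^ n * 2 ^ n)).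
  { simpl. rewrite <- Rpow_mult_distr. replace (2 * 2) with 4 by lra. reflexivity. }
  assert (HI : INR (2 ^ n) = 2 ^ n) by (rewrite pow_INR; reflexivity).
  rewrite dup_sum_split. unfold pole_sum.
  rewrite Cmult_plus_distr_l, <- !csum_scal.
  match goal with |- Cmod (Cminus (Cminus (Cplus ?A ?B) (Cplus ?A' ?B')) _) < _ =>
    replace (A + B - (A' + B') - 0)%C with (-1 * ((A' - A) + (B' - B)))%C by ring end.
  rewrite Cmod_mult, Cmod_R, Rabs_left by lra. replace (- -1) with 1 by ring.
  rewrite Rmult_1_l.
  eapply Rle_lt_trans; [apply Cmod_triangle|].
  assert (Q : forall f g : nat -> C,
    (forall k, (k < 2 ^ n)%nat -> Cmod (f k - g k) <= K / 4 ^ S n) ->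
    Cmod (csum f (2 ^ n) - csum g (2 ^ n)) <= 2 ^ n * (K / 4 ^ S n)).
  { intros f g Hfg. rewrite <- HI.
    replace (csum f (2 ^ n) - csum g (2 ^ n))%C
      with (csum (fun k => f k + -1 * g k)%C (2 ^ n)) by (rewrite csum_plus, csum_scal; ring).
    apply csum_bound. intros k Hk.
    replace (f k + -1 * g k)%C with (f k - g k)%C by ring. auto. }
  assert (Bd : forall x : C, Cmod x <= Cmod w + 2 ^ n -> Cmod x <= 9 / 16 * 2 ^ S n).
  { intros x Hx. simpl. lra. }
  eapply Rle_lt_trans; [apply Rplus_le_compat; apply Q|].
  - intros k Hk. apply pf_scaled; [exact HK|]. apply Bd.
    eapply Rle_trans; [apply Cmod_triangle|]. apply Rplus_le_compat_l.
    rewrite Cmod_R, Rabs_pos_eq, <- HI by apply pos_INR. apply le_INR. lia.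
  - intros k Hk. apply pf_scaled; [exact HK|]. apply Bd.
    eapply Rle_trans; [apply Cmod_sub_le|]. apply Rplus_le_compat_l.
    rewrite Cmod_R, Rabs_pos_eq, <- HI by apply pos_INR. apply le_INR. lia.
  - rewrite P4.
    replace (2 ^ n * (K / (4 * (2 ^ n * 2 ^ n))) + 2 ^ n * (K / (4 * (2 ^ n * 2 ^ n))))
      with (K / 2 ^ n / 2) by (field; lra).
    apply Rle_lt_trans with (K / 2 ^ n).
    { assert (0 <= K / 2 ^ n) by (apply Rdiv_le_0_compat; auto). lra. }
    apply Rmult_lt_reg_r with (2 ^ n); [auto|]. unfold Rdiv. rewrite Rmult_assoc, Rinv_l by lra.
    rewrite Rmult_1_r. apply Rmult_lt_reg_r with (/ eps); [apply Rinv_0_lt_compat; auto|].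
    replace (eps * 2 ^ n * / eps) with (2 ^ n) by (field; lra). exact HN1.
Qed.

(** The symmetric partial sum with an approximation of both tails, chosen so that differences
    telescope. The error of a row drops from order [1/N] to order [1/N^2], and so it still tends to
    0 after [2 N + 1] rows are added. *)
Definition pole_sum_corr (w : C) (N : nat) : C :=
  (zsum (fun k => / ((w + IZR k) * (w + IZR k))) N
   + (/ (INR (S N) + w) + / (INR (S N) - w)))%C.

Lemma zsum_pole_sum (w : C) (N : nat) :
  zsum (fun k => / ((w + IZR k) * (w + IZR k)))%C N =
  (pole_sum w (S N) - / ((w - INR (S N)) * (w - INR (S N))))%C.
Proof.
  unfold pole_sum. rewrite zsum_csum.
  rewrite (csum_ext (fun k => / ((w + IZR (Z.of_nat k)) * (w + IZR (Z.of_nat k))))%C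
    (fun k => / ((w + INR k) * (w + INR k)))%C) by (intros; rewrite INR_IZR_INZ; reflexivity).
  rewrite (csum_ext (fun j => / ((w + IZR (- Z.of_nat (S j))) * (w + IZR (- Z.of_nat (S j)))))%C
    (fun j => / ((w - INR (S j)) * (w - INR (S j))))%C)
    by (intros; rewrite opp_IZR, <- INR_IZR_INZ, RtoC_opp; reflexivity).
  cbn [csum]. ring.
Qed.

(** A distance to the nonzero integers proportional to their size. For [w = m z] the constant can be
    chosen independently of the row [m] ([gap_far]). *)
Definition far (dl : R) (w : C) : Prop := 0 < dl /\ forall M : nat, (1 <= M)%nat ->
  dl * INR M <= Cmod (INR M + w) /\ dl * INR M <= Cmod (INR M - w).

Lemma far_neq_0 (dl : R) (w : C) (M : nat) : far dl w -> (1 <= M)%nat -> (INR M + w)%C <> 0%C /\ (INR M - w)%C <> 0%C.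
Proof.
  intros [Hdl Hw] HM. destruct (Hw M HM) as [H1 H2].
  assert (0 < dl * INR M) by (apply Rmult_lt_0_compat; [auto | apply lt_0_INR; lia]).
  split; apply Cmod_gt_0; lra.
Qed.

(** With [m = N + 1] the step equals [1 / ((m+w)^2 (m+1+w)) + 1 / ((m-w)^2 (m+1-w))]; the bound is
    stated in a form that telescopes. *)
Lemma pole_sum_corr_step (dl : R) (w : C) (N : nat) : far dl w ->
  Cmod (pole_sum_corr w (S N) - pole_sum_corr w N)
  <= 2 / dl ^ 3 / INR (S N) * (/ INR (S N) - / INR (S (S N))).
Proof.
  intros Hf. pose proof Hf as [Hdl Hw]. unfold pole_sum_corr. cbn [zsum]. set (M := S N).
  rewrite opp_IZR, <- INR_IZR_INZ, RtoC_opp.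
  destruct (far_neq_0 dl w M Hf ltac:(lia)) as [A1 A2].
  destruct (far_neq_0 dl w (S M) Hf ltac:(lia)) as [B1 B2].
  destruct (Hw M ltac:(lia)) as [C1 C2]. destruct (Hw (S M) ltac:(lia)) as [D1 D2].
  rewrite S_INR in *. set (m := INR M) in *.
  assert (Hm : 0 < m) by (apply lt_0_INR; lia).
  rewrite RtoC_plus in *.
  match goal with |- Cmod ?x <= _ => replace x with
    (/ ((m + w) * (m + w) * (m + 1 + w)) + / ((m - w) * (m - w) * (m + 1 - w)))%C end.
  2:{ generalize dependent (RtoC m). intros c; intros. field.
      repeat split; auto.
      intros Q. apply A2. replace (c - w)%C with (- (w + - c))%C by ring. rewrite Q. ring. }
  assert (Q : forall a b, dl * m <= Cmod a -> dl * (m + 1) <= Cmod b -> a <> 0%C -> b <> 0%C ->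
    Cmod (/ (a * a * b)) <= / dl ^ 3 / m * (/ m - / (m + 1))).
  { intros a b Ha Hb Ha0 Hb0. rewrite Cmod_inv by (repeat apply Cmult_neq_0; auto).
    rewrite !Cmod_mult.
    assert (P1 : 0 < dl * m) by (apply Rmult_lt_0_compat; auto).
    assert (P2 : 0 < dl * (m + 1)) by (apply Rmult_lt_0_compat; lra).
    replace (/ dl ^ 3 / m * (/ m - / (m + 1))) with (/ (dl * m * (dl * m) * (dl * (m + 1))))
      by (field; repeat split; lra).
    apply Rinv_le_contravar; [rpos|].
    apply Rmult_le_compat; try lra; [nra|]. apply Rmult_le_compat; lra. }
  eapply Rle_trans; [apply Cmod_triangle|].
  eapply Rle_trans; [apply Rplus_le_compat; apply Q; eassumption|].
  right. field. repeat split; lra.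
Qed.

Lemma pole_sum_corr_subseq (dl : R) (w L : C) : far dl w ->
  clim (fun n => / 4 ^ n * dup_sum w n)%C L ->
  clim (fun n => pole_sum_corr w (2 ^ n - 1)) L.
Proof.
  intros Hf HL. pose proof Hf as [Hdl Hw].
  apply clim_dist with (fun n => pole_sum w (2 ^ n)); [apply pole_sum_lim, HL|].
  intros eps He.
  assert (Hd2 : 0 < dl ^ 2) by (apply pow_lt; auto).
  set (K := 2 / dl + / dl ^ 2). assert (HK : 0 < K).
  { apply Rplus_lt_0_compat; [apply Rdiv_lt_0_compat | apply Rinv_0_lt_compat]; lra. }
  destruct (pow2_large (K / eps)) as [N HN]. exists N. intros n Hn. specialize (HN n Hn).
  assert (P2 : (1 <= 2 ^ n)%nat) by (pose proof (Nat.pow_nonzero 2 n); lia).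
  unfold pole_sum_corr. rewrite zsum_pole_sum. replace (S (2 ^ n - 1)) with (2 ^ n)%nat by lia.
  destruct (far_neq_0 dl w (2 ^ n) Hf P2) as [A1 A2]. destruct (Hw (2 ^ n)%nat P2) as [C1 C2].
  assert (HI : INR (2 ^ n) = 2 ^ n) by (rewrite pow_INR; reflexivity).
  rewrite HI in *. set (m := 2 ^ n) in *.
  assert (Hm : 1 <= m) by (rewrite <- HI; apply (le_INR 1); lia).
  match goal with |- Cmod ?x < _ => replace x with
    ((/ (m + w) + / (m - w)) - / ((m - w) * (m - w)))%C by
    (replace ((w - m) * (w - m))%C with ((m - w) * (m - w))%C by ring; ring) end.
  assert (Hi : forall a, dl * m <= Cmod a -> a <> 0%C -> Cmod (/ a) <= / dl / m).
  { intros a Ha Ha0. rewrite Cmod_inv by auto.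
    replace (/ dl / m) with (/ (dl * m)) by (field; lra).
    apply Rinv_le_contravar; [apply Rmult_lt_0_compat; lra | auto]. }
  pose proof (Hi _ C1 A1) as I1. pose proof (Hi _ C2 A2) as I2.
  assert (I3 : Cmod (/ ((m - w) * (m - w))) <= / dl ^ 2 / m).
  { rewrite Cmod_inv by (apply Cmult_neq_0; auto). rewrite Cmod_mult.
    replace (/ dl ^ 2 / m) with (/ (dl * m * dl)) by (field; lra).
    assert (0 < dl * m) by (apply Rmult_lt_0_compat; lra).
    apply Rinv_le_contravar; [apply Rmult_lt_0_compat; lra|].
    apply Rmult_le_compat; try lra. nra. }
  eapply Rle_lt_trans; [apply Cmod_sub_le|].
  eapply Rle_lt_trans; [apply Rplus_le_compat; [apply Cmod_triangle | exact I3]|].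
  apply Rle_lt_trans with (K / m); [unfold K, Rdiv in *; lra|].
  apply Rmult_lt_reg_r with m; [lra|]. unfold Rdiv. rewrite Rmult_assoc, Rinv_l by lra.
  rewrite Rmult_1_r. apply Rmult_lt_reg_r with (/ eps); [apply Rinv_0_lt_compat; auto|].
  replace (eps * m * / eps) with m by (field; lra). exact HN.
Qed.

(** Convergence is known along the indices [2^n - 1]; the telescoping step bounds connect an
    arbitrary [N] with a late index of this kind. *)
Lemma pole_sum_corr_error (dl : R) (w L : C) (N : nat) : far dl w ->
  clim (fun n => / 4 ^ n * dup_sum w n)%C L ->
  Cmod (pole_sum_corr w N - L) <= 2 / dl ^ 3 / (INR (S N) * INR (S N)).
Proof.
  intros Hf HL. pose proof Hf as [Hdl Hw].
  assert (Hd3 : 0 < dl ^ 3) by (apply pow_lt; auto).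
  assert (HN : 0 < INR (S N)) by (apply lt_0_INR; lia).
  set (c := 2 / dl ^ 3 / INR (S N)).
  assert (Hc : 0 < c) by (repeat apply Rdiv_lt_0_compat; lra).
  assert (St : forall k, Cmod (pole_sum_corr w (N + k) - pole_sum_corr w N)
    <= c * (/ INR (S N) - / INR (S (N + k)))).
  { induction k as [|k IH].
    - rewrite Nat.add_0_r. replace (pole_sum_corr w N - pole_sum_corr w N)%C with (RtoC 0) by ring.
      rewrite Cmod_0. right; ring.
    - eapply Rle_trans; [apply (Cmod_triangle3 _ (pole_sum_corr w (N + k)))|].
      rewrite Nat.add_succ_r. pose proof (pole_sum_corr_step dl w (N + k) Hf) as P.
      set (x := / INR (S (N + k))) in *. set (y := / INR (S (S (N + k)))) in *.
      assert (Hle : 2 / dl ^ 3 / INR (S (N + k)) <= c).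
      { unfold c, Rdiv. apply Rmult_le_compat_l.
        - apply Rmult_le_pos; [lra | apply Rlt_le, Rinv_0_lt_compat; auto].
        - apply Rinv_le_contravar; [auto | apply le_INR; lia]. }
      assert (Hxy : 0 <= x - y).
      { assert (y <= x); [|lra]. unfold x, y. apply Rinv_le_contravar; [apply lt_0_INR; lia | apply le_INR; lia]. }
      nra. }
  apply Rnot_lt_le. intros Hlt.
  replace (2 / dl ^ 3 / (INR (S N) * INR (S N))) with (c * / INR (S N)) in Hlt
    by (unfold c; field; split; lra).
  destruct (pole_sum_corr_subseq dl w L Hf HL (Cmod (pole_sum_corr w N - L) - c * / INR (S N))) as [n0 Hn0]; [lra|].
  set (n := (n0 + S N)%nat). specialize (Hn0 n ltac:(lia)).
  assert (Hg : (N <= 2 ^ n - 1)%nat).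
  { assert (n < 2 ^ n)%nat by (apply Nat.pow_gt_lin_r; lia). lia. }
  specialize (St (2 ^ n - 1 - N)%nat). replace (N + (2 ^ n - 1 - N))%nat with (2 ^ n - 1)%nat in St by lia.
  pose proof (Cmod_triangle3 (pole_sum_corr w N) (pole_sum_corr w (2 ^ n - 1)) L) as T.
  rewrite (Cmod_sub_sym (pole_sum_corr w N) (pole_sum_corr w (2 ^ n - 1))) in T.
  assert (0 < / INR (S (2 ^ n - 1))) by (apply Rinv_0_lt_compat, lt_0_INR; lia).
  nra.
Qed.

(** * The logarithm of the eta product *)

(** The involution [m -> n / m] of the divisors, obtained from the symmetry of the condition
    [m k = n] in a double sum. *)
Lemma divisor_swap (f : nat -> C) (n : nat) :
  csum (fun m => if (n mod S m =? 0)%nat then f (S m) else 0%C) n =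
  csum (fun m => if (n mod S m =? 0)%nat then f (n / S m)%nat else 0%C) n.
Proof.
  assert (D : forall (m : nat) (g : nat -> C), (m < n)%nat ->
    (if (n mod S m =? 0)%nat then g (n / S m)%nat else 0%C) =
    csum (fun k => if (S m * S k =? n)%nat then g (S k) else 0%C) n).
  { intros m g Hm. destruct (Nat.eqb_spec (n mod S m) 0) as [E|E].
    - pose proof (Nat.div_mod_eq n (S m)) as Q. rewrite E, Nat.add_0_r in Q.
      set (k := (n / S m)%nat) in *. destruct k as [|k]; [lia|].
      rewrite (csum_delta _ n k).
      + destruct (Nat.eqb_spec (S m * S k) n); [reflexivity | lia].
      + nia.
      + intros j Hj Hjk. destruct (Nat.eqb_spec (S m * S j) n); [nia | reflexivity].
    - symmetry. apply csum_zero. intros k Hk.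
      destruct (Nat.eqb_spec (S m * S k) n) as [Q|Q]; [|reflexivity].
      exfalso. apply E. rewrite <- Q, Nat.mul_comm. apply Nat.Div0.mod_mul. }
  rewrite (csum_ext (fun m => if (n mod S m =? 0)%nat then f (n / S m)%nat else 0%C)
    (fun m => csum (fun k => if (S m * S k =? n)%nat then f (S k) else 0%C) n))
    by (intros; apply (D k f); auto).
  rewrite csum_swap. apply csum_ext. intros m Hm.
  rewrite (csum_ext _ (fun k => if (S m * S k =? n)%nat then f (S m) else 0%C))
    by (intros; rewrite Nat.mul_comm; reflexivity).
  apply (D m (fun _ => f (S m)) Hm).
Qed.

(** The coefficients of [- log (1 - x)]; those of [x / (1 - x)^2] follow. For [n >= 1] their Lambert
    coefficients are [sigma(n) / n] and [sigma(n)]. *)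
Definition log_coef (n : nat) : C := if (n =? 0)%nat then 0%C else (/ INR n)%C.
Definition id_coef (n : nat) : C := INR n.

Lemma INR_neq_0 (n : nat) : (0 < n)%nat -> RtoC (INR n) <> 0%C.
Proof. intros H E. apply RtoC_inj in E. apply (not_0_INR n); [lia | exact E]. Qed.

Lemma lambert_log_id (n : nat) :
  (INR n * lambert log_coef n)%C = lambert id_coef n.
Proof.
  unfold lambert, lambert_part. rewrite <- csum_scal.
  unfold dilate, id_coef. rewrite <- (divisor_swap (fun k => RtoC (INR k)) n).
  apply csum_ext. intros m Hm. destruct (Nat.eqb_spec (n mod S m) 0) as [E|E]; [|ring].
  pose proof (Nat.div_mod_eq n (S m)) as Q. rewrite E, Nat.add_0_r in Q.
  unfold log_coef. destruct (Nat.eqb_spec (n / S m) 0) as [Z|Z]; [lia|].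
  rewrite Q at 1. rewrite mult_INR, RtoC_mult. field. apply INR_neq_0. lia.
Qed.

Lemma log_coef_bound (k : nat) : Cmod (log_coef k) <= 1 * INR k ^ 1.
Proof.
  unfold log_coef. destruct (Nat.eqb_spec k 0) as [->|E]; [rewrite Cmod_0; simpl; lra|].
  rewrite Cmod_inv, Cmod_R, Rabs_pos_eq by (try apply INR_neq_0; try apply pos_INR; lia).
  assert (1 <= INR k) by (apply (le_INR 1); lia).
  apply Rle_trans with 1; [|simpl; lra]. rewrite <- Rinv_1. apply Rinv_le_contravar; lra.
Qed.

Lemma id_coef_bound (k : nat) : Cmod (id_coef k) <= 1 * INR k ^ 1.
Proof. unfold id_coef. rewrite Cmod_R, Rabs_pos_eq by apply pos_INR. simpl. lra. Qed.

Lemma adm_lambert (al : nat -> C) (K : R) (d : nat) : al 0%nat = 0%C ->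
  (forall k, Cmod (al k) <= K * INR k ^ d) -> adm (lambert al).
Proof.
  intros H0 H. apply (adm_pow_bound _ K (S d)). intros n. apply lambert_part_bound; auto.
Qed.

Lemma Cmod_W_lt_1 (z : C) : inH z -> Cmod (W z) < 1.
Proof. intros H. rewrite Cmod_W. apply rho_lt_1, H. Qed.

Lemma one_minus_W_neq_0 (z : C) : inH z -> (1 - W z)%C <> 0%C.
Proof.
  intros H E. pose proof (Cmod_W_lt_1 z H) as L.
  replace (W z) with (1 - (1 - W z))%C in L by ring. rewrite E in L.
  replace (1 - 0)%C with (RtoC 1) in L by ring. rewrite Cmod_1 in L. lra.
Qed.

Lemma QS_geom : QS (fun _ => 1%C) (fun z => / (1 - W z))%C.
Proof.
  intros z Hz.
  assert (G : geo 1 (Cmod (W z)) (fun n => 1 * W z ^ n)%C).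
  { split; [pose proof (Cmod_W_lt_1 z Hz); pose proof (Cmod_ge_0 (W z)); lra|].
    intros n. rewrite Cmult_1_l, Cmod_pow. lra. }
  destruct (geo_cser _ _ _ G) as [l Hl].
  assert (E : (l = 1 + W z * l)%C).
  { refine (clim_unique _ _ _ Hl _).
    pose proof (cser_unshift (fun n => 1 * W z ^ n)%C (W z * l)%C) as P. simpl in P.
    replace (1 * 1 + W z * l)%C with (1 + W z * l)%C in P by ring. apply P.
    eapply cser_ext; [|apply (cser_scal (W z) _ _ Hl)]. intros n; simpl; ring. }
  replace (/ (1 - W z))%C with l; [exact Hl|].
  pose proof (one_minus_W_neq_0 z Hz) as N.
  replace l with ((l - W z * l) / (1 - W z))%C by (field; auto).
  rewrite E at 1. field; auto.
Qed.

Lemma QS_id_coef : QS id_coef (fun z => W z / ((1 - W z) * (1 - W z)))%C.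
Proof.
  eapply QS_ext; [| |apply (QS_mul_W _ _ (QS_mult _ _ _ _ QS_geom QS_geom))].
  - intros n. unfold id_coef. destruct n as [|n]; [reflexivity|].
    unfold conv. rewrite Cmult_1_l. apply csum_ones.
  - intros z Hz. simpl. field. apply one_minus_W_neq_0, Hz.
Qed.

Lemma adm_log_coef : adm log_coef.
Proof. apply (adm_pow_bound _ 1 1), log_coef_bound. Qed.

Lemma cder_W (z : C) : cder W z (th * W z).
Proof.
  apply cder_ext with (fun x => cexp (th * x)); [intros; symmetry; apply W_cexp|].
  rewrite W_cexp, Cmult_comm. apply (cder_comp cexp); [apply cder_cexp|].
  pose proof (cder_scal th _ _ _ (cder_id z)) as P. rewrite Cmult_1_r in P. exact P.
Qed.

Lemma clim_cexp (u : nat -> C) (l : C) : clim u l -> clim (fun n => cexp (u n)) (cexp l).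
Proof.
  intros H. pose proof (clim_minus _ _ _ _ H (clim_const l)) as H0.
  replace (l - l)%C with (RtoC 0) in H0 by ring.
  pose proof (clim_scal (cexp l) _ _ (clim_cexp_0 _ H0)) as P. rewrite Cmult_1_r in P.
  eapply clim_ext; [|exact P]. intros n; simpl. rewrite <- cexp_add. f_equal. ring.
Qed.

(** The logarithmic series [L] has derivative [W / (1 - W)] with respect to [W d/dW], so
    [exp(L) (1 - W)] is constant; it tends to 1 at the cusp. *)
Lemma cexp_log_sum (z : C) : inH z -> cexp (- qsum log_coef z) = (1 - W z)%C.
Proof.
  intros Hz. pose proof (QS_qsum _ adm_log_coef) as Q.
  destruct (QS_der _ _ Q) as [G [HG D]]. set (L := qsum log_coef) in *.
  assert (EG : forall x, inH x -> G x = (W x / (1 - W x))%C).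
  { intros x Hx. refine (clim_unique _ _ _ (HG x Hx) _).
    pose proof (QS_minus _ _ _ _ QS_geom (QS_const 1) x Hx) as P. simpl in P.
    replace (/ (1 - W x) - 1)%C with (W x / (1 - W x))%C in P
      by (field; apply one_minus_W_neq_0, Hx).
    eapply cser_ext; [|exact P]. intros n; simpl. unfold log_coef.
    destruct (Nat.eqb_spec n 0) as [->|E]; [simpl; ring|].
    field. apply INR_neq_0. lia. }
  assert (DX : forall x, inH x -> cder (fun x => cexp (L x) * (1 - W x))%C x 0).
  { intros x Hx.
    assert (D1 : cder (fun x => 1 - W x)%C x (0 + -1 * (th * W x))%C).
    { apply cder_ext with (fun x => 1 + -1 * W x)%C; [intros; ring|].
      apply (cder_plus (fun _ => 1%C)); [apply cder_const | apply cder_scal, cder_W]. }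
    assert (D2 : cder (fun x => cexp (L x))%C x (cexp (L x) * (th * G x))%C)
      by (apply (cder_comp cexp); [apply cder_cexp | apply D, Hx]).
    pose proof (cder_mult _ _ _ _ _ D2 D1) as P. cbv beta in P.
    rewrite EG in P by exact Hx.
    match type of P with cder _ _ ?y => replace y with (RtoC 0) in P; [exact P|] end.
    field. apply one_minus_W_neq_0, Hx. }
  assert (Hi : inH (1 * Ci)) by (apply inH_Ci; lra).
  set (c := (cexp (L (1 * Ci)%C) * (1 - W (1 * Ci)))%C).
  assert (HX : forall x, inH x -> (cexp (L x) * (1 - W x))%C = c)
    by (intros x Hx; apply (cder_zero_const _ DX x _ Hx Hi)).
  assert (Hc : c = 1%C).
  { pose proof (clim_cexp _ _ (QS_lim _ _ Q)) as L1.
    replace (log_coef 0) with (RtoC 0) in L1 by reflexivity. rewrite cexp_0 in L1.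
    pose proof (QS_lim _ _ (QS_minus _ _ _ _ (QS_const 1) (QS_mul_W _ _ (QS_const 1)))) as L2.
    change (clim (fun n => 1 - W (INR (S n) * Ci) * 1)%C (1 - 0)%C) in L2.
    pose proof (clim_mult _ _ _ _ L1 L2) as P.
    replace (1 * (1 - 0))%C with (RtoC 1) in P by ring.
    refine (clim_unique _ _ _ _ P). eapply clim_ext; [|apply clim_const].
    intros n. cbv beta. rewrite <- (HX (INR (S n) * Ci)%C) by (apply inH_Ci, lt_0_INR; lia).
    unfold L. ring. }
  pose proof (HX z Hz) as E. rewrite Hc in E. rewrite cexp_opp.
  replace (1 - W z)%C with (/ cexp (L z) * (cexp (L z) * (1 - W z)))%C
    by (field; apply cexp_neq_0).
  rewrite E. ring.
Qed.

(** Minus the logarithm of the product of the [1 - q^n]; [Sig] is the series of [sigma(n) q^n]. The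
    argument [3 z] passes from powers of [q^(1/3)] to powers of [q]. *)
Definition Lam (z : C) : C := qsum (lambert log_coef) (3 * z).
Definition Sig (z : C) : C := qsum (lambert id_coef) (3 * z).

Lemma adm_lambert_log : adm (lambert log_coef).
Proof. apply (adm_lambert _ 1 1); [reflexivity | apply log_coef_bound]. Qed.

Lemma adm_lambert_id : adm (lambert id_coef).
Proof. apply (adm_lambert _ 1 1); [reflexivity | apply id_coef_bound]. Qed.

Lemma INR_3 : RtoC (INR 3) = RtoC 3.
Proof. f_equal. simpl. ring. Qed.

Lemma QS_Lam : QS (dilate 3 (lambert log_coef)) Lam.
Proof.
  eapply QS_ext; [reflexivity| |apply (QS_dilate 3 _ _ ltac:(lia) (QS_qsum _ adm_lambert_log))].
  intros z Hz. unfold Lam. rewrite INR_3. reflexivity.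
Qed.

Lemma QS_Sig : QS (dilate 3 (lambert id_coef)) Sig.
Proof.
  eapply QS_ext; [reflexivity| |apply (QS_dilate 3 _ _ ltac:(lia) (QS_qsum _ adm_lambert_id))].
  intros z Hz. unfold Sig. rewrite INR_3. reflexivity.
Qed.

Lemma inH_3 (z : C) : inH z -> inH (3 * z).
Proof. intros H. apply inH_scal; [lra | exact H]. Qed.

Lemma cder_Lam (z : C) : inH z -> cder Lam z (3 * th * Sig z).
Proof.
  intros Hz. destruct (QS_der _ _ (QS_qsum _ adm_lambert_log)) as [G [HG D]].
  assert (EG : forall x, inH x -> G x = qsum (lambert id_coef) x).
  { intros x Hx. refine (clim_unique _ _ _ (HG x Hx) _).
    eapply cser_ext; [|apply (QS_qsum _ adm_lambert_id x Hx)].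
    intros n; simpl. rewrite lambert_log_id. reflexivity. }
  unfold Lam, Sig. rewrite <- EG by (apply inH_3, Hz).
  replace (3 * th * G (3 * z)%C)%C with (th * G (3 * z)%C * 3)%C by ring.
  apply (cder_comp (qsum (lambert log_coef)) (fun x => 3 * x)%C); [apply D, inH_3, Hz|].
  pose proof (cder_scal 3 _ _ _ (cder_id z)) as P. rewrite Cmult_1_r in P. exact P.
Qed.

Lemma W_3 (z : C) : W (3 * z) = qpow 1 z.
Proof. rewrite <- INR_3, W_INR, <- qpow_W. f_equal. simpl. field. Qed.

Lemma INR_mul_3 (m : nat) (z : C) : (INR (S m) * (3 * z) = 3 * (INR (S m) * z))%C.
Proof. ring. Qed.

Lemma eta_partial_lim (z : C) : inH z ->
  clim (fun N => eta_partial N z) (cexp (- Lam z)).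
Proof.
  intros Hz.
  pose proof (QS_lambert _ _ _ 1 1 (QS_qsum _ adm_log_coef) eq_refl log_coef_bound
    (QS_qsum _ adm_lambert_log) _ (inH_3 z Hz)) as P.
  pose proof (clim_cexp _ _ (clim_scal (-1) _ _ P)) as E.
  replace (-1 * qsum (lambert log_coef) (3 * z))%C with (- Lam z)%C in E by (unfold Lam; ring).
  eapply clim_ext; [|exact E]. intros N. cbv beta. induction N as [|N IH].
  - cbn [csum eta_partial]. rewrite Cmult_0_r. apply cexp_0.
  - cbn [csum]. cbn [eta_partial]. rewrite <- IH, Cmult_plus_distr_l, cexp_add. f_equal.
    replace (-1 * qsum log_coef (INR (S N) * (3 * z)))%C
      with (- qsum log_coef (INR (S N) * (3 * z)))%C by ring.
    rewrite cexp_log_sum by (apply inH_scal; [apply lt_0_INR; lia | apply inH_3, Hz]).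
    f_equal. f_equal. rewrite INR_mul_3, W_3. unfold qpow. f_equal.
    rewrite !RtoC_mult. ring.
Qed.

Lemma eta_Lam (z : C) : inH z -> eta z = (qpow (1 / 24) z * cexp (- Lam z))%C.
Proof.
  intros Hz. unfold eta. f_equal. pose proof (eta_partial_lim z Hz) as P.
  apply filterlim_clim in P.
  set (F := filtermap (fun N => eta_partial N z) eventually) in *.
  (* [lim] is specified only for proper Cauchy filters; the convergence just established supplies
     the Cauchy property. *)
  assert (PF : ProperFilter F) by (apply filtermap_proper_filter, eventually_filter).
  assert (CF : @cauchy C_UniformSpace F).
  { intros eps. exists (cexp (- Lam z)). apply P. exists eps. auto. }
  assert (Q : clim (fun N => eta_partial N z) (@lim C_CompleteNormedModule F)).
  { apply filterlim_clim. intros Pr [eps HP].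
    apply (filter_imp _ _ (fun y Hy => HP y Hy)).
    apply (@complete_cauchy C_CompleteNormedModule F PF CF eps). }
  exact (clim_unique _ _ _ Q (eta_partial_lim z Hz)).
Qed.

(** As [pf] is [-4 pi^2 x / (1 - x)^2] with [x = e^(2 pi i u)], the values [pf (m z)] add up to a
    Lambert series with coefficients [n]. *)
Lemma Sig_lim (z : C) : inH z ->
  clim (csum (fun m => pf (INR (S m) * z))) (- (4 * (PI * PI)) * Sig z)%C.
Proof.
  intros Hz.
  pose proof (QS_lambert _ _ _ 1 1 QS_id_coef eq_refl id_coef_bound
    (QS_qsum _ adm_lambert_id) _ (inH_3 z Hz)) as P.
  pose proof (clim_scal (- (4 * (PI * PI))) _ _ P) as E.
  eapply clim_ext; [|exact E]. intros N. cbv beta. rewrite <- csum_scal. apply csum_ext.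
  intros m Hm. rewrite INR_mul_3, W_3. unfold pf, Cdiv. ring.
Qed.

(** * The quasimodularity of the weight 2 Eisenstein series *)

Lemma inH_neq_0 (z : C) : inH z -> z <> 0%C.
Proof. intros H E. subst z. unfold inH in H. simpl in H. lra. Qed.

Definition gap (z : C) : R := Im z / (2 * Cmod z).

Lemma gap_pos (z : C) : inH z -> 0 < gap z.
Proof.
  intros H. pose proof (proj1 (Cmod_gt_0 z) (inH_neq_0 z H)).
  apply Rdiv_lt_0_compat; [exact H | lra].
Qed.

Lemma gap_le_half (z : C) : inH z -> gap z <= / 2.
Proof.
  intros H. pose proof (proj1 (Cmod_gt_0 z) (inH_neq_0 z H)) as P.
  pose proof (im_le_Cmod z) as Q. rewrite Rabs_pos_eq in Q by (unfold inH in H; lra).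
  unfold gap. apply Rmult_le_reg_r with (2 * Cmod z); [lra|].
  replace (Im z / (2 * Cmod z) * (2 * Cmod z)) with (Im z) by (field; lra). lra.
Qed.

(** The bound is uniform in [m]: if [|m z| <= |x| / 2], the real term dominates, and otherwise the
    imaginary part [m Im z] is large enough. *)
Lemma gap_bound (z : C) (m x : R) : inH z -> gap z * Rabs x <= Cmod (x + m * z).
Proof.
  intros H. pose proof (proj1 (Cmod_gt_0 z) (inH_neq_0 z H)) as P.
  pose proof (gap_le_half z H) as G. pose proof (gap_pos z H) as G0.
  pose proof (Rabs_pos x) as Px.
  destruct (Rle_lt_dec (Rabs m * Cmod z) (Rabs x / 2)) as [L|L].
  - pose proof (Cmod_rev_triangle x (- (m * z))) as T.
    rewrite Cmod_opp, Cmod_mult, !Cmod_R in T.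
    replace (x - - (m * z))%C with (x + m * z)%C in T by ring. nra.
  - pose proof (im_le_Cmod (x + m * z)) as T. rewrite im_plus, im_RtoC, im_scal_l, Rplus_0_l in T.
    rewrite Rabs_mult, (Rabs_pos_eq (Im z)) in T by (unfold inH in H; lra).
    eapply Rle_trans; [|exact T]. unfold gap.
    apply Rmult_le_reg_r with (2 * Cmod z); [lra|].
    replace (Im z / (2 * Cmod z) * Rabs x * (2 * Cmod z)) with (Im z * Rabs x) by (field; lra).
    unfold inH in H. nra.
Qed.

Lemma gap_far (z : C) (m : Z) : inH z -> far (gap z) (IZR m * z).
Proof.
  intros H. split; [apply gap_pos, H|]. intros M HM.
  pose proof (gap_bound z (IZR m) (INR M) H) as A.
  pose proof (gap_bound z (- IZR m) (INR M) H) as B.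
  rewrite Rabs_pos_eq in A, B by apply pos_INR. split; [exact A|].
  rewrite RtoC_opp in B. replace (INR M - IZR m * z)%C with (INR M + - IZR m * z)%C by ring.
  exact B.
Qed.

(** The sum of [1 / (m z + n)^2] over all integers [n]. The row [m = 0] lacks the term [n = 0],
    which leaves [pi^2 / 3]. *)
Definition lat_row (z : C) (m : Z) : C :=
  if Z.eq_dec m 0 then (PI * PI / 3)%C else pf (IZR m * z).

Lemma pow4_inv_lim : clim (fun n => / 4 ^ n)%C 0%C.
Proof.
  intros eps He. destruct (pow_to_zero (/ 4) eps) as [N HN]; [lra | exact He|].
  exists N. intros n Hn. specialize (HN n Hn).
  assert (N4 : RtoC 4 <> 0%C) by (intros E; apply RtoC_inj in E; lra).
  replace (/ 4 ^ n - 0)%C with ((/ 4) ^ n)%C by (rewrite Cpow_inv by auto; ring).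
  rewrite Cmod_pow, Cmod_inv, Cmod_R, Rabs_pos_eq by (auto; lra). exact HN.
Qed.

Lemma pow4_neq_0 (n : nat) : (4 ^ n)%C <> 0%C.
Proof. apply Cpow_nz. intros E. apply RtoC_inj in E. lra. Qed.

Lemma lat_row_lim (z : C) (m : Z) : inH z ->
  clim (fun n => / 4 ^ n * dup_sum (IZR m * z) n)%C (lat_row z m).
Proof.
  intros Hz. unfold lat_row. destruct (Z.eq_dec m 0) as [->|Hm].
  - replace (0 * z)%C with (RtoC 0) by ring.
    pose proof (clim_minus _ _ _ _ (clim_const (PI * PI / 3)%C)
      (clim_scal (PI * PI / 3) _ _ pow4_inv_lim)) as P.
    rewrite Cmult_0_r in P. replace (PI * PI / 3 - 0)%C with (PI * PI / 3)%C in P by ring.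
    eapply clim_ext; [|exact P]. intros n. cbv beta. rewrite dup_sum_0.
    pose proof (pow4_neq_0 n). generalize dependent (4 ^ n)%C. generalize (RtoC PI).
    intros; field; auto.
  - eapply clim_ext; [|apply clim_const]. intros n. cbv beta. rewrite dup_sum_H.
    + field. apply pow4_neq_0.
    + rewrite im_scal_l. apply Rmult_integral_contrapositive_currified.
      * intros E. apply eq_IZR in E. auto.
      * unfold inH in Hz. lra.
Qed.

(** This is [(pi^2 / 3) E_2], the lattice sum taken row by row. *)
Definition Eis (z : C) : C := (PI * PI / 3 - 8 * (PI * PI) * Sig z)%C.

Lemma zsum_lat_row_lim (z : C) : inH z -> clim (zsum (lat_row z)) (Eis z).
Proof.
  intros Hz. pose proof (clim_plus _ _ _ _ (clim_const (PI * PI / 3)%C)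
    (clim_scal 2 _ _ (Sig_lim z Hz))) as P.
  replace (PI * PI / 3 + 2 * (- (4 * (PI * PI)) * Sig z))%C with (Eis z) in P
    by (unfold Eis; ring).
  eapply clim_ext; [|exact P]. intros N. cbv beta. induction N as [|N IH].
  - simpl. unfold lat_row. simpl. ring.
  - cbn [zsum csum]. rewrite <- IH. unfold lat_row.
    destruct (Z.eq_dec (Z.of_nat (S N)) 0); [lia|].
    destruct (Z.eq_dec (- Z.of_nat (S N)) 0); [lia|].
    rewrite opp_IZR, <- INR_IZR_INZ, RtoC_opp.
    replace (- INR (S N) * z)%C with (- (INR (S N) * z))%C by ring. rewrite pf_opp. ring.
Qed.

(* The term [m = n = 0] contributes [/ 0 = 0]. *)
Definition lat_sq (z : C) (N : nat) : C :=
  zsum (fun m => zsum (fun n => / ((IZR m * z + IZR n) * (IZR m * z + IZR n)))%C N) N.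

(** The tail corrections of all rows. Those with [+ m z] and with [- m z] have the same sum over
    [|m| <= N], whence the factor 2 in [lat_sq_lim]. *)
Definition lat_edge (z : C) (N : nat) : C :=
  zsum (fun m => / (INR (S N) + IZR m * z))%C N.

(** The square of indices is stable under the quarter turn [(m, n) -> (n, -m)], which permutes the
    terms and fixes the omitted one. *)
Lemma lat_sq_inv (z : C) (N : nat) : z <> 0%C ->
  (lat_sq (- / z) N / (z * z))%C = lat_sq z N.
Proof.
  intros Hz. unfold lat_sq.
  transitivity (zsum (fun a => zsum (fun b =>
    / ((IZR b * z + IZR (- a)) * (IZR b * z + IZR (- a))))%C N) N).
  - unfold Cdiv. rewrite Cmult_comm, <- zsum_scal. apply zsum_ext. intros m _.
    rewrite <- zsum_scal. apply zsum_ext. intros n _. rewrite opp_IZR, RtoC_opp.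
    destruct (Ceq_dec (IZR n * z + - IZR m) 0) as [E|E].
    + rewrite E. replace (IZR m * - / z + IZR n)%C with ((IZR n * z + - IZR m) / z)%C
        by (field; auto).
      rewrite E. replace (0 / z * (0 / z))%C with (RtoC 0) by (field; auto).
      replace (0 * 0)%C with (RtoC 0) by ring. rewrite Cinv_0. ring.
    + replace (IZR m * - / z + IZR n)%C with ((IZR n * z + - IZR m) / z)%C by (field; auto).
      field. auto.
  - rewrite (zsum_swap (fun m n => / ((IZR m * z + IZR n) * (IZR m * z + IZR n)))%C).
    rewrite <- (zsum_opp (fun n => zsum (fun m =>
      / ((IZR m * z + IZR n) * (IZR m * z + IZR n)))%C N)).
    reflexivity.
Qed.

Lemma clim_of_bound (u : nat -> C) (K : R) :
  (forall n, Cmod (u n) <= K / INR (S n)) -> clim u 0.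
Proof.
  intros H eps He.
  assert (HK : 0 <= K).
  { specialize (H 0%nat). simpl in H. pose proof (Cmod_ge_0 (u 0%nat)). lra. }
  destruct (archimed (K / eps)) as [Hup _]. set (N := Z.to_nat (up (K / eps))).
  assert (HN : K / eps <= INR N).
  { unfold N. rewrite INR_IZR_INZ, Z2Nat.id; [lra|]. apply le_IZR.
    pose proof (Rdiv_le_0_compat K eps HK He). lra. }
  exists N. intros n Hn. replace (u n - 0)%C with (u n) by ring.
  eapply Rle_lt_trans; [apply H|].
  assert (Hp : 0 < INR (S n)) by (apply lt_0_INR; lia).
  apply Rmult_lt_reg_r with (INR (S n)); [exact Hp|].
  unfold Rdiv. rewrite Rmult_assoc, Rinv_l, Rmult_1_r by lra.
  apply Rle_lt_trans with (eps * INR N).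
  - apply Rmult_le_reg_r with (/ eps); [apply Rinv_0_lt_compat; auto|].
    replace (eps * INR N * / eps) with (INR N) by (field; lra). exact HN.
  - apply Rmult_lt_compat_l; [auto|]. apply lt_INR. lia.
Qed.

Lemma lat_sq_lim (z : C) : inH z ->
  clim (fun N => lat_sq z N + 2 * lat_edge z N)%C (Eis z).
Proof.
  intros Hz. apply clim_dist with (zsum (lat_row z)); [apply zsum_lat_row_lim, Hz|].
  pose proof (gap_pos z Hz) as G. assert (G3 : 0 < gap z ^ 3) by (apply pow_lt; auto).
  apply (clim_of_bound _ (4 / gap z ^ 3)). intros N.
  replace (lat_sq z N + 2 * lat_edge z N - zsum (lat_row z) N)%C
    with (zsum (fun m => pole_sum_corr (IZR m * z) N - lat_row z m)%C N).
  - assert (Hp : 0 < INR (S N)) by (apply lt_0_INR; lia).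
    eapply Rle_trans.
    + apply (zsum_bound _ (2 / gap z ^ 3 / (INR (S N) * INR (S N)))). intros m Hm.
      apply pole_sum_corr_error; [apply gap_far, Hz | apply lat_row_lim, Hz].
    + rewrite S_INR in *. set (x := INR N + 1) in *.
      replace (2 * INR N + 1) with (2 * x - 1) by (unfold x; ring).
      apply Rle_trans with (2 * x * (2 / gap z ^ 3 / (x * x))).
      * apply Rmult_le_compat_r; [|lra]. rpos.
      * right. field. split; lra.
  - rewrite zsum_minus. unfold pole_sum_corr. rewrite !zsum_plus. unfold lat_sq, lat_edge.
    rewrite <- (zsum_opp (fun m => / (INR (S N) - IZR m * z))%C).
    rewrite (zsum_ext (fun k => / (INR (S N) - IZR (- k) * z))%C
      (fun m => / (INR (S N) + IZR m * z))%C).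
    + ring.
    + intros k _. f_equal. rewrite opp_IZR, RtoC_opp. ring.
Qed.

(** * Exponentials of the boundary sums *)

Fixpoint zprod (f : Z -> C) (N : nat) : C :=
  match N with
  | O => f 0%Z
  | S n => (zprod f n * (f (Z.of_nat (S n)) * f (- Z.of_nat (S n))%Z))%C
  end.

Lemma zprod_ext (f g : Z -> C) (N : nat) :
  (forall k, (Z.abs k <= Z.of_nat N)%Z -> f k = g k) -> zprod f N = zprod g N.
Proof.
  intros H. induction N as [|N IH]; cbn [zprod]; [apply H; simpl; lia|].
  rewrite IH, !H by (intros; try apply H; lia). reflexivity.
Qed.

Lemma zprod_telescope (a : Z -> C) (N : nat) : (forall m, a m <> 0%C) ->
  zprod (fun m => a (m + 1)%Z / a m)%C N = (a (Z.of_nat (S N)) / a (- Z.of_nat N)%Z)%C.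
Proof.
  intros H. induction N as [|N IH].
  - reflexivity.
  - cbn [zprod]. rewrite IH.
    replace (Z.of_nat (S N) + 1)%Z with (Z.of_nat (S (S N))) by lia.
    replace (- Z.of_nat (S N) + 1)%Z with (- Z.of_nat N)%Z by lia.
    field. auto.
Qed.

Lemma zprod_cexp (f u : Z -> C) (N : nat) :
  zprod (fun m => f m * cexp (- u m))%C N = (zprod f N * cexp (- zsum u N))%C.
Proof.
  induction N as [|N IH]; cbn [zprod zsum]; [reflexivity|].
  rewrite IH, !Copp_plus_distr, !cexp_add. ring.
Qed.

Lemma zprod_near_1 (e : Z -> C) (h : R) (N : nat) :
  (forall k, (Z.abs k <= Z.of_nat N)%Z -> Cmod (e k - 1) <= h) ->
  Cmod (zprod e N - 1) <= (1 + h) ^ (2 * N + 1) - 1.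
Proof.
  intros H. assert (Hh : 0 <= h) by (pose proof (H 0%Z ltac:(lia)); pose proof (Cmod_ge_0 (e 0%Z - 1)); lra).
  assert (M : forall x y X Y, Cmod (x - 1) <= X - 1 -> Cmod (y - 1) <= Y - 1 ->
    Cmod (x * y - 1) <= X * Y - 1).
  { intros x y X Y Hx Hy.
    replace (x * y - 1)%C with ((x - 1) * (y - 1) + ((x - 1) + (y - 1)))%C by ring.
    eapply Rle_trans; [apply Cmod_triangle|]. rewrite Cmod_mult.
    pose proof (Cmod_triangle (x - 1) (y - 1)).
    pose proof (Cmod_ge_0 (x - 1)). pose proof (Cmod_ge_0 (y - 1)). nra. }
  induction N as [|N IH]; cbn [zprod].
  - pose proof (H 0%Z ltac:(lia)). simpl. lra.
  - replace (2 * S N + 1)%nat with (2 * N + 1 + 2)%nat by lia. rewrite pow_add.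
    apply M; [apply IH; intros; apply H; lia|].
    replace ((1 + h) ^ 2) with ((1 + h) * (1 + h)) by ring.
    apply M; [pose proof (H (Z.of_nat (S N)) ltac:(lia)) | pose proof (H (- Z.of_nat (S N))%Z ltac:(lia))]; lra.
Qed.

(** The estimate [log (1 + u) = u + O(u^2)] in a form without logarithms. *)
Lemma one_plus_cexp (u : C) : Cmod u <= 1 ->
  Cmod ((1 + u) * cexp (- u) - 1) <= (1 + 2 * exp 1) * Cmod u ^ 2.
Proof.
  intros H. replace ((1 + u) * cexp (- u) - 1)%C
    with ((1 + u) * (cexp (- u) - 1 - (- u)) - u * u)%C by ring.
  eapply Rle_trans; [apply Cmod_sub_le|]. rewrite !Cmod_mult.
  pose proof (cexp_bound1 (- u)) as B. rewrite Cmod_opp in B.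
  pose proof (exp_mono _ _ H) as E. pose proof (Cmod_triangle 1 u) as T. rewrite Cmod_1 in T.
  pose proof (Cmod_ge_0 u). pose proof (Cmod_ge_0 (1 + u)).
  assert (P : Cmod u ^ 2 * exp (Cmod u) <= Cmod u ^ 2 * exp 1)
    by (apply Rmult_le_compat_l; [apply pow_le; auto | auto]).
  assert (Q : Cmod (1 + u) * Cmod (cexp (- u) - 1 - - u) <= 2 * (Cmod u ^ 2 * exp 1)).
  { apply Rmult_le_compat; auto using Cmod_ge_0; lra. }
  simpl in *. lra.
Qed.

Lemma exp_minus_1_le (x : R) : 0 <= x -> exp x - 1 <= x * exp x.
Proof.
  intros H. pose proof (exp_ineq1_le (- x)) as P. pose proof (exp_pos x) as Q.
  assert (E : exp x * exp (- x) = 1) by (rewrite <- exp_plus, Rplus_opp_r; apply exp_0).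
  nra.
Qed.

(** Each of the [2 N + 1] factors [(1 + u) e^(-u)] is 1 up to [O(1/N^2)], so the product is 1 up to
    [O(1/N)]. *)
Lemma zprod_cexp_lim (u : nat -> Z -> C) (c : R) :
  (forall N m, (Z.abs m <= Z.of_nat N)%Z -> Cmod (u N m) <= c / INR (S N)) ->
  clim (fun N => zprod (fun m => 1 + u N m)%C N * cexp (- zsum (u N) N))%C 1.
Proof.
  intros H. assert (Hc : 0 <= c).
  { specialize (H 0%nat 0%Z ltac:(lia)). simpl in H. pose proof (Cmod_ge_0 (u 0%nat 0%Z)). lra. }
  set (k := 1 + 2 * exp 1). assert (Hk : 0 < k) by (unfold k; pose proof (exp_pos 1); lra).
  destruct (clim_of_bound (fun N => RtoC (c / INR (S N))) c) with (eps := 1) as [N0 HN0]; [|lra|].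
  { intros n. rewrite Cmod_R, Rabs_pos_eq; [lra|]. apply Rdiv_le_0_compat; [auto | apply lt_0_INR; lia]. }
  set (K := 2 * k * (c * c)). assert (HK : 0 <= K) by (unfold K; rpos).
  assert (Bd : forall N, (N0 <= N)%nat ->
    Cmod (zprod (fun m => 1 + u N m)%C N * cexp (- zsum (u N) N) - 1) <= K * exp K / INR (S N)).
  { intros N HN. specialize (HN0 N HN).
    replace (RtoC (c / INR (S N)) - 0)%C with (RtoC (c / INR (S N))) in HN0 by ring.
    assert (Hp : 0 < INR (S N)) by (apply lt_0_INR; lia).
    assert (Hcp : 0 <= c / INR (S N)) by (apply Rdiv_le_0_compat; auto).
    rewrite Cmod_R, Rabs_pos_eq in HN0 by auto.
    rewrite <- zprod_cexp. set (h := k * (c / INR (S N)) ^ 2).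
    assert (Hh : 0 <= h) by (unfold h; apply Rmult_le_pos; [lra | apply pow_le; auto]).
    eapply Rle_trans; [apply (zprod_near_1 _ h)|].
    - intros m Hm. specialize (H N m Hm).
      eapply Rle_trans; [apply one_plus_cexp; lra|]. fold k. unfold h.
      apply Rmult_le_compat_l; [lra|]. apply pow_incr. split; [apply Cmod_ge_0 | auto].
    - apply Rle_trans with (exp (INR (2 * N + 1) * h) - 1).
      { rewrite exp_pow_INR. apply Rplus_le_compat_r. apply pow_incr.
        split; [lra|]. apply exp_ineq1_le. }
      assert (X : INR (2 * N + 1) * h <= K / INR (S N)).
      { unfold h, K. rewrite plus_INR, mult_INR. simpl (INR 2). simpl (INR 1).
        rewrite S_INR in *. set (x := INR N + 1) in *.
        replace ((1 + 1) * INR N + 1) with (2 * x - 1) by (unfold x; ring).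
        replace (2 * k * (c * c) / x) with (2 * x * (k * (c / x) ^ 2)) by (field; lra).
        apply Rmult_le_compat_r; [rpos; apply pow_le; auto | lra]. }
      assert (X0 : 0 <= INR (2 * N + 1) * h) by (apply Rmult_le_pos; [apply pos_INR | auto]).
      assert (X1 : K / INR (S N) <= K).
      { rewrite <- (Rmult_1_r K) at 2. unfold Rdiv. apply Rmult_le_compat_l; [auto|].
        rewrite <- Rinv_1. apply Rinv_le_contravar; [lra|]. apply (le_INR 1). lia. }
      eapply Rle_trans; [apply exp_minus_1_le, X0|].
      replace (K * exp K / INR (S N)) with (K / INR (S N) * exp K) by (field; lra).
      apply Rmult_le_compat; auto.
      + apply Rlt_le, exp_pos.
      + apply exp_mono. lra. }
  intros eps He.
  destruct (clim_of_bound (fun N => RtoC (K * exp K / INR (S N))) (K * exp K)) with (eps := eps)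
    as [N1 HN1]; [|exact He|].
  { intros n. rewrite Cmod_R, Rabs_pos_eq; [lra|].
    apply Rdiv_le_0_compat; [|apply lt_0_INR; lia]. apply Rmult_le_pos; [auto | apply Rlt_le, exp_pos]. }
  exists (N0 + N1)%nat. intros n Hn. eapply Rle_lt_trans; [apply Bd; lia|].
  specialize (HN1 n ltac:(lia)).
  replace (RtoC (K * exp K / INR (S n)) - 0)%C with (RtoC (K * exp K / INR (S n))) in HN1 by ring.
  rewrite Cmod_R in HN1. eapply Rle_lt_trans; [apply Rle_abs | exact HN1].
Qed.

Lemma clim_inv (u : nat -> C) (l : C) : l <> 0%C -> clim u l -> clim (fun n => / u n)%C (/ l)%C.
Proof.
  intros Hl H. pose proof (proj1 (Cmod_gt_0 l) Hl) as P.
  intros eps He.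
  destruct (H (Rmin (Cmod l / 2) (eps * Cmod l * Cmod l / 2))) as [N HN].
  { apply Rmin_pos; [lra|]. assert (0 < eps * Cmod l * Cmod l) by rpos. lra. }
  exists N. intros n Hn. specialize (HN n Hn).
  pose proof (Rmin_l (Cmod l / 2) (eps * Cmod l * Cmod l / 2)).
  pose proof (Rmin_r (Cmod l / 2) (eps * Cmod l * Cmod l / 2)).
  pose proof (Cmod_rev_triangle l (u n)) as T. rewrite (Cmod_sub_sym l (u n)) in T.
  assert (Hu : Cmod l / 2 < Cmod (u n)) by lra.
  assert (Hu0 : u n <> 0%C) by (apply Cmod_gt_0; lra).
  replace (/ u n - / l)%C with (- (u n - l) / (u n * l))%C by (field; auto).
  rewrite Cmod_div by (apply Cmult_neq_0; auto). rewrite Cmod_opp, Cmod_mult.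
  assert (Hp : 0 < Cmod (u n) * Cmod l) by rpos.
  apply Rmult_lt_reg_r with (Cmod (u n) * Cmod l); [exact Hp|].
  unfold Rdiv. rewrite Rmult_assoc, Rinv_l, Rmult_1_r by lra.
  assert (eps * Cmod l * (Cmod l / 2) <= eps * Cmod l * Cmod (u n))
    by (apply Rmult_le_compat_l; [rpos | lra]).
  lra.
Qed.

Lemma clim_inv_INR (c : C) : clim (fun N => c / INR (S N))%C 0.
Proof.
  apply (clim_of_bound _ (Cmod c)). intros n. rewrite Cmod_div by (apply INR_neq_0; lia).
  rewrite Cmod_R, Rabs_pos_eq by apply pos_INR. lra.
Qed.

(** Equal to [z * lat_edge z N - lat_edge (- / z) N / z]: what survives when [lat_sq_lim] at [z] and
    at [-1/z] are subtracted and the square sums cancel. *)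
Definition edge (z : C) (N : nat) : C :=
  (zsum (fun m => z / (INR (S N) + IZR m * z)) N - zsum (fun m => / (INR (S N) * z + IZR m)) N)%C.

Lemma edge_denominators (z : C) (N : nat) (m : Z) : inH z ->
  (INR (S N) + IZR m * z)%C <> 0%C /\ (INR (S N) * z + IZR m)%C <> 0%C.
Proof.
  intros Hz. assert (P : 0 < INR (S N)) by (apply lt_0_INR; lia). split.
  - apply Cmod_gt_0. eapply Rlt_le_trans; [|apply gap_bound, Hz].
    rewrite Rabs_pos_eq by lra. apply Rmult_lt_0_compat; [apply gap_pos, Hz | exact P].
  - intros E. apply (f_equal Im) in E. rewrite im_plus, im_scal_l, !im_RtoC in E.
    unfold inH in Hz. nra.
Qed.

(** With [M = N + 1], both [1 + z / (M + m z)] and [1 + 1 / (M z + m)] are quotients of consecutive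
    denominators. Their products telescope to limits [(1+z)/(1-z)] and [(1+z)/(z-1)], whose quotient
    is -1. *)
Lemma cexp_edge_lim (z : C) : inH z -> clim (fun N => cexp (edge z N)) (-1).
Proof.
  intros Hz. pose proof (inH_neq_0 z Hz) as Hz0.
  assert (Hz1 : (1 - z)%C <> 0%C).
  { intros E. unfold inH in Hz. apply (f_equal Im) in E. unfold Im in *. simpl in E. lra. }
  assert (Hz2 : (1 + z)%C <> 0%C).
  { intros E. unfold inH in Hz. apply (f_equal Im) in E. unfold Im in *. simpl in E. lra. }
  assert (Hz3 : (z - 1)%C <> 0%C).
  { intros E. apply Hz1. replace (1 - z)%C with (- (z - 1))%C by ring. rewrite E. ring. }
  pose proof (gap_pos z Hz) as G.
  set (u := fun N m => (z / (INR (S N) + IZR m * z))%C).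
  set (v := fun N m => (/ (INR (S N) * z + IZR m))%C).
  assert (Lu : clim (fun N => zprod (fun m => 1 + u N m)%C N * cexp (- zsum (u N) N))%C 1).
  { apply (zprod_cexp_lim u (Cmod z / gap z)). intros N m _. unfold u.
    assert (P : 0 < INR (S N)) by (apply lt_0_INR; lia).
    rewrite Cmod_div by (apply edge_denominators, Hz).
    pose proof (gap_bound z (IZR m) (INR (S N)) Hz) as B. rewrite Rabs_pos_eq in B by lra.
    replace (Cmod z / gap z / INR (S N)) with (Cmod z / (gap z * INR (S N))) by (field; lra).
    apply Rmult_le_compat_l; [apply Cmod_ge_0|]. apply Rinv_le_contravar; [rpos | exact B]. }
  assert (Lv : clim (fun N => zprod (fun m => 1 + v N m)%C N * cexp (- zsum (v N) N))%C 1).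
  { apply (zprod_cexp_lim v (/ Im z)). intros N m _. unfold v. unfold inH in Hz.
    assert (P : 0 < INR (S N)) by (apply lt_0_INR; lia).
    rewrite Cmod_inv by (apply edge_denominators, Hz).
    replace (/ Im z / INR (S N)) with (/ (INR (S N) * Im z)) by (field; lra).
    apply Rinv_le_contravar; [rpos|].
    eapply Rle_trans; [|apply im_le_Cmod]. rewrite im_plus, im_scal_l, im_RtoC, Rplus_0_r.
    apply Rle_abs. }
  assert (Pu : clim (fun N => zprod (fun m => 1 + u N m)%C N) ((1 + z) * / (1 - z))%C).
  { assert (L : clim (fun N => (1 - z) + z / INR (S N))%C (1 - z)%C).
    { replace (1 - z)%C with (1 - z + 0)%C at 1 by ring.
      apply clim_plus; [apply clim_const | apply clim_inv_INR]. }
    eapply clim_ext; [|apply (clim_scal (1 + z) _ _ (clim_inv _ _ Hz1 L))].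
    intros N. cbv beta.
    rewrite (zprod_ext _ (fun m => (INR (S N) + IZR (m + 1) * z) / (INR (S N) + IZR m * z))%C).
    - rewrite (zprod_telescope (fun m => INR (S N) + IZR m * z)%C)
        by (intros; apply edge_denominators, Hz).
      rewrite opp_IZR, <- !INR_IZR_INZ, RtoC_opp.
      pose proof (proj1 (edge_denominators z N (- Z.of_nat N) Hz)) as D.
      rewrite opp_IZR, <- INR_IZR_INZ, RtoC_opp in D.
      pose proof (INR_neq_0 (S N) ltac:(lia)) as E. rewrite S_INR, RtoC_plus in *.
      generalize dependent (RtoC (INR N)). intros n D E. field. repeat split; auto.
    - intros k _. unfold u. rewrite plus_IZR, RtoC_plus.
      pose proof (proj1 (edge_denominators z N k Hz)) as D.
      generalize dependent (RtoC (INR (S N))). intros; field; auto. }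
  assert (Pv : clim (fun N => zprod (fun m => 1 + v N m)%C N) ((1 + z) * / (z - 1))%C).
  { assert (L : clim (fun N => (z - 1) + 1 / INR (S N))%C (z - 1)%C).
    { replace (z - 1)%C with (z - 1 + 0)%C at 1 by ring.
      apply clim_plus; [apply clim_const | apply clim_inv_INR]. }
    eapply clim_ext; [|apply (clim_scal (1 + z) _ _ (clim_inv _ _ Hz3 L))].
    intros N. cbv beta.
    rewrite (zprod_ext _ (fun m => (INR (S N) * z + IZR (m + 1)) / (INR (S N) * z + IZR m))%C).
    - rewrite (zprod_telescope (fun m => INR (S N) * z + IZR m)%C)
        by (intros; apply edge_denominators, Hz).
      rewrite opp_IZR, <- !INR_IZR_INZ, RtoC_opp.
      pose proof (proj2 (edge_denominators z N (- Z.of_nat N) Hz)) as D.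
      rewrite opp_IZR, <- INR_IZR_INZ, RtoC_opp in D.
      pose proof (INR_neq_0 (S N) ltac:(lia)) as E. rewrite S_INR, RtoC_plus in *.
      generalize dependent (RtoC (INR N)). intros n D E. field. repeat split; auto.
    - intros k _. unfold v. rewrite plus_IZR, RtoC_plus.
      pose proof (proj2 (edge_denominators z N k Hz)) as D.
      generalize dependent (RtoC (INR (S N))). intros; field; auto. }
  (* [exp (sum u - sum v) = (prod (1+u) / prod (1+v)) * (1 + o(1))] *)
  assert (Iv : clim (fun N => / (zprod (fun m => 1 + v N m)%C N))%C (/ ((1 + z) * / (z - 1)))%C).
  { apply clim_inv; [|exact Pv]. apply Cmult_neq_0; [auto|]. intros E.
    apply (Cmult_neq_0 _ _ Hz3 Hz3). replace ((z - 1) * (z - 1))%C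
      with (/ (z - 1) * ((z - 1) * (z - 1) * (z - 1)))%C by (field; auto). rewrite E. ring. }
  pose proof (clim_mult _ _ _ _ (clim_mult _ _ _ _ Pu Lv)
    (clim_mult _ _ _ _ Iv (clim_inv _ _ C1_nz Lu))) as P.
  replace ((1 + z) * / (1 - z) * 1 * (/ ((1 + z) * / (z - 1)) * / 1))%C with (RtoC (-1)) in P.
  2:{ field. repeat split; auto. }
  apply clim_dist with (1 := P).
  intros eps He.
  (* The products have to be nonzero before they are cancelled; this holds for large [N] because,
     times an exponential, they tend to 1. *)
  assert (Nz : exists N0, forall N, (N0 <= N)%nat ->
    zprod (fun m => 1 + u N m)%C N <> 0%C /\ zprod (fun m => 1 + v N m)%C N <> 0%C).
  { destruct (Lu (1 / 2)) as [a Ha]; [lra|]. destruct (Lv (1 / 2)) as [b Hb]; [lra|].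
    exists (a + b)%nat. intros N HN. specialize (Ha N ltac:(lia)). specialize (Hb N ltac:(lia)).
    split; intros E; [rewrite E in Ha | rewrite E in Hb].
    - replace (0 * cexp (- zsum (u N) N) - 1)%C with (- (1))%C in Ha by ring. rewrite Cmod_m1 in Ha. lra.
    - replace (0 * cexp (- zsum (v N) N) - 1)%C with (- (1))%C in Hb by ring. rewrite Cmod_m1 in Hb. lra. }
  destruct Nz as [N0 HN0]. exists N0. intros N HN. destruct (HN0 N HN) as [A B].
  match goal with |- Cmod ?x < _ => replace x with (RtoC 0) end; [rewrite Cmod_0; exact He|].
  unfold edge. change (zsum (fun m => z / (INR (S N) + IZR m * z))%C N) with (zsum (u N) N).
  change (zsum (fun m => / (INR (S N) * z + IZR m))%C N) with (zsum (v N) N).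
  replace (zsum (u N) N - zsum (v N) N)%C with (zsum (u N) N + - zsum (v N) N)%C by ring.
  rewrite cexp_add, !cexp_opp.
  pose proof (cexp_neq_0 (zsum (u N) N)). pose proof (cexp_neq_0 (zsum (v N) N)).
  field. repeat split; auto.
Qed.

Lemma im_inv_opp (z : C) : z <> 0%C -> Im (- / z) = Im z / (Cmod z * Cmod z).
Proof.
  intros H. pose proof (proj1 (Cmod_gt_0 z) H) as P. destruct z as [x y].
  pose proof (Cmod_pair_sq x y) as E. rewrite E. unfold Im. simpl.
  assert (x * x + y * y <> 0) by nra. field. nra.
Qed.

Lemma inH_S (z : C) : inH z -> inH (- / z).
Proof.
  intros H. pose proof (inH_neq_0 z H) as N. pose proof (proj1 (Cmod_gt_0 z) N) as P.
  unfold inH. rewrite im_inv_opp by auto. apply Rdiv_lt_0_compat; [exact H | nra].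
Qed.

(** The failure of weight 2 invariance, scaled to be the limit of [edge]; it turns out to be the
    constant [pi i]. *)
Definition Kf (z : C) : C := (z / 2 * (Eis z - Eis (- / z) / (z * z)))%C.

Lemma edge_lim (z : C) : inH z -> clim (edge z) (Kf z).
Proof.
  intros Hz. pose proof (inH_neq_0 z Hz) as N.
  pose proof (lat_sq_lim z Hz) as A. pose proof (lat_sq_lim _ (inH_S z Hz)) as B.
  pose proof (clim_scal (z / 2) _ _ (clim_minus _ _ _ _ A (clim_scal (/ (z * z)) _ _ B))) as P.
  replace (z / 2 * (Eis z - / (z * z) * Eis (- / z)))%C with (Kf z) in P
    by (unfold Kf, Cdiv; ring).
  eapply clim_ext; [|exact P]. intros n. cbv beta.
  transitivity (z * lat_edge z n - lat_edge (- / z) n / z)%C.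
  - rewrite <- (lat_sq_inv z n N). field. auto.
  - unfold edge, lat_edge. rewrite <- zsum_scal. f_equal.
    unfold Cdiv at 1. rewrite Cmult_comm, <- zsum_scal, <- zsum_opp.
    apply zsum_ext. intros m _. rewrite opp_IZR, RtoC_opp.
    pose proof (proj2 (edge_denominators z n m Hz)) as D.
    replace (INR (S n) + - IZR m * - / z)%C with ((INR (S n) * z + IZR m) / z)%C.
    + generalize dependent (RtoC (INR (S n))). intros. field; auto.
    + generalize (RtoC (INR (S n))). intros. field; auto.
Qed.

Lemma cexp_Kf (z : C) : inH z -> cexp (Kf z) = (-1)%C.
Proof.
  intros Hz. exact (clim_unique _ _ _ (clim_cexp _ _ (edge_lim z Hz)) (cexp_edge_lim z Hz)).
Qed.

Lemma cder_S (z : C) : z <> 0%C -> cder (fun x => - / x)%C z (/ (z * z))%C.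
Proof.
  intros H. apply cder_ext with (fun x => -1 * / x)%C; [intros; ring|].
  replace (/ (z * z))%C with (-1 * - / (z * z))%C by ring.
  apply cder_scal, cder_inv_id, H.
Qed.

Lemma Eis_der (z : C) : inH z -> exists l, cder Eis z l.
Proof.
  intros Hz. destruct (QS_der _ _ QS_Sig) as [G [_ D]]. eexists.
  apply cder_ext with (fun x => PI * PI / 3 + - (8 * (PI * PI)) * Sig x)%C.
  { intros; unfold Eis; ring. }
  apply (cder_plus (fun _ => (PI * PI / 3)%C)); [apply cder_const | apply cder_scal, D, Hz].
Qed.

Lemma Kf_der (z : C) : inH z -> exists l, cder Kf z l.
Proof.
  intros Hz. pose proof (inH_neq_0 z Hz) as N.
  destruct (Eis_der z Hz) as [l1 D1]. destruct (Eis_der _ (inH_S z Hz)) as [l2 D2].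
  pose proof (cder_comp Eis (fun x => - / x)%C z _ _ D2 (cder_S z N)) as D3.
  pose proof (cder_inv (fun x => x * x)%C _ _ (Cmult_neq_0 _ _ N N) (cder_mult _ _ _ _ _ (cder_id z) (cder_id z))) as D4.
  pose proof (cder_mult _ _ _ _ _ D3 D4) as D5.
  pose proof (cder_plus _ _ _ _ _ D1 (cder_scal (-1) _ _ _ D5)) as D6.
  pose proof (cder_mult _ _ _ _ _ (cder_scal (/ 2) _ _ _ (cder_id z)) D6) as D7.
  eexists. eapply cder_ext; [|exact D7]. intros x. unfold Kf, Cdiv. ring.
Qed.

(** Differentiating [exp (Kf) = -1] gives [Kf' = 0], which replaces a continuity argument on the
    branches of the logarithm. *)
Lemma Kf_const (z : C) : inH z -> Kf z = Kf Ci.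
Proof.
  intros Hz. assert (Hi : inH Ci) by (unfold inH; simpl; lra).
  apply (cder_zero_const Kf); auto. intros x Hx. destruct (Kf_der x Hx) as [l D].
  pose proof (cder_comp cexp Kf x _ _ (cder_cexp _) D) as E.
  assert (E0 : cder (fun x => cexp (Kf x)) x 0).
  { apply (cder_ext_H (fun _ => (-1)%C)); [exact Hx | | apply cder_const].
    intros y Hy. symmetry. apply cexp_Kf, Hy. }
  pose proof (cder_unique _ _ _ _ E E0) as Q.
  replace (RtoC 0) with l; [exact D|].
  replace l with (cexp (Kf x) * l / cexp (Kf x))%C by (field; apply cexp_neq_0).
  rewrite Q. field. apply cexp_neq_0.
Qed.

(* At [z = i] the imaginary parts of the partial sums lie in [1, 4], which pins down the
   logarithm [pi i] of [-1]. *)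
Lemma Kf_Ci : Kf Ci = (PI * Ci)%C.
Proof.
  assert (Hi : inH Ci) by (unfold inH; simpl; lra).
  pose proof (edge_lim Ci Hi) as L.
  assert (B : forall N, 1 <= Im (edge Ci N) <= 4).
  { intros N. set (M := INR (S N)). assert (HM : 1 <= M) by (apply (le_INR 1); lia).
    assert (E : edge Ci N = zsum (fun m => RtoC (2 * M / (M * M + IZR m * IZR m)) * Ci)%C N).
    { unfold edge. fold M. rewrite <- zsum_minus. apply zsum_ext. intros m _.
      assert (D : M * M + IZR m * IZR m <> 0) by nra.
      apply Ceq; unfold Re, Im; simpl; field; nra. }
    rewrite E.
    assert (Q : forall K, (K <= N)%nat ->
      (2 * INR K + 1) / M <= Im (zsum (fun m => RtoC (2 * M / (M * M + IZR m * IZR m)) * Ci)%C K)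
        <= 2 * ((2 * INR K + 1) / M)).
    (* Because [|m| <= N < M], each summand lies between [1/M] and [2/M]; their number [2 N + 1]
       lies between [M] and [2 M]. *)
    { assert (T : forall m, (Z.abs m <= Z.of_nat N)%Z ->
        / M <= 2 * M / (M * M + IZR m * IZR m) <= 2 * / M).
      { intros m Hm. assert (Hs : IZR m * IZR m <= M * M).
        { apply Rsqr_le_abs_1. rewrite (Rabs_pos_eq M) by lra. rewrite <- abs_IZR.
          unfold M. rewrite INR_IZR_INZ. apply IZR_le. lia. }
        assert (0 <= IZR m * IZR m) by nra.
        assert (D : 0 < M * M + IZR m * IZR m) by nra. split.
        - apply Rmult_le_reg_r with (M * (M * M + IZR m * IZR m)); [nra|].
          replace (/ M * (M * (M * M + IZR m * IZR m))) with (M * M + IZR m * IZR m) by (field; lra).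
          replace (2 * M / (M * M + IZR m * IZR m) * (M * (M * M + IZR m * IZR m)))
            with (2 * (M * M)) by (field; lra). lra.
        - apply Rmult_le_reg_r with (M * (M * M + IZR m * IZR m)); [nra|].
          replace (2 * / M * (M * (M * M + IZR m * IZR m))) with (2 * (M * M + IZR m * IZR m)) by (field; lra).
          replace (2 * M / (M * M + IZR m * IZR m) * (M * (M * M + IZR m * IZR m)))
            with (2 * (M * M)) by (field; lra). lra. }
      assert (Ti : forall x, Im (RtoC x * Ci) = x) by (intros; unfold Im; simpl; ring).
      induction K as [|K IH]; intros HK.
      - cbn [zsum]. rewrite Ti. pose proof (T 0%Z ltac:(lia)). simpl INR. unfold Rdiv in *. lra.
      - cbn [zsum]. rewrite !im_plus, !Ti. specialize (IH ltac:(lia)).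
        pose proof (T (Z.of_nat (S K)) ltac:(lia)). pose proof (T (- Z.of_nat (S K))%Z ltac:(lia)).
        rewrite (S_INR K).
        replace ((2 * (INR K + 1) + 1) / M) with ((2 * INR K + 1) / M + 2 * / M) by (field; lra).
        lra. }
    specialize (Q N (le_n _)).
    assert (EM : M = INR N + 1) by (unfold M; apply S_INR). pose proof (pos_INR N).
    assert (Y : 1 <= (2 * INR N + 1) / M <= 2).
    { split; apply Rmult_le_reg_r with M; try lra;
      replace ((2 * INR N + 1) / M * M) with (2 * INR N + 1) by (field; lra); lra. }
    lra. }
  assert (BK : 1 <= Im (Kf Ci) <= 4).
  { split; apply Rnot_lt_le; intros Hlt.
    - destruct (L (1 - Im (Kf Ci))) as [N HN]; [lra|]. specialize (HN N (le_n _)). specialize (B N).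
      pose proof (im_le_Cmod (edge Ci N - Kf Ci)) as T. unfold Cminus in T at 1.
      rewrite im_plus, im_opp in T. apply Rabs_le_between in T. lra.
    - destruct (L (Im (Kf Ci) - 4)) as [N HN]; [lra|]. specialize (HN N (le_n _)). specialize (B N).
      pose proof (im_le_Cmod (edge Ci N - Kf Ci)) as T. unfold Cminus in T at 1.
      rewrite im_plus, im_opp in T. apply Rabs_le_between in T. lra. }
  pose proof (cexp_Kf Ci Hi) as E. clear L B. generalize dependent (Kf Ci). intros k BK E.
  assert (R0 : Re (k) = 0).
  { apply (f_equal Cmod) in E. rewrite Cmod_cexp, Cmod_R, Rabs_left in E by lra.
    apply (f_equal ln) in E. rewrite ln_exp in E. replace (- -1) with 1 in E by ring.
    rewrite ln_1 in E. exact E. }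
  rewrite cexp_pair, R0, exp_0 in E. pose proof (f_equal snd E) as E2. simpl in E2.
  pose proof (f_equal fst E) as E1. simpl in E1. rewrite Rmult_1_l in E1, E2.
  pose proof PI2_3_2 as P3.
  (* The bounds 1 and 4 exclude the zeros 0 and [2 pi > 6] of the sine. *)
  destruct (sin_eq_O_2PI_0 (Im (k))) as [Z|[Z|Z]]; try lra.
  apply Ceq; [rewrite R0 | rewrite Z]; unfold Re, Im; simpl; ring.
Qed.

Lemma Eis_inversion (z : C) : inH z ->
  (Eis (- / z) / (z * z))%C = (Eis z - 2 * PI * Ci / z)%C.
Proof.
  intros Hz. pose proof (inH_neq_0 z Hz) as N.
  pose proof (Kf_const z Hz) as E. rewrite Kf_Ci in E. unfold Kf in E.
  replace (Eis (- / z) / (z * z))%C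
    with (Eis z - 2 / z * (z / 2 * (Eis z - Eis (- / z) / (z * z))))%C by (field; auto).
  rewrite E. generalize (RtoC PI). intros; field; auto.
Qed.

(** * The inversion formula of the eta function *)

(** A logarithm of [eta^2], through which the inversion law of [Eis] integrates to that of
    [eta^2]. *)
Definition Yf (z : C) : C := (th / 4 * z - 2 * Lam z)%C.

Lemma eta_sq (z : C) : inH z -> (eta z * eta z)%C = cexp (Yf z).
Proof.
  intros Hz. rewrite eta_Lam by auto. unfold qpow, Yf. rewrite <- !cexp_add. f_equal.
  unfold th. replace (RtoC (2 * PI * (1 / 24)))%C with (PI / 12)%C.
  - field.
  - rewrite <- RtoC_div by lra. f_equal. field.
Qed.

Lemma cder_Yf (z : C) : inH z -> cder Yf z (Ci / (2 * PI) * Eis z)%C.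
Proof.
  intros Hz. apply cder_ext with (fun x => th / 4 * x + (-2) * Lam x)%C.
  { intros; unfold Yf; ring. }
  replace (Ci / (2 * PI) * Eis z)%C with (th / 4 * 1 + (-2) * (3 * th * Sig z))%C.
  - apply cder_plus; apply cder_scal; [apply cder_id | apply cder_Lam, Hz].
  - unfold Eis, th. assert (P : RtoC PI <> 0%C).
    { intros E. apply RtoC_inj in E. pose proof PI_RGT_0. lra. }
    generalize dependent (RtoC PI). intros. field. auto.
Qed.

(** By [Eis_inversion] the quotient [eta^2(-1/z) / (z eta^2(z))] has derivative 0; at the fixed
    point [z = i] its value is [1 / i]. *)
Lemma eta_sq_inversion (z : C) : inH z ->
  (eta (- / z) * eta (- / z))%C = (- Ci * z * (eta z * eta z))%C.
Proof.
  intros Hz. rewrite !eta_sq by auto using inH_S.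
  assert (P : RtoC PI <> 0%C).
  { intros E. apply RtoC_inj in E. pose proof PI_RGT_0. lra. }
  set (V := fun x => (cexp (Yf (- / x)) * cexp (-1 * Yf x) * / x)%C).
  assert (DV : forall x, inH x -> cder V x 0).
  { intros x Hx. pose proof (inH_neq_0 x Hx) as N.
    pose proof (cder_comp Yf (fun x => - / x)%C x _ _ (cder_Yf _ (inH_S x Hx)) (cder_S x N)) as D1.
    pose proof (cder_comp cexp _ x _ _ (cder_cexp _) D1) as D2.
    pose proof (cder_comp cexp _ x _ _ (cder_cexp _) (cder_scal (-1) _ _ _ (cder_Yf x Hx))) as D3.
    pose proof (cder_mult _ _ _ _ _ (cder_mult _ _ _ _ _ D2 D3) (cder_inv_id x N)) as D.
    cbv beta in D. unfold V.
    match type of D with cder _ _ ?y => replace (RtoC 0) with y; [exact D|] end.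
    pose proof (Eis_inversion x Hx) as E.
    replace (Eis (- / x)) with (Eis (- / x) / (x * x) * (x * x))%C by (field; auto).
    rewrite E. clear - P N.
    replace (Ci / (2 * PI) * ((Eis x - 2 * PI * Ci / x) * (x * x)) * / (x * x))%C
      with (Ci / (2 * PI) * Eis x - Ci * Ci / x)%C
      by (generalize dependent (RtoC PI); intros; field; auto).
    replace (Ci * Ci)%C with (RtoC (-1)) by (apply Ceq; simpl; ring).
    generalize dependent (RtoC PI); intros; field; auto. }
  assert (Hi : inH Ci) by (unfold inH; simpl; lra).
  pose proof (cder_zero_const V DV z Ci Hz Hi) as E. unfold V in E.
  assert (Ei : (- / Ci)%C = Ci) by (apply Ceq; unfold Re, Im; simpl; field).
  rewrite Ei, <- !cexp_add in E.
  replace (Yf Ci + -1 * Yf Ci)%C with (RtoC 0) in E by ring. rewrite cexp_0 in E.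
  pose proof (inH_neq_0 z Hz) as N.
  replace (Yf (- / z)) with ((Yf (- / z) + -1 * Yf z) + Yf z)%C by ring.
  rewrite cexp_add.
  replace (cexp (Yf (- / z) + -1 * Yf z)) with (cexp (Yf (- / z) + -1 * Yf z) * / z * z)%C
    by (field; auto).
  rewrite E. replace (/ Ci)%C with (- Ci)%C by (apply Ceq; unfold Re, Im; simpl; field). ring.
Qed.

(** * Forms with prescribed leading term *)

Definition fr (z : C) : C := (- / (3 * z))%C.

Lemma three_neq_0 : RtoC 3 <> 0%C.
Proof. intros E. apply RtoC_inj in E. lra. Qed.

Lemma inH_fr (z : C) : inH z -> inH (fr z).
Proof. intros H. apply inH_S, inH_3, H. Qed.

Lemma three_fr (z : C) : z <> 0%C -> (3 * fr z)%C = (- / z)%C.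
Proof. intros H. unfold fr. field. auto using three_neq_0. Qed.

Lemma cder_fr (z : C) : z <> 0%C -> cder fr z (/ (3 * (z * z)))%C.
Proof.
  intros H. pose proof three_neq_0 as N3.
  pose proof (cder_comp (fun x => - / x)%C (fun x => 3 * x)%C z _ _
    (cder_S _ (Cmult_neq_0 _ _ N3 H)) (cder_scal 3 _ _ _ (cder_id z))) as D.
  cbv beta in D. replace (/ (3 * (z * z)))%C with (/ (3 * z * (3 * z)) * (3 * 1))%C
    by (field; auto). exact D.
Qed.

(** Since [fr z = -1/(3z)] and [3 fr z = -1/z], the involution interchanges [eta^2(z)] and
    [eta^2(3z)] up to linear factors. *)
Lemma cexp_Yf_fr (z : C) : inH z ->
  cexp (Yf (fr z)) = (- Ci * (3 * z) * cexp (Yf (3 * z)))%C /\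
  cexp (Yf (3 * fr z)) = (- Ci * z * cexp (Yf z))%C.
Proof.
  intros Hz. pose proof (inH_neq_0 z Hz) as N. split.
  - rewrite <- !eta_sq by auto using inH_fr, inH_3. apply eta_sq_inversion, inH_3, Hz.
  - rewrite three_fr by auto. rewrite <- !eta_sq by auto using inH_S.
    apply eta_sq_inversion, Hz.
Qed.

Lemma CiCi : (Ci * Ci)%C = (-1)%C.
Proof. apply Ceq; simpl; ring. Qed.

Lemma h3_Yf (z : C) : inH z -> h3 z = (cexp (Yf z) * cexp (Yf (3 * z)))%C.
Proof.
  intros Hz. unfold h3. rewrite <- !eta_sq by auto using inH_3. ring.
Qed.

Lemma h3_fr (z : C) : inH z -> h3 (fr z) = (-1 * (3 * z * z) * h3 z)%C.
Proof.
  intros Hz. rewrite !h3_Yf by auto using inH_fr.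
  destruct (cexp_Yf_fr z Hz) as [-> ->].
  replace (- Ci * (3 * z) * cexp (Yf (3 * z)) * (- Ci * z * cexp (Yf z)))%C
    with ((Ci * Ci) * (3 * z * z) * (cexp (Yf z) * cexp (Yf (3 * z))))%C by ring.
  rewrite CiCi. ring.
Qed.

(** Its exponential [eprod al be] is the product of [(1 - q^n)^(-al) (1 - q^(3n))^(-be)]; hence the
    signs of the exponents in the eta quotients. *)
Definition Lcomb (al be : R) (z : C) : C := (al * Lam z + be * Lam (3 * z))%C.
Definition lcoef (al be : R) (n : nat) : C :=
  (al * dilate 3 (lambert log_coef) n + be * dilate 3 (dilate 3 (lambert log_coef)) n)%C.

Lemma QS_Lam3 : QS (dilate 3 (dilate 3 (lambert log_coef))) (fun z => Lam (3 * z)).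
Proof.
  eapply QS_ext; [reflexivity| |apply (QS_dilate 3 _ _ ltac:(lia) QS_Lam)].
  intros z Hz. cbv beta. rewrite INR_3. reflexivity.
Qed.

Lemma QS_Lcomb (al be : R) : QS (lcoef al be) (Lcomb al be).
Proof. exact (QS_plus _ _ _ _ (QS_scal al _ _ QS_Lam) (QS_scal be _ _ QS_Lam3)). Qed.

Lemma supp_dilate_3 (a : nat -> C) : supp 0 (dilate 3 a).
Proof.
  intros n Hn. unfold dilate. destruct (Nat.eqb_spec (n mod 3) 0); [|reflexivity].
  contradiction.
Qed.

Lemma supp_lin (r : nat) (x y : C) (a b : nat -> C) :
  supp r a -> supp r b -> supp r (fun n => x * a n + y * b n)%C.
Proof. intros Ha Hb n Hn. rewrite Ha, Hb by auto. ring. Qed.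

Lemma supp_lcoef (al be : R) : supp 0 (lcoef al be).
Proof. apply supp_lin; apply supp_dilate_3. Qed.

Lemma lcoef_0 (al be : R) : lcoef al be 0 = 0%C.
Proof. unfold lcoef, dilate, lambert, lambert_part. simpl. ring. Qed.

Definition eprod (al be : R) (z : C) : C := cexp (Lcomb al be z).
Definition ecoef (al be : R) : nat -> C := exp_coef (lcoef al be).

Lemma QS_eprod (al be : R) : QS (ecoef al be) (eprod al be).
Proof. apply QS_exp; [apply QS_Lcomb | apply lcoef_0]. Qed.

Lemma supp_ecoef (al be : R) : supp 0 (ecoef al be).
Proof. apply supp_exp_coef, supp_lcoef. Qed.

Lemma ecoef_0 (al be : R) : ecoef al be 0 = 1%C.
Proof. reflexivity. Qed.

Lemma h3_eprod (z : C) : inH z -> h3 z = (W z * eprod (-2) (-2) z)%C.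
Proof.
  intros Hz. rewrite h3_Yf by auto. unfold eprod. rewrite W_cexp, <- !cexp_add. f_equal.
  unfold Yf, Lcomb. field.
Qed.

Lemma h3_neq_0 (z : C) : inH z -> h3 z <> 0%C.
Proof. intros Hz. rewrite h3_Yf by auto. apply Cmult_neq_0; apply cexp_neq_0. Qed.

(** The Hauptmodul [(eta(z) / eta(3z))^12 = q^(-1) - 12 + ...] of [Gamma_0(3)]. *)
Definition tf (z : C) : C := (cexp (Yf z) ^ 6 / cexp (Yf (3 * z)) ^ 6)%C.

Lemma tf_neq_0 (z : C) : tf z <> 0%C.
Proof.
  unfold tf. pose proof (Cpow_nz _ 6 (cexp_neq_0 (Yf z))) as A.
  pose proof (Cpow_nz _ 6 (cexp_neq_0 (Yf (3 * z)))) as B.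
  intros E. apply A.
  replace (cexp (Yf z) ^ 6)%C with (cexp (Yf z) ^ 6 / cexp (Yf (3 * z)) ^ 6 * cexp (Yf (3 * z)) ^ 6)%C
    by (field; apply cexp_neq_0).
  rewrite E. ring.
Qed.

(** The factors [-3 i z] and [-i z] of [cexp_Yf_fr] have ratio 3, and [729 = 3^6]. *)
Lemma tf_fr (z : C) : inH z -> (tf (fr z) * tf z)%C = 729%C.
Proof.
  intros Hz. pose proof (inH_neq_0 z Hz) as N. unfold tf.
  destruct (cexp_Yf_fr z Hz) as [-> ->].
  pose proof (cexp_neq_0 (Yf z)). pose proof (cexp_neq_0 (Yf (3 * z))). pose proof Ci_nz.
  field. auto.
Qed.

Lemma tf_cexp (z : C) : tf z = cexp (-3 * th * z + Lcomb (-12) 12 z).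
Proof.
  unfold tf, Cdiv. rewrite !cexp_pow, <- cexp_opp, <- cexp_add. f_equal.
  unfold Yf, Lcomb. replace (RtoC (INR 6)) with (RtoC 6) by (f_equal; simpl; ring). field.
Qed.

Lemma W_cube_cexp (z : C) : (W z ^ 3)%C = cexp (3 * th * z).
Proof. rewrite W_cexp, cexp_pow, INR_3. f_equal. ring. Qed.

Lemma tf_eprod (z : C) : (W z ^ 3 * tf z)%C = eprod (-12) 12 z.
Proof. rewrite tf_cexp, W_cube_cexp, <- cexp_add. unfold eprod. f_equal. ring. Qed.

Lemma tf_inv_eprod (z : C) : (/ tf z)%C = (W z ^ 3 * eprod 12 (-12) z)%C.
Proof.
  rewrite tf_cexp, W_cube_cexp, <- cexp_opp. unfold eprod. rewrite <- cexp_add. f_equal.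
  unfold Lcomb. ring.
Qed.

(** The weight 2 Eisenstein series [(3 E_2(3z) - E_2(z)) / 2] of [Gamma_0(3)]. *)
Definition Af (z : C) : C := (1 + (12 * Sig z + -36 * Sig (3 * z)))%C.
Definition acoef (n : nat) : C :=
  ((if (n =? 0)%nat then 1%C else 0%C) + (12 * dilate 3 (lambert id_coef) n
    + -36 * dilate 3 (dilate 3 (lambert id_coef)) n))%C.

Lemma QS_Af : QS acoef Af.
Proof.
  refine (QS_plus _ _ _ _ (QS_const 1) (QS_plus _ _ _ _ (QS_scal 12 _ _ QS_Sig) (QS_scal (-36) _ _ _))).
  eapply QS_ext; [reflexivity| |apply (QS_dilate 3 _ _ ltac:(lia) QS_Sig)].
  intros z Hz. cbv beta. rewrite INR_3. reflexivity.
Qed.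

Lemma supp_acoef : supp 0 acoef.
Proof.
  intros n Hn. unfold acoef. rewrite !supp_dilate_3 by auto.
  destruct (Nat.eqb_spec n 0) as [->|E]; [exfalso; apply Hn; reflexivity | ring].
Qed.

Lemma acoef_0 : acoef 0 = 1%C.
Proof. unfold acoef, dilate, lambert, lambert_part. simpl. ring. Qed.

Lemma cder_tf (z : C) : inH z -> cder tf z (tf z * (-3 * th * Af z))%C.
Proof.
  intros Hz. apply cder_ext with (fun x => cexp (-3 * th * x + Lcomb (-12) 12 x)).
  { intros; symmetry; apply tf_cexp. }
  rewrite tf_cexp. apply (cder_comp cexp); [apply cder_cexp|].
  replace (-3 * th * Af z)%C
    with (-3 * th * 1 + (-12 * (3 * th * Sig z) + 12 * (3 * th * Sig (3 * z) * 3)))%C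
    by (unfold Af; ring).
  apply cder_plus; [apply cder_scal, cder_id|].
  unfold Lcomb. apply cder_plus; apply cder_scal; [apply cder_Lam, Hz|].
  apply (cder_comp Lam (fun x => 3 * x)%C); [apply cder_Lam, inH_3, Hz|].
  pose proof (cder_scal 3 _ _ _ (cder_id z)) as P. rewrite Cmult_1_r in P. exact P.
Qed.

Lemma th_neq_0 : th <> 0%C.
Proof. apply Cmod_gt_0. rewrite Cmod_th. pose proof PI_RGT_0. lra. Qed.

(** Differentiating [tf (fr z) * tf z = 729] gives the law directly, so the nonmodular term of [E_2]
    does not appear. *)
Lemma Af_fr (z : C) : inH z -> Af (fr z) = (-1 * (3 * z * z) * Af z)%C.
Proof.
  intros Hz. pose proof (inH_neq_0 z Hz) as N.
  pose proof (cder_mult _ _ _ _ _ (cder_comp tf fr z _ _ (cder_tf _ (inH_fr z Hz)) (cder_fr z N))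
    (cder_tf z Hz)) as D.
  assert (D0 : cder (fun x => tf (fr x) * tf x)%C z 0).
  { apply (cder_ext_H (fun _ => 729%C)); [exact Hz | | apply cder_const].
    intros x Hx. symmetry. apply tf_fr, Hx. }
  pose proof (cder_unique _ _ _ _ D D0) as E. cbv beta in E.
  pose proof (tf_neq_0 z). pose proof (tf_neq_0 (fr z)). pose proof th_neq_0. pose proof three_neq_0.
  set (X := (tf (fr z) * (-3 * th * Af (fr z)) * / (3 * (z * z)) * tf z +
    tf (fr z) * (tf z * (-3 * th * Af z)))%C) in *.
  replace (Af (fr z)) with (X * (3 * (z * z)) / (-3 * th * tf (fr z) * tf z) - (3 * z * z) * Af z)%C.
  - rewrite E. field. repeat split; auto;
    try (intros Q; apply RtoC_inj in Q; lra).
  - unfold X. field. repeat split; auto;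
    try (intros Q; apply RtoC_inj in Q; lra).
Qed.

(** [F] begins with [q^(-d/3)] and has weight 2 with sign [e] under the involution. The condition
    [supp 0 b] makes [F] equal to [q^(-d/3)] times a series in [q], which encodes the multiplier
    under [T]. *)
Definition lead (e : C) (d : nat) (F : C -> C) : Prop :=
  (forall z, inH z -> F (fr z) = (e * (3 * z * z) * F z)%C) /\
  exists b, QS b (fun z => W z ^ d * F z)%C /\ b 0%nat = 1%C /\ supp 0 b.

Lemma conv_0 (a b : nat -> C) : conv a b 0 = (a 0%nat * b 0%nat)%C.
Proof. unfold conv. simpl. ring. Qed.

Lemma supp_shift3 (a : nat -> C) (k : nat) : (k mod 3 = 0)%nat -> supp 0 a ->
  supp 0 (fun n => if (n <? k)%nat then 0%C else a (n - k)%nat).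
Proof.
  intros Hk H n Hn. destruct (Nat.ltb_spec n k); [reflexivity|]. apply H. intros E. apply Hn.
  replace n with ((n - k) + k)%nat by lia. rewrite Nat.Div0.add_mod, E, Hk. reflexivity.
Qed.

Definition jf (s : C) (z : C) : C := (tf z + s * (729 / tf z))%C.

Lemma jf_fr (s : C) (z : C) : (s * s = 1)%C -> inH z -> jf s (fr z) = (s * jf s z)%C.
Proof.
  intros Hs Hz. pose proof (tf_fr z Hz) as E. pose proof (tf_neq_0 z) as N.
  pose proof (tf_neq_0 (fr z)) as N'. unfold jf.
  replace (tf (fr z)) with (729 / tf z)%C.
  2:{ rewrite <- E. field. auto. }
  assert (N729 : RtoC 729 <> 0%C) by (intros Q; apply RtoC_inj in Q; lra).
  replace (s * (tf z + s * (729 / tf z)))%C with (s * tf z + (s * s) * (729 / tf z))%C by ring.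
  rewrite Hs. field. auto.
Qed.

Lemma QS_jf (s : C) : exists b,
  QS b (fun z => W z ^ 3 * jf s z)%C /\ b 0%nat = 1%C /\ supp 0 b.
Proof.
  pose proof (QS_plus _ _ _ _ (QS_eprod (-12) 12)
    (QS_scal (s * 729) _ _ (QS_mul_Wn 6 _ _ (QS_eprod 12 (-12))))) as P.
  eexists. split; [|split].
  - eapply QS_ext; [reflexivity| |exact P]. intros z Hz. cbv beta.
    rewrite <- tf_eprod. unfold jf, Cdiv. rewrite tf_inv_eprod. ring.
  - cbv beta. simpl. rewrite ecoef_0. ring.
  - intros n Hn. cbv beta. rewrite supp_ecoef by auto.
    rewrite (supp_shift3 _ 6 eq_refl (supp_ecoef 12 (-12))) by auto. ring.
Qed.

Lemma lead_mul_jf (e : C) (d : nat) (F : C -> C) : lead e d F ->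
  lead e (d + 3) (fun z => jf 1 z * F z)%C.
Proof.
  intros [L [b [Q [b0 S]]]]. destruct (QS_jf 1) as [c [Qc [c0 Sc]]]. split.
  - intros z Hz. rewrite L, jf_fr by (auto; ring). ring.
  - exists (conv c b). split; [|split].
    + eapply QS_ext; [reflexivity| |apply (QS_mult _ _ _ _ Qc Q)].
      intros z Hz. cbv beta. rewrite Cpow_add_r. ring.
    + rewrite conv_0, c0, b0. ring.
    + exact (supp_conv 0 0 _ _ Sc S).
Qed.

Lemma lead_h3_jf (s : C) : (s * s = 1)%C -> lead (- s) 2 (fun z => h3 z * jf s z)%C.
Proof.
  intros Hs. destruct (QS_jf s) as [c [Qc [c0 Sc]]]. split.
  - intros z Hz. rewrite h3_fr, jf_fr by auto. ring.
  - exists (conv (ecoef (-2) (-2)) c). split; [|split].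
    + eapply QS_ext; [reflexivity| |apply (QS_mult _ _ _ _ (QS_eprod (-2) (-2)) Qc)].
      intros z Hz. cbv beta. rewrite h3_eprod by auto. ring.
    + rewrite conv_0, c0, ecoef_0. ring.
    + exact (supp_conv 0 0 _ _ (supp_ecoef _ _) Sc).
Qed.

Lemma eprod_inv (z : C) : (/ eprod (-2) (-2) z)%C = eprod 2 2 z.
Proof. unfold eprod. rewrite <- cexp_opp. f_equal. unfold Lcomb. ring. Qed.

Lemma h3_inv (z : C) : inH z -> (/ h3 z)%C = (eprod 2 2 z / W z)%C.
Proof.
  intros Hz. rewrite h3_eprod by auto. rewrite <- eprod_inv. field.
  split; [apply cexp_neq_0 | apply W_neq_0].
Qed.

Lemma lead_minus : lead (-1) 1 (fun z => Af z * Af z / h3 z)%C.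
Proof.
  split.
  - intros z Hz. rewrite h3_fr, Af_fr by auto. pose proof (inH_neq_0 z Hz).
    pose proof (h3_neq_0 z Hz). field. repeat split; auto using three_neq_0;
    try (intros Q; apply RtoC_inj in Q; lra).
  - exists (conv (conv acoef acoef) (ecoef 2 2)). split; [|split].
    + eapply QS_ext; [reflexivity| |
        apply (QS_mult _ _ _ _ (QS_mult _ _ _ _ QS_Af QS_Af) (QS_eprod 2 2))].
      intros z Hz. cbv beta. unfold Cdiv. rewrite h3_inv by auto. field. apply W_neq_0.
    + rewrite !conv_0, acoef_0, ecoef_0. ring.
    + exact (supp_conv 0 0 _ _ (supp_conv 0 0 _ _ supp_acoef supp_acoef) (supp_ecoef _ _)).
Qed.

(* The derivative of the weight 0 form [Af / h3] has weight 2 and the same multiplier. *)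
Lemma lead_plus : exists F, lead 1 1 F.
Proof.
  pose proof (QS_mult _ _ _ _ QS_Af (QS_eprod 2 2)) as QP.
  set (c := conv acoef (ecoef 2 2)) in *.
  assert (c0 : c 0%nat = 1%C) by (unfold c; rewrite conv_0, acoef_0, ecoef_0; ring).
  assert (Sc : supp 0 c) by exact (supp_conv 0 0 _ _ supp_acoef (supp_ecoef _ _)).
  destruct (QS_der _ _ QP) as [G [QG D]].
  set (P := fun z => (Af z * eprod 2 2 z)%C) in *.
  set (u := fun z => (Af z / h3 z)%C).
  assert (Eu : forall z, inH z -> u z = (P z * / W z)%C).
  { intros z Hz. unfold u, P, Cdiv. rewrite h3_inv by auto. unfold Cdiv. ring. }
  assert (Du : forall z, inH z -> cder u z (- th * ((P z - G z) / W z))%C).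
  { intros z Hz. apply (cder_ext_H (fun x => P x * / W x)%C); [exact Hz | |].
    { intros x Hx. symmetry. apply Eu, Hx. }
    pose proof (cder_mult _ _ _ _ _ (D z Hz) (cder_inv _ _ _ (W_neq_0 z) (cder_W z))) as DD.
    cbv beta in DD. replace (- th * ((P z - G z) / W z))%C with
      (th * G z * / W z + P z * (- (th * W z) / (W z * W z)))%C by (field; apply W_neq_0).
    exact DD. }
  exists (fun z => (P z - G z) / W z)%C. split.
  - intros z Hz. pose proof (inH_neq_0 z Hz) as N.
    pose proof (cder_comp u fr z _ _ (Du _ (inH_fr z Hz)) (cder_fr z N)) as D1.
    (* [Af / h3] is invariant under the involution, so the chain rule gives a second expression for
       its derivative. *)
    assert (D2 : cder u z (- th * ((P (fr z) - G (fr z)) / W (fr z)) * / (3 * (z * z)))%C).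
    { refine (cder_ext_H _ _ _ _ Hz _ D1). intros x Hx. unfold u.
      pose proof (inH_neq_0 x Hx). pose proof (h3_neq_0 x Hx).
      rewrite Af_fr, h3_fr by auto. field. repeat split; auto using three_neq_0;
    try (intros Q; apply RtoC_inj in Q; lra). }
    pose proof (cder_unique _ _ _ _ (Du z Hz) D2) as E.
    pose proof th_neq_0 as Nt. pose proof three_neq_0 as N3.
    set (X := ((P z - G z) / W z)%C) in *. set (Y := ((P (fr z) - G (fr z)) / W (fr z))%C) in *.
    replace Y with (- th * Y * / (3 * (z * z)) * (3 * (z * z)) / (- th))%C by (field; auto).
    rewrite <- E. field. auto.
  - eexists. split; [|split].
    + eapply QS_ext; [reflexivity| |apply (QS_minus _ _ _ _ QP QG)].
      intros z Hz. cbv beta. fold (P z). field. apply W_neq_0.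
    + cbv beta. rewrite c0. simpl. ring.
    + intros n Hn. cbv beta. rewrite Sc by auto. ring.
Qed.

Definition sgn (s : bool) : C := if s then 1%C else (-1)%C.

Lemma lead_exists (s : bool) (d : nat) : (d mod 3 <> 0)%nat -> exists F, lead (sgn s) d F.
Proof.
  intros Hd. pose proof (Nat.div_mod_eq d 3) as E.
  pose proof (Nat.mod_upper_bound d 3 ltac:(lia)) as U.
  assert (Base : exists F, lead (sgn s) (d mod 3) F).
  { assert (d mod 3 = 1 \/ d mod 3 = 2)%nat as [->| ->] by lia; destruct s; simpl.
    - apply lead_plus.
    - eexists; apply lead_minus.
    (* As [h3] contributes the sign -1, the plus form takes [jf (-1)] and the minus form takes
       [jf 1]. *)
    - exists (fun z => h3 z * jf (-1) z)%C. pose proof (lead_h3_jf (-1) ltac:(ring)) as P.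
      replace (- -1)%C with (RtoC 1) in P by ring. exact P.
    - exists (fun z => h3 z * jf 1 z)%C. pose proof (lead_h3_jf 1 ltac:(ring)) as P.
      replace (- (1))%C with (RtoC (-1)) in P by ring. exact P. }
  rewrite E. clear E. induction (d / 3)%nat as [|k [F IH]].
  - rewrite Nat.mul_0_r. exact Base.
  - exists (fun z => jf 1 z * F z)%C. replace (3 * S k + d mod 3)%nat with (3 * k + d mod 3 + 3)%nat by lia.
    apply lead_mul_jf, IH.
Qed.

(** * The transformation law under [Gamma_0(3)] *)

Lemma zeta3pow_add (j k : Z) : zeta3pow (j + k) = (zeta3pow j * zeta3pow k)%C.
Proof.
  unfold zeta3pow. rewrite <- cexp_add. f_equal. rewrite plus_IZR.
  replace (2 * PI * (IZR j + IZR k) / 3) with (2 * PI * IZR j / 3 + 2 * PI * IZR k / 3) by field.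
  rewrite RtoC_plus. Cring.
Qed.

Lemma zeta3pow_0 : zeta3pow 0 = 1%C.
Proof.
  unfold zeta3pow. replace (2 * PI * 0 / 3) with 0 by field. rewrite Cmult_0_l. apply cexp_0.
Qed.

Lemma zeta3pow_1 : zeta3pow 1 = zeta.
Proof.
  unfold zeta3pow, zeta, th. f_equal. f_equal.
  rewrite <- RtoC_mult, <- RtoC_div by lra. f_equal. field.
Qed.

Lemma zeta3pow_nat (n : nat) : zeta3pow (Z.of_nat n) = (zeta ^ n)%C.
Proof.
  induction n as [|n IH]; [apply zeta3pow_0|].
  rewrite Nat2Z.inj_succ, <- Z.add_1_r, zeta3pow_add, IH, zeta3pow_1. simpl. ring.
Qed.

Lemma zeta3pow_triple (k : Z) : zeta3pow (3 * k) = 1%C.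
Proof.
  assert (P : forall n : nat, zeta3pow (3 * Z.of_nat n) = 1%C).
  { intros n. replace (3 * Z.of_nat n)%Z with (Z.of_nat (3 * n)) by lia.
    rewrite zeta3pow_nat, Cpow_mult_r, zeta_cube. apply Cpow_1_l. }
  destruct (Z_le_dec 0 k) as [H|H].
  - rewrite <- (Z2Nat.id k H). apply P.
  - specialize (P (Z.to_nat (- k))). rewrite Z2Nat.id in P by lia.
    pose proof (zeta3pow_add (3 * k) (3 * - k)) as E. replace (3 * k + 3 * - k)%Z with 0%Z in E by lia.
    rewrite zeta3pow_0, P, Cmult_1_r in E. auto.
Qed.

Lemma zeta3pow_cong (j k m : Z) : (j - k = 3 * m)%Z -> zeta3pow j = zeta3pow k.
Proof.
  intros H. replace j with (k + 3 * m)%Z by lia. rewrite zeta3pow_add, zeta3pow_triple. ring.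
Qed.

Definition act (a b c d : Z) (z : C) : C := ((IZR a * z + IZR b) / (IZR c * z + IZR d))%C.

Lemma act_denom (c d : Z) (z : C) : inH z -> (c <> 0 \/ d <> 0)%Z ->
  (IZR c * z + IZR d)%C <> 0%C.
Proof.
  intros Hz H E. pose proof (f_equal Im E) as E1. pose proof (f_equal Re E) as E2.
  rewrite im_plus, im_scal_l, !im_RtoC in E1. rewrite re_plus, re_scal_l, !re_RtoC in E2.
  unfold inH in Hz. assert (C0 : IZR c = 0) by nra. rewrite C0 in E2.
  apply eq_IZR in C0. assert (D0 : IZR d = 0) by lra. apply eq_IZR in D0. lia.
Qed.

Lemma det_denom (a b c d : Z) (z : C) : inH z -> (a * d - b * c = 1)%Z ->
  (IZR c * z + IZR d)%C <> 0%C.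
Proof. intros Hz H. apply act_denom; [exact Hz|]. lia. Qed.

Lemma inH_act (a b c d : Z) (z : C) : inH z -> (a * d - b * c = 1)%Z -> inH (act a b c d z).
Proof.
  intros Hz H. pose proof (det_denom a b c d z Hz H) as D.
  pose proof (proj1 (Cmod_gt_0 _) D) as P. unfold act.
  assert (N : 0 < Re (IZR c * z + IZR d) ^ 2 + Im (IZR c * z + IZR d) ^ 2)
    by (rewrite <- Cmod2_alt; apply pow_lt, P).
  clear P. destruct z as [x y]. unfold inH, Re, Im in *. simpl in *.
  assert (E : IZR a * IZR d - IZR b * IZR c = 1) by (rewrite <- !mult_IZR, <- minus_IZR, H; reflexivity).
  set (n := (IZR c * x - 0 * y + IZR d) * ((IZR c * x - 0 * y + IZR d) * 1) +
    (IZR c * y + 0 * x + 0) * ((IZR c * y + 0 * x + 0) * 1)) in *.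
  match goal with |- 0 < ?X => replace X with ((IZR a * IZR d - IZR b * IZR c) * y / n) end.
  - rewrite E. apply Rdiv_lt_0_compat; lra.
  - field. lra.
Qed.

Definition kap (conj : bool) : Z := if conj then (-1)%Z else 1%Z.

Definition nuexp (a b c d : Z) : Z := ((c / 3) * (a + d) + b * d)%Z.

(** The integer [k] is arbitrary: it covers [nu], its conjugate and the multipliers of the Hecke
    images. *)
Definition glaw (k : Z) (F : C -> C) (a b c d : Z) : Prop := forall z, inH z ->
  F (act a b c d z) = (zeta3pow (k * nuexp a b c d) * (IZR c * z + IZR d) ^ 2 * F z)%C.

Definition tlaw (k : Z) (F : C -> C) : Prop :=
  forall z, inH z -> F (z + 1)%C = (zeta3pow k * F z)%C.

Definition wlaw (e : C) (F : C -> C) : Prop :=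
  forall z, inH z -> F (fr z) = (e * (3 * z * z) * F z)%C.

Lemma inH_addZ (z : C) (n : Z) : inH z -> inH (z + IZR n).
Proof. unfold inH. rewrite im_plus, im_RtoC. lra. Qed.

Lemma tlaw_Z (k : Z) (F : C -> C) : tlaw k F ->
  forall n z, inH z -> F (z + IZR n)%C = (zeta3pow (k * n) * F z)%C.
Proof.
  intros H.
  assert (P : forall (n : nat) z, inH z -> F (z + IZR (Z.of_nat n))%C = (zeta3pow (k * Z.of_nat n) * F z)%C).
  { induction n as [|n IH]; intros z Hz.
    - simpl. rewrite Z.mul_0_r, zeta3pow_0. replace (z + 0)%C with z by ring. ring.
    - rewrite Nat2Z.inj_succ. unfold Z.succ. rewrite plus_IZR, RtoC_plus, Cplus_assoc.
      rewrite H by (apply inH_addZ, Hz). rewrite IH by exact Hz.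
      rewrite Z.mul_add_distr_l, Z.mul_1_r, zeta3pow_add. ring. }
  intros n z Hz. destruct (Z_le_dec 0 n) as [Hn|Hn].
  - rewrite <- (Z2Nat.id n Hn). apply P, Hz.
  - set (m := Z.to_nat (- n)). assert (En : n = (- Z.of_nat m)%Z) by lia.
    pose proof (P m (z + IZR n)%C (inH_addZ z n Hz)) as Q.
    replace (z + IZR n + IZR (Z.of_nat m))%C with z in Q.
    2:{ rewrite <- Cplus_assoc, <- RtoC_plus, <- plus_IZR, En. replace (- Z.of_nat m + Z.of_nat m)%Z with 0%Z by lia. ring. }
    rewrite Q, Cmult_assoc, <- zeta3pow_add.
    replace (k * n + k * Z.of_nat m)%Z with 0%Z by (rewrite En; lia). rewrite zeta3pow_0. ring.
Qed.

Lemma lower_unip (n : Z) (z : C) : inH z ->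
  (3 * IZR n * z + 1)%C <> 0%C /\ inH (z / (3 * IZR n * z + 1)).
Proof.
  intros Hz. assert (E : (1 * 1 - 0 * (3 * n) = 1)%Z) by lia. split.
  - pose proof (det_denom 1 0 (3 * n) 1 z Hz E) as D. rewrite mult_IZR, RtoC_mult in D. exact D.
  - pose proof (inH_act 1 0 (3 * n) 1 z Hz E) as D. unfold act in D. rewrite mult_IZR, RtoC_mult in D.
    replace (1 * z + 0)%C with z in D by ring. exact D.
Qed.

(* [U^n = W T^(-n) W^(-1)]. *)
Lemma ulaw (k : Z) (e : C) (F : C -> C) : (e * e = 1)%C -> tlaw k F -> wlaw e F ->
  forall n z, inH z ->
    F (z / (3 * IZR n * z + 1))%C = (zeta3pow (- (k * n)) * (3 * IZR n * z + 1) ^ 2 * F z)%C.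
Proof.
  intros He HT HW n z Hz. pose proof (inH_neq_0 z Hz) as N. pose proof three_neq_0 as N3.
  destruct (lower_unip n z Hz) as [D _].
  set (x := (fr z + IZR (- n))%C).
  assert (Hx : inH x) by (apply inH_addZ, inH_fr, Hz).
  assert (Ex : x = (- (3 * IZR n * z + 1) / (3 * z))%C).
  { unfold x, fr. rewrite opp_IZR, RtoC_opp. generalize (RtoC (IZR n)). intros; field; auto. }
  replace (z / (3 * IZR n * z + 1))%C with (fr x).
  2:{ rewrite Ex. unfold fr. generalize dependent (RtoC (IZR n)). intros.
      field. repeat split; auto. }
  rewrite HW by exact Hx. unfold x at 3. rewrite (tlaw_Z k F HT) by (apply inH_fr, Hz).
  rewrite HW by exact Hz. replace (k * - n)%Z with (- (k * n))%Z by lia.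
  replace (e * (3 * x * x) * (zeta3pow (- (k * n)) * (e * (3 * z * z) * F z)))%C
    with ((e * e) * zeta3pow (- (k * n)) * ((3 * z * x) * (3 * z * x)) * F z)%C by ring.
  rewrite He. replace (3 * z * x)%C with (- (3 * IZR n * z + 1))%C.
  - ring.
  - rewrite Ex. generalize (RtoC (IZR n)). intros; field; auto.
Qed.

Lemma nuexp_3 (a b c d : Z) : nuexp a b (3 * c) d = (c * (a + d) + b * d)%Z.
Proof.
  unfold nuexp. rewrite (Z.mul_comm 3 c), Z.div_mul by lia. reflexivity.
Qed.

(** The law descends from [gamma T^n] to [gamma]; the exponents agree modulo 3 because
    [a d = 1 + 3 b c]. *)
Lemma glaw_of_T (k : Z) (F : C -> C) (a b c d n : Z) : tlaw k F -> (a * d - b * (3 * c) = 1)%Z ->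
  glaw k F a (b + a * n) (3 * c) (d + 3 * c * n) -> glaw k F a b (3 * c) d.
Proof.
  intros HT Hdet H z Hz.
  assert (Hz' : inH (z + IZR (- n))) by (apply inH_addZ, Hz).
  pose proof (H _ Hz') as Q. rewrite (tlaw_Z k F HT) in Q by exact Hz. unfold act in Q |- *.
  rewrite !plus_IZR, !opp_IZR, !mult_IZR, !RtoC_plus, !RtoC_opp, !RtoC_mult in Q.
  rewrite !mult_IZR, !RtoC_mult.
  match type of Q with F ?x = _ => replace x with
    ((IZR a * z + IZR b) / (3 * IZR c * z + IZR d))%C in Q end.
  2:{ f_equal; ring. }
  rewrite Q. rewrite !nuexp_3.
  replace (3 * IZR c * (z + - IZR n) + (IZR d + 3 * IZR c * IZR n))%C
    with (3 * IZR c * z + IZR d)%C by ring.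
  replace (zeta3pow (k * (c * (a + d) + b * d)))
    with (zeta3pow (k * (c * (a + (d + 3 * c * n)) + (b + a * n) * (d + 3 * c * n))) * zeta3pow (k * - n))%C.
  - ring.
  - rewrite <- zeta3pow_add.
    apply zeta3pow_cong with (m := (k * (c * c * n + (b + a * n) * c * n + n * b * c))%Z).
    assert (E : (a * d = 1 + b * (3 * c))%Z) by lia.
    replace (k * (c * (a + (d + 3 * c * n)) + (b + a * n) * (d + 3 * c * n)) + k * - n -
      k * (c * (a + d) + b * d))%Z with
      (k * (3 * c * c * n + (b + a * n) * (3 * c * n) + (a * d) * n - n))%Z by ring.
    rewrite E. ring.
Qed.

(** The law descends from [gamma U^n] to [gamma], where [U = [[1, 0], [3, 1]]]. Modulo 3 the
    exponents differ by [k n (a d + d^2 + 1)], and the determinant forces [a d = d^2 = 1] modulo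
    3. *)
Lemma glaw_of_U (k : Z) (e : C) (F : C -> C) (a b c d n : Z) : (e * e = 1)%C ->
  tlaw k F -> wlaw e F -> (a * d - b * (3 * c) = 1)%Z ->
  glaw k F (a + 3 * n * b) b (3 * (c + n * d)) d -> glaw k F a b (3 * c) d.
Proof.
  intros He HT HW Hdet H z Hz.
  destruct (lower_unip (- n) z Hz) as [D Hy]. set (y := (z / (3 * IZR (- n) * z + 1))%C) in *.
  pose proof (H y Hy) as Q. unfold y in Q at 3. rewrite (ulaw k e F He HT HW) in Q by exact Hz.
  pose proof (det_denom a b (3 * c) d z Hz Hdet) as D2.
  unfold act in Q |- *. rewrite !mult_IZR, !RtoC_mult in D2 |- *.
  rewrite !plus_IZR, !mult_IZR, !plus_IZR, !mult_IZR in Q.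
  rewrite !RtoC_plus, !RtoC_mult, !RtoC_plus, !RtoC_mult in Q.
  rewrite opp_IZR, RtoC_opp in D. unfold y in Q. rewrite opp_IZR, RtoC_opp in Q.
  set (zn := RtoC (IZR n)) in *. set (za := RtoC (IZR a)) in *. set (zb := RtoC (IZR b)) in *.
  set (zc := RtoC (IZR c)) in *. set (zd := RtoC (IZR d)) in *.
  assert (E1 : (3 * (zc + zn * zd) * (z / (3 * - zn * z + 1)) + zd
    = (3 * zc * z + zd) / (3 * - zn * z + 1))%C) by (field; auto).
  rewrite E1 in Q.
  match type of Q with F ?x = _ => replace x with ((za * z + zb) / (3 * zc * z + zd))%C in Q end.
  2:{ field. repeat split; auto. }
  rewrite Q, !nuexp_3.
  replace (zeta3pow (k * (c * (a + d) + b * d)))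
    with (zeta3pow (k * ((c + n * d) * (a + 3 * n * b + d) + b * d)) * zeta3pow (- (k * - n)))%C.
  - field. auto.
  - rewrite <- zeta3pow_add.
    assert (Dd : exists m, (d * d = 1 + 3 * m)%Z).
    { assert (M : (d mod 3 = 0 \/ d mod 3 = 1 \/ d mod 3 = 2)%Z) by (pose proof (Z.mod_pos_bound d 3); lia).
      pose proof (Z.div_mod d 3 ltac:(lia)) as Ed. set (q := (d / 3)%Z) in *.
      destruct M as [M|[M|M]]; rewrite M in Ed.
      - exfalso. rewrite Ed in Hdet. assert (3 * (a * q - b * c) = 1)%Z by lia. lia.
      - exists (3 * q * q + 2 * q)%Z. rewrite Ed. ring.
      - exists (3 * q * q + 4 * q + 1)%Z. rewrite Ed. ring. }
    destruct Dd as [m Dm].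
    apply zeta3pow_cong with (m := (k * (c * n * b + n * (b * c) + n * m + n + n * d * n * b))%Z).
    assert (E : (a * d = 1 + b * (3 * c))%Z) by lia.
    replace (k * ((c + n * d) * (a + 3 * n * b + d) + b * d) + - (k * - n) -
      k * (c * (a + d) + b * d))%Z with
      (k * (3 * c * n * b + n * (a * d) + n * (d * d) + 3 * n * d * n * b + n))%Z by ring.
    rewrite E, Dm. ring.
Qed.

Lemma near_multiple (x m : Z) : (m <> 0)%Z -> exists n, (2 * Z.abs (x + m * n) <= Z.abs m)%Z.
Proof.
  intros Hm. pose proof (Z.div_mod x (Z.abs m) ltac:(lia)) as E.
  pose proof (Z.mod_pos_bound x (Z.abs m) ltac:(lia)) as B.
  set (q := (x / Z.abs m)%Z) in *. set (r := (x mod Z.abs m)%Z) in *.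
  assert (Hs : exists s, (Z.abs m = m * s)%Z)
    by (destruct (Z_le_dec 0 m); [exists 1%Z | exists (-1)%Z]; lia).
  destruct Hs as [s Hs].
  destruct (Z_le_dec (2 * r) (Z.abs m)) as [L|L].
  - exists (- (s * q))%Z. replace (x + m * - (s * q))%Z with r by (rewrite E, Hs; ring). lia.
  - exists (- (s * (q + 1)))%Z.
    replace (x + m * - (s * (q + 1)))%Z with (r - Z.abs m)%Z by (rewrite E, Hs; ring). lia.
Qed.

(** Induction on [|c|] for the lower left entry [3 c]. A power of [T] achieves [|d| <= 3 |c| / 2],
    then a power of [U] achieves a new [|c|] of at most [|d| / 2], hence at most [3/4] of the old
    one. For [c = 0] the matrix is a translation up to sign, and -1 acts trivially in weight 2. *)
Lemma Gamma0_law (k : Z) (e : C) (F : C -> C) : (e * e = 1)%C -> tlaw k F -> wlaw e F ->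
  forall a b c d, Gamma0_3 a b c d -> glaw k F a b c d.
Proof.
  intros He HT HW.
  assert (P : forall N : nat, forall a b c d, (Z.abs c <= Z.of_nat N)%Z ->
    (a * d - b * (3 * c) = 1)%Z -> glaw k F a b (3 * c) d).
  { induction N as [|N IH]; intros a b c d Hc Hdet.
    - assert (c = 0)%Z by lia. subst c. assert (Had : (a * d = 1)%Z) by lia.
      intros z Hz. rewrite nuexp_3. unfold act.
      assert (Ha : (a = 1 /\ d = 1 \/ a = -1 /\ d = -1)%Z).
      { destruct (Z.mul_eq_1 a d Had) as [->| ->]; lia. }
      destruct Ha as [[-> ->]|[-> ->]].
      + replace (k * (0 * (1 + 1) + b * 1))%Z with (k * b)%Z by ring.
        replace ((1 * z + IZR b) / (IZR (3 * 0) * z + 1))%C with (z + IZR b)%C by (simpl; field).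
        rewrite (tlaw_Z k F HT) by exact Hz. simpl (3 * 0)%Z. ring.
      + replace (k * (0 * (-1 + -1) + b * -1))%Z with (k * - b)%Z by ring.
        replace ((-1 * z + IZR b) / (IZR (3 * 0) * z + -1))%C with (z + IZR (- b))%C.
        * rewrite (tlaw_Z k F HT) by exact Hz. simpl (3 * 0)%Z. ring.
        * rewrite opp_IZR, RtoC_opp. simpl (3 * 0)%Z. field.
    - destruct (Z.eq_dec c 0) as [->|Hc0]; [apply IH; simpl; lia|].
      destruct (near_multiple d (3 * c) ltac:(lia)) as [n Hn].
      apply (glaw_of_T k F a b c d n HT Hdet).
      set (b' := (b + a * n)%Z). set (d' := (d + 3 * c * n)%Z) in *.
      assert (Hdet' : (a * d' - b' * (3 * c) = 1)%Z) by (unfold b', d'; lia).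
      assert (Hd0 : (d' <> 0)%Z) by (intros E; rewrite E in Hdet'; lia).
      destruct (near_multiple c d' Hd0) as [m Hm].
      apply (glaw_of_U k e F a b' c d' m He HT HW Hdet').
      replace (c + m * d')%Z with (c + d' * m)%Z by ring.
      apply IH; [lia|]. lia. }
  intros a b c d [Hdet [q Hq]]. subst c. rewrite (Z.mul_comm q 3) in *.
  exact (P (Z.to_nat (Z.abs q)) a b q d ltac:(lia) Hdet).
Qed.

(** * Membership in [M_2^!] and existence *)

Lemma slash2_det1 (a b c d : Z) (F : C -> C) (z : C) : (a * d - b * c = 1)%Z ->
  slash2 a b c d F z = (F (act a b c d z) / (IZR c * z + IZR d) ^ 2)%C.
Proof. intros H. unfold slash2, act. rewrite H. unfold Cdiv. ring. Qed.

Lemma slash2_W (F : C -> C) (z : C) : inH z ->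
  slash2 0 (-1) 3 0 F z = (F (fr z) / (3 * z * z))%C.
Proof.
  intros Hz. pose proof (inH_neq_0 z Hz) as N. pose proof three_neq_0 as N3. unfold slash2.
  simpl (0 * 0 - -1 * 3)%Z.
  replace ((0 * z + -1) / (3 * z + 0))%C with (fr z) by (unfold fr; field; auto).
  field. auto.
Qed.

Lemma slash2_W_wlaw (e : C) (F : C -> C) :
  (forall z, inH z -> slash2 0 (-1) 3 0 F z = (e * F z)%C) <-> wlaw e F.
Proof.
  pose proof three_neq_0 as N3. split; intros H z Hz; pose proof (inH_neq_0 z Hz) as N.
  - specialize (H z Hz). rewrite slash2_W in H by exact Hz.
    replace (F (fr z)) with (F (fr z) / (3 * z * z) * (3 * z * z))%C by (field; auto).
    rewrite H. ring.
  - rewrite slash2_W, (H z Hz) by exact Hz. field. auto.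
Qed.

Lemma nu_G0_zeta (conj : bool) (a b c d : Z) :
  nu_G0 conj a b c d = zeta3pow (kap conj * nuexp a b c d).
Proof. unfold nu_G0, kap, nuexp. destruct conj; f_equal; lia. Qed.

Lemma sgn_sq (s : bool) : (sgn s * sgn s = 1)%C.
Proof. destruct s; simpl; ring. Qed.

(** At [(z + j) / 3] the parameter [q^(1/3)] becomes [q^(1/9)] times a ninth root of unity. *)
Lemma QS_cusp0 (b : nat -> C) (d : nat) (F : C -> C) (j : Z) (c : C) :
  QS b (fun z => W z ^ d * F z)%C ->
  exists e : nat -> C, forall z, inH z ->
    cser (fun n => e n * qpow ((INR n - INR d) / INR 9) z)%C (c * F ((z + IZR j) / 3))%C.
Proof.
  intros Q. set (om := qpow (1 / 9) (IZR j)).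
  assert (Nom : om <> 0%C) by apply qpow_neq_0.
  exists (fun n => c * b n * (om ^ n / om ^ d))%C. intros z Hz.
  set (x := ((z + IZR j) / 3)%C).
  assert (Hx : inH x).
  { unfold x. replace ((z + IZR j) / 3)%C with (RtoC (/ 3) * (z + IZR j))%C.
    - apply inH_scal; [lra | apply inH_addZ, Hz].
    - rewrite RtoC_inv by lra. field. }
  assert (EW : W x = (qpow (1 / 9) z * om)%C).
  { unfold om. rewrite <- qpow_arg_add. unfold W, qpow, x. f_equal.
    replace (2 * PI * (1 / 3)) with (3 * (2 * PI * (1 / 9))) by field. rewrite (RtoC_mult 3).
    gen_RtoC. field. }
  pose proof (cser_scal (c / W x ^ d) _ _ (Q x Hx)) as P.
  replace (c / W x ^ d * (W x ^ d * F x))%C with (c * F x)%C in P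
    by (field; apply Cpow_nz, W_neq_0).
  eapply cser_ext; [|exact P]. intros n. cbv beta.
  rewrite EW, !Cpow_mult_l.
  replace ((INR n - INR d) / INR 9) with (INR n * (1 / 9) + - (INR d * (1 / 9)))
    by (replace (INR 9) with 9 by (simpl; ring); field).
  rewrite qpow_plus, qpow_opp, !qpow_INR.
  field. repeat split; apply Cpow_nz; auto using qpow_neq_0.
Qed.

(** The pole order and the support give the law under [T]. For meromorphy at the cusps, a matrix
    with [3 | c] lies in [Gamma_0(3)] and repeats the expansion at infinity; any other is brought to
    the expansion at the cusp 0. *)
Lemma Mweak2_intro (s : bool) (d : nat) (F : C -> C) (b : nat -> C) : (d mod 3 <> 0)%nat ->
  wlaw (sgn s) F -> QS b (fun z => W z ^ d * F z)%C -> supp 0 b ->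
  Mweak2 s (d mod 3 =? 1)%nat F.
Proof.
  intros Hd HW Q Sb.
  assert (HT : tlaw (kap (d mod 3 =? 1)%nat) F).
  { intros z Hz. pose proof (QS_T 0 b _ Q Sb z Hz) as E. cbv beta in E.
    rewrite W_T, Cpow_mult_l in E. simpl (zeta ^ 0)%C in E.
    pose proof (Cpow_nz _ d (W_neq_0 z)) as N.
    replace (F (z + 1)%C) with ((zeta ^ d * W z ^ d * F (z + 1)%C) / (zeta ^ d * W z ^ d))%C
      by (field; split; [auto | apply Cpow_nz, zeta_neq_0]).
    rewrite E. rewrite (zeta_pow_mod d).
    assert (M : (d mod 3 = 1 \/ d mod 3 = 2)%nat)
      by (pose proof (Nat.mod_upper_bound d 3 ltac:(lia)); lia).
    pose proof zeta_neq_0 as Nz.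
    destruct M as [->| ->]; simpl Nat.eqb; unfold kap.
    - assert (Z1 : (zeta3pow (-1) * zeta)%C = 1%C) by (rewrite <- zeta3pow_1, <- zeta3pow_add; apply zeta3pow_0).
      replace (zeta3pow (-1)) with (zeta3pow (-1) * zeta / zeta)%C by (field; auto).
      rewrite Z1. field. auto.
    - rewrite zeta3pow_1. replace (zeta * F z)%C with (zeta ^ 3 * F z / zeta ^ 2)%C by (field; auto).
      rewrite zeta_cube. field. auto. }
  pose proof (Gamma0_law _ _ F (sgn_sq s) HT HW) as HG.
  split; [|split; [|split]].
  - intros z Hz. destruct (QS_der _ _ Q) as [G [_ D]]. destruct (QS_der _ _ (QS_mul_Wn d _ _ (QS_const 1))) as [G1 [_ D1]].
    assert (ND : (W z ^ d * 1)%C <> 0%C) by (rewrite Cmult_1_r; apply Cpow_nz, W_neq_0).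
    pose proof (cder_mult _ _ _ _ _ (D z Hz) (cder_inv (fun z => W z ^ d * 1)%C _ _ ND (D1 z Hz))) as DD.
    eexists. apply cder_is_derive. eapply cder_ext; [|exact DD].
    intros x. cbv beta. field. apply Cpow_nz, W_neq_0.
  - intros a0 b0 c0 d0 Hdet.
    destruct (Z.eq_dec (c0 mod 3) 0) as [E|E].
    + assert (HG0 : Gamma0_3 a0 b0 c0 d0) by (split; [exact Hdet | apply Z.mod_divide; lia]).
      set (x := zeta3pow (kap (d mod 3 =? 1)%nat * nuexp a0 b0 c0 d0)).
      exists 3%nat, d, (fun n => x * b n)%C. split; [lia|]. intros z Hz.
      apply is_series_cser. rewrite slash2_det1, (HG _ _ _ _ HG0 z Hz) by exact Hdet. fold x.
      pose proof (det_denom _ _ _ _ z Hz Hdet) as ND.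
      replace (x * (IZR c0 * z + IZR d0) ^ 2 * F z / (IZR c0 * z + IZR d0) ^ 2)%C
        with (x / W z ^ d * (W z ^ d * F z))%C.
      * eapply cser_ext; [|apply (cser_scal (x / W z ^ d) _ _ (Q z Hz))].
        intros n. cbv beta.
        replace ((INR n - INR d) / INR 3) with (INR n / 3 + - (INR d / 3))
          by (replace (INR 3) with 3 by (simpl; ring); field).
        rewrite qpow_plus, qpow_opp, !qpow_W. field. apply Cpow_nz, W_neq_0.
      * field. split; [exact ND | apply Cpow_nz, W_neq_0].
    (* As [c0] is invertible modulo 3, some [u = z + j] turns the matrix into an element of
       [Gamma_0(3)] applied to [-1/u], and [-1/u = fr (u / 3)]. *)
    + assert (Hj : exists j, (3 | d0 - c0 * j)%Z).
      { pose proof (Z.div_mod c0 3 ltac:(lia)) as Ec. pose proof (Z.div_mod d0 3 ltac:(lia)) as Ed.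
        pose proof (Z.mod_pos_bound c0 3 ltac:(lia)).
        set (qc := (c0 / 3)%Z) in *. set (qd := (d0 / 3)%Z) in *. set (rd := (d0 mod 3)%Z) in *.
        assert (Hc : (c0 mod 3 = 1 \/ c0 mod 3 = 2)%Z) by lia.
        destruct Hc as [Hc|Hc]; rewrite Hc in Ec.
        - exists rd, (qd - qc * rd)%Z. rewrite Ec, Ed. ring.
        - exists (2 * rd)%Z, (qd - 2 * qc * rd - rd)%Z. rewrite Ec, Ed. ring. }
      destruct Hj as [j Hj].
      assert (HG0 : Gamma0_3 (- (b0 - a0 * j)) a0 (- (d0 - c0 * j)) c0).
      { split; [lia | apply Z.divide_opp_r; exact Hj]. }
      set (x := zeta3pow (kap (d mod 3 =? 1)%nat * nuexp (- (b0 - a0 * j)) a0 (- (d0 - c0 * j)) c0)).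
      destruct (QS_cusp0 b d F j (x * sgn s / 3) Q) as [e He].
      exists 9%nat, d, e. split; [lia|]. intros z Hz. apply is_series_cser.
      replace (slash2 a0 b0 c0 d0 F z) with (x * sgn s / 3 * F ((z + IZR j) / 3)%C)%C; [apply He, Hz|].
      pose proof three_neq_0 as N3.
      assert (Hu : inH (z + IZR j)) by (apply inH_addZ, Hz).
      set (u := (z + IZR j)%C) in *. pose proof (inH_neq_0 u Hu) as Nu.
      assert (Hu3 : inH (u / 3)).
      { replace (u / 3)%C with (RtoC (/ 3) * u)%C by (rewrite RtoC_inv by lra; field; auto).
        apply inH_scal; [lra | exact Hu]. }
      assert (Hy : inH (- / u)) by (apply inH_S, Hu).
      pose proof (HG _ _ _ _ HG0 _ Hy) as E1. fold x in E1.
      pose proof (HW _ Hu3) as E2. replace (fr (u / 3)) with (- / u)%C in E2 by (unfold fr; field; auto).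
      rewrite E2 in E1.
      pose proof (det_denom _ _ _ _ z Hz Hdet) as ND.
      assert (Ez : z = (u - IZR j)%C) by (unfold u; ring).
      rewrite slash2_det1 by exact Hdet.
      assert (ND2 : (IZR c0 * (u - IZR j) + IZR d0)%C <> 0%C) by (rewrite <- Ez; exact ND).
      replace (act a0 b0 c0 d0 z) with (act (- (b0 - a0 * j)) a0 (- (d0 - c0 * j)) c0 (- / u)).
      * rewrite E1. rewrite Ez. rewrite opp_IZR, minus_IZR, mult_IZR, RtoC_opp, RtoC_minus, RtoC_mult.
        replace (- (IZR d0 - IZR c0 * IZR j) * - / u + IZR c0)%C
          with ((IZR c0 * (u - IZR j) + IZR d0) / u)%C by (field; auto).
        field. auto.
      * unfold act. rewrite Ez. rewrite !opp_IZR, !minus_IZR, !mult_IZR, !RtoC_opp, !RtoC_minus, !RtoC_mult.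
        field. repeat split; auto.
  - intros a0 b0 c0 d0 HG0 z Hz. destruct HG0 as [Hdet Hc].
    pose proof (det_denom _ _ _ _ z Hz Hdet) as ND.
    rewrite slash2_det1, (HG a0 b0 c0 d0 (conj Hdet Hc) z Hz), nu_G0_zeta by exact Hdet.
    field. exact ND.
  - apply slash2_W_wlaw. exact HW.
Qed.

Lemma wlaw_lin (e x : C) (F G : C -> C) :
  wlaw e F -> wlaw e G -> wlaw e (fun z => F z - x * G z)%C.
Proof. intros HF HG z Hz. rewrite HF, HG by auto. ring. Qed.

(* Subtracting a form with leading term [q^(-(d-m)/3)] kills the [m]-th coefficient and leaves
   the earlier ones unchanged. *)
Lemma kill_coef (s : bool) (d m : nat) (F G : C -> C) (b g : nat -> C) :
  (0 < m)%nat -> (m mod 3 = 0)%nat ->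
  wlaw (sgn s) F -> QS b (fun z => W z ^ d * F z)%C -> supp 0 b ->
  wlaw (sgn s) G -> QS g (fun z => W z ^ d * G z / W z ^ m)%C -> g 0%nat = 1%C -> supp 0 g ->
  exists F' b', wlaw (sgn s) F' /\ QS b' (fun z => W z ^ d * F' z)%C /\ supp 0 b' /\
    b' m = 0%C /\ forall n, (n < m)%nat -> b' n = b n.
Proof.
  intros Hm Hm3 HF Qb Sb HG Qg g0 Sg.
  exists (fun z => F z - b m * G z)%C,
    (fun n => b n - b m * (if (n <? m)%nat then 0%C else g (n - m)%nat))%C.
  split; [apply wlaw_lin; auto|]. split; [|split; [|split]].
  - eapply QS_ext; [reflexivity| |apply (QS_minus _ _ _ _ Qb (QS_scal (b m) _ _ (QS_mul_Wn m _ _ Qg)))].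
    intros z Hz. cbv beta. field. apply Cpow_nz, W_neq_0.
  - intros n Hn. rewrite Sb, (supp_shift3 g m Hm3 Sg) by auto. ring.
  - rewrite Nat.ltb_irrefl, Nat.sub_diag, g0. ring.
  - intros n Hn. apply Nat.ltb_lt in Hn. rewrite Hn. ring.
Qed.

(** Coefficients are removed in increasing order, since a correction at [m] disturbs only later
    ones. Only multiples [m] of 3 matter, and for these [d - m] is again prime to 3, so a form of
    that order exists. *)
Lemma reduced_exists (s : bool) (d m : nat) : (d mod 3 <> 0)%nat -> (m <= d)%nat ->
  exists F b, wlaw (sgn s) F /\ QS b (fun z => W z ^ d * F z)%C /\ supp 0 b /\
    b 0%nat = 1%C /\ forall n, (1 <= n <= m)%nat -> b n = 0%C.
Proof.
  intros Hd. induction m as [|m IH]; intros Hm.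
  - destruct (lead_exists s d Hd) as [F [L [b [Q [b0 S]]]]]. exists F, b.
    repeat split; auto. intros; lia.
  - destruct (IH ltac:(lia)) as [F [b [L [Q [Sb [b0 Hb]]]]]].
    destruct (Nat.eq_dec (S m mod 3) 0) as [E|E].
    2:{ exists F, b. repeat split; auto. intros n Hn.
        destruct (Nat.eq_dec n (S m)) as [->|]; [apply Sb; exact E | apply Hb; lia]. }
    set (e := (d - S m)%nat).
    assert (Ed : d = (S m + e)%nat) by (unfold e; lia).
    assert (He : (e mod 3 <> 0)%nat).
    { intros E'. apply Hd. rewrite Ed, Nat.Div0.add_mod, E, E'. reflexivity. }
    destruct (lead_exists s e He) as [G [LG [g [Qg [g0 Sg]]]]].
    destruct (kill_coef s d (S m) F G b g) as [F' [b' [L' [Q' [S' [Z K]]]]]]; auto; [lia| |].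
    { eapply QS_ext; [reflexivity| |exact Qg]. intros z Hz. cbv beta.
      rewrite Ed, Cpow_add_r. field. apply Cpow_nz, W_neq_0. }
    exists F', b'. repeat split; auto; [rewrite K by lia; exact b0|].
    intros n Hn. destruct (Nat.eq_dec n (S m)) as [->|]; [exact Z|].
    rewrite K by lia. apply Hb; lia.
Qed.

Lemma is_f_intro (s : bool) (d : nat) (F : C -> C) (b : nat -> C) :
  (0 < d)%nat -> (d mod 3 <> 0)%nat ->
  wlaw (sgn s) F -> QS b (fun z => W z ^ d * F z)%C -> supp 0 b -> b 0%nat = 1%C ->
  (forall n, (1 <= n <= d)%nat -> b n = 0%C) ->
  (s = false -> (d mod 3 = 2)%nat -> b (S d) = 0%C) ->
  is_f s d F (fun n => b (n + d)%nat).
Proof.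
  intros Hd0 Hd L Q Sb b0 Hb Hx.
  assert (M : (d mod 3 = 1 \/ d mod 3 = 2)%nat)
    by (pose proof (Nat.mod_upper_bound d 3 ltac:(lia)); lia).
  split; [|split; [|split; [|split]]].
  - apply (Mweak2_intro s d F b); auto.
  - apply Hb. simpl. lia.
  - intros n Hn. apply Sb. intros E. apply Hn. rewrite Nat.Div0.add_mod in E.
    pose proof (Nat.mod_upper_bound n 3 ltac:(lia)) as U.
    simpl (0 mod 3)%nat in E.
    destruct M as [M|M]; rewrite M in *; simpl;
      (assert (C : (n mod 3 = 0 \/ n mod 3 = 1 \/ n mod 3 = 2)%nat) by lia;
       destruct C as [C|[C|C]]; rewrite C in *; simpl in E; auto; discriminate).
  - intros [Es E2] n Hn. destruct (Nat.eq_dec n 0) as [->|N0]; [apply Hb; simpl; lia|].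
    destruct (Nat.eq_dec n 1) as [->|N1]; [apply Hx; auto|].
    apply Sb. rewrite Nat.Div0.add_mod, E2.
    assert (C : (n = 2 \/ n = 3)%nat) by lia. destruct C as [->| ->]; simpl; lia.
  - intros z Hz. apply is_series_cser.
    pose proof (QS_minus _ _ _ _ Q (QS_const 1)) as Q1.
    pose proof (QS_div_Wn d _ _ Q1) as Q2. cbv beta in Q2.
    assert (Hv : forall n, (n < d)%nat -> (b n - (if (n =? 0)%nat then 1%C else 0%C))%C = 0%C).
    { intros n Hn. destruct (Nat.eqb_spec n 0) as [->|N]; [rewrite b0; ring|].
      rewrite Hb by lia. ring. }
    pose proof (Q2 Hv z Hz) as P. cbv beta in P.
    replace (F z - qpow (- INR d / 3) z)%C with ((W z ^ d * F z - 1) / W z ^ d)%C.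
    + eapply cser_ext; [|exact P]. intros n. cbv beta. rewrite qpow_W.
      destruct (Nat.eqb_spec (n + d) 0); [lia|]. ring.
    + replace (- INR d / 3) with (- (INR d / 3)) by field. rewrite qpow_opp, qpow_W.
      field. apply Cpow_nz, W_neq_0.
Qed.

Lemma is_f_exists (s : bool) (d : nat) : (0 < d)%nat -> (d mod 3 <> 0)%nat ->
  exists f a, is_f s d f a.
Proof.
  intros Hd0 Hd. destruct (reduced_exists s d d Hd (le_n _)) as [F [b [L [Q [Sb [b0 Hb]]]]]].
  destruct s.
  { exists F, (fun n => b (n + d)%nat). apply is_f_intro; auto; discriminate. }
  destruct (Nat.eq_dec (d mod 3) 2) as [E|E].
  2:{ exists F, (fun n => b (n + d)%nat). apply is_f_intro; auto; contradiction. }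
  assert (E3 : (S d mod 3 = 0)%nat).
  { replace (S d) with (d + 1)%nat by lia. rewrite Nat.Div0.add_mod, E. reflexivity. }
  (* [h3] has the sign and multiplier of this space and begins with [q^(1/3)], so it removes the
     coefficient of index [d + 1] and leaves the earlier ones alone. *)
  destruct (kill_coef false d (S d) F h3 b (ecoef (-2) (-2))) as [F' [b' [L' [Q' [S' [Z K]]]]]];
    auto using supp_ecoef; try exact h3_fr.
  { eapply QS_ext; [reflexivity| |apply (QS_eprod (-2) (-2))].
    intros z Hz. cbv beta. rewrite h3_eprod by exact Hz. simpl. field.
    split; [apply Cpow_nz|]; apply W_neq_0. }
  exists F', (fun n => b' (n + d)%nat). apply is_f_intro; auto.
  - rewrite K by lia. exact b0.
  - intros n Hn. rewrite K by lia. apply Hb; lia.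
Qed.

(** * Uniqueness *)

Lemma fr_im (z : C) : inH z -> Im (fr z) = Im z / (3 * (Cmod z * Cmod z)).
Proof.
  intros Hz. pose proof (inH_neq_0 z Hz) as N. pose proof (proj1 (Cmod_gt_0 z) N).
  unfold fr. rewrite im_inv_opp by (apply Cmult_neq_0; auto using three_neq_0).
  rewrite Cmod_mult, Cmod_R, Rabs_pos_eq, im_scal_l by lra. field. lra.
Qed.

Lemma near_integer (x : R) : exists n : Z, Rabs (x + IZR n) <= / 2.
Proof.
  destruct (archimed (x - / 2)) as [H1 H2]. exists (- up (x - / 2))%Z.
  rewrite opp_IZR. apply Rabs_le. lra.
Qed.

(* Below height 7/25, translating to [|Re| <= 1/2] and inverting multiplies the height
   by more than 1000/986. *)
Lemma reduction (Q : C -> Prop) :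
  (forall z, 7 / 25 <= Im z -> Q z) ->
  (forall z, inH z -> (Q (z + 1)%C <-> Q z)) ->
  (forall z, inH z -> Q (fr z) -> Q z) ->
  forall z, inH z -> Q z.
Proof.
  intros Hhi HT HW.
  assert (HTZ : forall (n : nat) z, inH z -> (Q (z + IZR (Z.of_nat n))%C <-> Q z)).
  { induction n as [|n IH]; intros z Hz.
    - simpl. replace (z + 0)%C with z by ring. tauto.
    - rewrite Nat2Z.inj_succ. unfold Z.succ. rewrite plus_IZR, RtoC_plus, Cplus_assoc.
      rewrite HT by (apply inH_addZ, Hz). apply IH, Hz. }
  assert (HTZ' : forall n z, inH z -> Q (z + IZR n)%C -> Q z).
  { intros n z Hz H. destruct (Z_le_dec 0 n) as [Hn|Hn].
    - apply (HTZ (Z.to_nat n) z Hz). rewrite Z2Nat.id by lia. exact H.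
    - assert (Hz' : inH (z + IZR n)) by (apply inH_addZ, Hz).
      replace z with (z + IZR n + IZR (Z.of_nat (Z.to_nat (- n))))%C.
      + apply HTZ; auto.
      + rewrite Z2Nat.id by lia. rewrite opp_IZR, RtoC_opp. ring. }
  assert (P : forall n z, inH z -> 7 / 25 * (986 / 1000) ^ n <= Im z -> Q z).
  { induction n as [|n IH]; intros z Hz Hi.
    - apply Hhi. simpl in Hi. lra.
    - destruct (Rle_lt_dec (7 / 25) (Im z)) as [L|L]; [apply Hhi, L|].
      destruct (near_integer (Re z)) as [k Hk].
      apply (HTZ' k z Hz). set (x := (z + IZR k)%C).
      assert (Hx : inH x) by (apply inH_addZ, Hz).
      apply (HW x Hx). apply IH; [apply inH_fr, Hx|].
      rewrite fr_im by exact Hx.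
      assert (Ei : Im x = Im z) by (unfold x; rewrite im_plus, im_RtoC; ring).
      assert (Er : Re x = Re z + IZR k) by (unfold x; rewrite re_plus, re_RtoC; ring).
      assert (Sq : Cmod x * Cmod x = Re x * Re x + Im x * Im x).
      { replace x with ((Re x, Im x) : C) at 1 2 by (destruct x; reflexivity). apply Cmod_pair_sq. }
      rewrite <- Er in Hk. apply Rabs_le_between in Hk. unfold inH in Hx, Hz.
      rewrite Ei in *. set (y := Im z) in *. rewrite Sq.
      assert (B : 3 * (Re x * Re x + y * y) <= 986 / 1000) by nra.
      assert (B0 : 0 < 3 * (Re x * Re x + y * y)) by nra.
      apply Rmult_le_reg_r with (3 * (Re x * Re x + y * y)); [exact B0|].
      replace (y / (3 * (Re x * Re x + y * y)) * (3 * (Re x * Re x + y * y))) with y by (field; nra).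
      eapply Rle_trans; [|exact Hi]. cbn [pow].
      assert (0 <= (986 / 1000) ^ n) by (apply pow_le; lra).
      eapply Rle_trans; [apply Rmult_le_compat_l; [|exact B]; lra | right; ring]. }
  intros z Hz. destruct (pow_to_zero (986 / 1000) (Im z)) as [N HN]; [lra | exact Hz|].
  apply (P N z Hz). specialize (HN N (le_n _)).
  assert (0 <= (986 / 1000) ^ N) by (apply pow_le; lra). lra.
Qed.

Lemma Cmult_integral (x y : C) : (x * y)%C = 0%C -> x = 0%C \/ y = 0%C.
Proof.
  intros H. destruct (Ceq_dec x 0) as [E|E]; [auto|]. right.
  replace y with (x * y / x)%C by (field; auto). rewrite H. field. auto.
Qed.

Lemma csum_geom (x : C) (N : nat) : ((x - 1) * csum (fun j => x ^ j) N)%C = (x ^ N - 1)%C.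
Proof. induction N as [|N IH]; simpl; [ring|]. rewrite Cmult_plus_distr_l, IH. ring. Qed.

Lemma root_of_unity_neq (N m n : nat) : (m < n)%nat -> (n < N)%nat ->
  qpow 1 (INR m / INR N)%R <> qpow 1 (INR n / INR N)%R.
Proof.
  intros H1 H2 E. assert (PN : 0 < INR N) by (apply lt_0_INR; lia).
  apply lt_INR in H1 as L1. apply lt_INR in H2 as L2. pose proof (pos_INR m).
  apply (qpow1_real_neq_1 ((INR n - INR m) / INR N)).
  { split; [apply Rdiv_lt_0_compat; lra|]. apply Rmult_lt_reg_r with (INR N); [lra|].
    unfold Rdiv. rewrite Rmult_assoc, Rinv_l; lra. }
  pose proof (qpow_neq_0 1 (INR m / INR N)%R) as N0.
  replace (qpow 1 ((INR n - INR m) / INR N)%R)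
    with (qpow 1 (INR m / INR N)%R * qpow 1 ((INR n - INR m) / INR N)%R / qpow 1 (INR m / INR N)%R)%C
    by (field; auto).
  rewrite <- qpow_arg_add, <- RtoC_plus.
  replace (INR m / INR N + (INR n - INR m) / INR N) with (INR n / INR N) by (field; lra).
  rewrite <- E. field. auto.
Qed.

(* Average of [G] over [N] equidistant points of a horizontal segment of length 3. *)
Lemma cauchy_estimate (c : nat -> C) (G : C -> C) (y M : R) : QS c G -> 0 < y ->
  (forall z, Im z = y -> Cmod (G z) <= M) -> forall n, Cmod (c n) * rho y ^ n <= M.
Proof.
  intros H Hy HM n. destruct (adm_geo c y (QS_adm _ _ H) Hy) as [A [HA0 HA]].
  set (r := rho (y / 2)) in *. assert (Hr : 0 <= r < 1) by (apply rho_01; lra).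
  assert (B : forall N, (n < N)%nat -> Cmod (c n) * rho y ^ n <= M + A * r ^ N / (1 - r)).
  { intros N HN. assert (PN : 0 < INR N) by (apply lt_0_INR; lia).
    assert (NN : RtoC (INR N) <> 0%C) by (apply INR_neq_0; lia).
    set (x := fun j : nat => (RtoC (INR j / INR N * 3) + y * Ci)%C).
    assert (Hxi : forall j, Im (x j) = y) by (intros; unfold x, Im; simpl; ring).
    assert (Hx : forall j, inH (x j)) by (intros; unfold inH; rewrite Hxi; exact Hy).
    set (om := fun m : nat => qpow 1 (INR m / INR N)%R).
    assert (Nom : forall m, om m <> 0%C) by (intros; apply qpow_neq_0).
    assert (EW : forall j m, (W (x j) ^ m)%C = (W (y * Ci) ^ m * om m ^ j)%C).
    { intros j m. unfold x. replace (RtoC (INR j / INR N * 3) + y * Ci)%C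
        with (y * Ci + RtoC (INR j / INR N * 3))%C by ring.
      unfold W at 1. rewrite qpow_arg_add. fold (W (y * Ci)). rewrite Cpow_mult_l. f_equal.
      unfold om, qpow. rewrite !cexp_pow. f_equal.
      replace (RtoC (INR j / INR N * 3)) with (INR j / INR N * 3)%C
        by (rewrite RtoC_mult, RtoC_div by lra; reflexivity).
      rewrite RtoC_div by lra. rewrite Rmult_1_r.
      replace (RtoC (2 * PI * (1 / 3))) with (RtoC (2 * PI) / 3)%C
        by (rewrite <- RtoC_div by lra; f_equal; field).
      revert NN. generalize (RtoC (INR N)). intros vN NN. gen_RtoC. field. auto. }
    assert (Hom : forall m, (om m ^ N)%C = 1%C).
    { intros m. unfold om. rewrite <- qpow_INR.
      replace (qpow (INR N * 1) (RtoC (INR m / INR N))) with (qpow 1 1 ^ m)%C.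
      - rewrite qpow1_1. apply Cpow_1_l.
      - rewrite <- qpow_INR. unfold qpow. f_equal. rewrite RtoC_div by lra.
        rewrite !Rmult_1_r, !RtoC_mult.
        revert NN. generalize (RtoC (INR N)). intros vN NN. gen_RtoC. field. auto. }
    set (S := csum (fun j => G (x j) / om n ^ j)%C N).
    assert (Com : forall j, Cmod (om n ^ j) = 1).
    { intros j. rewrite Cmod_pow. unfold om. rewrite Cmod_qpow, im_RtoC, Rmult_0_r, Ropp_0, exp_0. apply pow1. }
    assert (S1 : Cmod S <= INR N * M).
    { apply csum_bound. intros j Hj. rewrite Cmod_div by (apply Cpow_nz, Nom).
      rewrite Com. unfold Rdiv. rewrite Rinv_1, Rmult_1_r. apply HM, Hxi. }
    (* Orthogonality of the [N]-th roots of unity isolates the index [n] among those below [N]; the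
       tail of the series is left to the error term [S3]. *)
    assert (S2 : csum (fun j => csum (fun m => c m * W (x j) ^ m) N / om n ^ j)%C N
      = (INR N * (c n * W (y * Ci) ^ n))%C).
    { rewrite (csum_ext _ (fun j => csum (fun m => c m * W (y * Ci) ^ m * (om m / om n) ^ j)%C N)).
      - rewrite csum_swap. rewrite (csum_delta _ N n HN).
        + rewrite (csum_ext _ (fun _ => (c n * W (y * Ci) ^ n) * 1)%C).
          * rewrite csum_scal, csum_ones. ring.
          * intros j Hj. replace (om n / om n)%C with (RtoC 1) by (field; auto).
            rewrite Cpow_1_l. reflexivity.
        + intros m Hm Hmn. rewrite csum_scal.
          assert (X1 : (om m / om n - 1)%C <> 0%C).
          { intros E. assert (Q : om m = om n).
            { replace (om m) with ((om m / om n - 1) * om n + om n)%C by (field; auto). rewrite E. ring. }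
            destruct (Nat.lt_ge_cases m n).
            - apply (root_of_unity_neq N m n); auto.
            - apply (root_of_unity_neq N n m); [lia | auto | symmetry; exact Q]. }
          pose proof (csum_geom (om m / om n) N) as Gm.
          replace ((om m / om n) ^ N - 1)%C with (RtoC 0) in Gm.
          * destruct (Cmult_integral _ _ Gm) as [Q|Q]; [contradiction|].
            match goal with |- context [csum ?f N] =>
              replace (csum f N) with (RtoC 0) by (symmetry; exact Q) end. ring.
          * unfold Cdiv. rewrite Cpow_mult_l, Cpow_inv, !Hom by auto. field.
      - intros j Hj. unfold Cdiv at 1. rewrite Cmult_comm, <- csum_scal. apply csum_ext. intros m Hm.
        rewrite EW. unfold Cdiv. rewrite Cpow_mult_l, Cpow_inv by auto. ring. }
    assert (S3 : Cmod (S - INR N * (c n * W (y * Ci) ^ n)) <= INR N * (A * r ^ N / (1 - r))).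
    { rewrite <- S2. unfold S.
      replace (csum (fun j => G (x j) / om n ^ j)%C N -
        csum (fun j => csum (fun m => c m * W (x j) ^ m) N / om n ^ j)%C N)%C
        with (csum (fun j => G (x j) / om n ^ j + -1 * (csum (fun m => c m * W (x j) ^ m) N / om n ^ j))%C N)
        by (rewrite csum_plus, csum_scal; ring).
      apply csum_bound. intros j Hj.
      replace (G (x j) / om n ^ j + -1 * (csum (fun m => c m * W (x j) ^ m) N / om n ^ j))%C
        with ((G (x j) - csum (fun m => c m * W (x j) ^ m) N) / om n ^ j)%C
        by (field; apply Cpow_nz, Nom).
      rewrite Cmod_div by (apply Cpow_nz, Nom). rewrite Com. unfold Rdiv at 1. rewrite Rinv_1, Rmult_1_r.
      apply cser_rem; [|apply H, Hx]. split; [exact Hr|]. intros k.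
      rewrite Cmod_mult, Cmod_W_pow, Hxi. apply HA. }
    assert (S4 : Cmod (INR N * (c n * W (y * Ci) ^ n)) = INR N * (Cmod (c n) * rho y ^ n)).
    { rewrite !Cmod_mult, Cmod_W_pow, Cmod_R, Rabs_pos_eq by lra.
      replace (Im (y * Ci)) with y by (unfold Im; simpl; ring). reflexivity. }
    pose proof (Cmod_rev_triangle (INR N * (c n * W (y * Ci) ^ n)) S) as T.
    rewrite Cmod_sub_sym in T. rewrite S4 in T.
    apply Rmult_le_reg_l with (INR N); [exact PN|]. lra. }
  apply Rnot_lt_le. intros Hlt. set (del := Cmod (c n) * rho y ^ n - M).
  assert (Hd : 0 < del) by (unfold del; lra).
  assert (HK : 0 < A / (1 - r) + 1) by (pose proof (Rdiv_le_0_compat A (1 - r) HA0 ltac:(lra)); lra).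
  destruct (pow_to_zero r (del / (A / (1 - r) + 1)) Hr) as [N HN]; [apply Rdiv_lt_0_compat; auto|].
  specialize (B (N + S n)%nat ltac:(lia)). specialize (HN (N + S n)%nat ltac:(lia)).
  set (u := r ^ (N + S n)) in *. assert (0 <= u) by (apply pow_le; lra).
  assert (X : (A / (1 - r) + 1) * u < del).
  { replace del with ((A / (1 - r) + 1) * (del / (A / (1 - r) + 1))) by (field; lra).
    apply Rmult_lt_compat_l; auto. }
  replace (A * u / (1 - r)) with (A / (1 - r) * u) in B by (field; lra).
  unfold del in X. nra.
Qed.

(** [rho (1/4) = e^(-pi/6) <= e^(-1/2)], and the eighth power of [e^(1/16) >= 17/16] bounds the
    latter. *)
Lemma rho_quarter : rho (1 / 4) <= 616 / 1000.
Proof.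
  assert (H : rho (1 / 4) <= exp (- (1 / 2))).
  { unfold rho. apply exp_mono. pose proof PI2_3_2. lra. }
  assert (E : exp (1 / 2) = exp (1 / 16) ^ 8).
  { rewrite <- exp_pow_INR. f_equal. simpl. field. }
  assert (L : (17 / 16) ^ 8 <= exp (1 / 2)).
  { rewrite E. apply pow_incr. pose proof (exp_ineq1_le (1 / 16)). lra. }
  eapply Rle_trans; [exact H|]. rewrite exp_Ropp.
  apply Rle_trans with (/ (17 / 16) ^ 8).
  - apply Rinv_le_contravar; [apply pow_lt; lra | exact L].
  - apply Rmult_le_reg_r with ((17 / 16) ^ 8); [apply pow_lt; lra|].
    rewrite Rinv_l; [simpl; lra|]. apply pow_nonzero. lra.
Qed.

Lemma vanishing_order2 (c : nat -> C) (G : C -> C) :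
  QS c G -> c 0%nat = 0%C -> c 1%nat = 0%C ->
  (forall z, inH z -> Cmod (G (z + 1)%C) = Cmod (G z)) ->
  (forall z, inH z -> Cmod (G (fr z)) = Cmod (G z)) ->
  forall z, inH z -> G z = 0%C.
Proof.
  intros H c0 c1 HT HW.
  assert (Red : forall M, (forall z, 7 / 25 <= Im z -> Cmod (G z) <= M) ->
    forall z, inH z -> Cmod (G z) <= M).
  { intros M HM. apply (reduction (fun z => Cmod (G z) <= M)); auto.
    - intros z Hz. rewrite HT by auto. tauto.
    - intros z Hz. rewrite HW by auto. auto. }
  (* Cauchy's estimate is taken at height 3/100, and [7/25 = 3/100 + 1/4], so the terms are at most
     [M k^n] with [k = rho (1/4)]. The series starts at [n = 2], and [k^2 / (1 - k) <= 99/100] for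
     [k <= 616/1000]. *)
  assert (Step : forall M, (forall z, inH z -> Cmod (G z) <= M) ->
    forall z, inH z -> Cmod (G z) <= 99 / 100 * M).
  { intros M HM. apply Red. intros z Hz.
    assert (Hz0 : inH z) by (unfold inH; lra).
    set (k := rho (1 / 4)). pose proof rho_quarter as Hk. fold k in Hk.
    pose proof (rho_pos (1 / 4)) as Hk0. fold k in Hk0.
    assert (HM0 : 0 <= M) by (pose proof (HM z Hz0); pose proof (Cmod_ge_0 (G z)); lra).
    assert (CE : forall n, Cmod (c n) * rho (3 / 100) ^ n <= M).
    { apply (cauchy_estimate c G); [exact H | lra|]. intros x Hx. apply HM. unfold inH. lra. }
    assert (GG : geo M k (fun n => c n * W z ^ n)%C).
    { split; [lra|]. intros n. rewrite Cmod_mult, Cmod_W_pow.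
      apply Rle_trans with (Cmod (c n) * (rho (3 / 100) ^ n * k ^ n)).
      - apply Rmult_le_compat_l; [apply Cmod_ge_0|]. rewrite <- Rpow_mult_distr. apply pow_incr.
        split; [apply Rlt_le, rho_pos|]. unfold k. rewrite <- rho_plus. apply rho_anti. lra.
      - rewrite <- Rmult_assoc. apply Rmult_le_compat_r; [apply pow_le; lra | apply CE]. }
    pose proof (cser_rem _ _ _ _ 2 GG (H z Hz0)) as R. simpl csum in R. rewrite c0, c1 in R.
    replace (G z - (0 + 0 * 1 + 0 * (W z * 1)))%C with (G z) in R by ring.
    eapply Rle_trans; [exact R|].
    apply Rmult_le_reg_r with (1 - k); [lra|].
    replace (M * k ^ 2 / (1 - k) * (1 - k)) with (M * (k * k)) by (field; lra).
    assert (k * k <= 99 / 100 * (1 - k)) by nra.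
    replace (99 / 100 * M * (1 - k)) with (M * (99 / 100 * (1 - k))) by ring.
    apply Rmult_le_compat_l; assumption. }
  (* The iteration needs a first finite bound: for [Im z >= 7/25] the series is dominated by its
     majorant at height 7/25, and invariance spreads the bound to all of the half-plane. *)
  assert (M0 : exists M, forall z, inH z -> Cmod (G z) <= M).
  { destruct (adm_geo c (7 / 25) (QS_adm _ _ H)) as [A [HA0 HA]]; [lra|].
    exists (A / (1 - rho (7 / 25 / 2))). apply Red. intros z Hz.
    assert (Hz0 : inH z) by (unfold inH; lra).
    refine (cser_le _ _ _ _ _ (H z Hz0)). split; [apply rho_01; lra|]. intros n.
    rewrite Cmod_mult, Cmod_W_pow. eapply Rle_trans; [|apply HA].
    apply Rmult_le_compat_l; [apply Cmod_ge_0|]. apply pow_incr.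
    split; [apply Rlt_le, rho_pos | apply rho_anti; exact Hz]. }
  destruct M0 as [M HM].
  assert (It : forall n z, inH z -> Cmod (G z) <= (99 / 100) ^ n * M).
  { induction n as [|n IH]; [intros z Hz; simpl; rewrite Rmult_1_l; auto|].
    intros z Hz. simpl. rewrite Rmult_assoc. apply Step; auto. }
  intros z Hz. apply Cmod_eq_0. destruct (Rle_lt_or_eq_dec 0 _ (Cmod_ge_0 (G z))) as [P|P]; [|auto].
  exfalso. assert (HM1 : 0 < M) by (pose proof (HM z Hz); lra).
  destruct (pow_to_zero (99 / 100) (Cmod (G z) / M)) as [N HN]; [lra | apply Rdiv_lt_0_compat; auto|].
  specialize (HN N (le_n _)). specialize (It N z Hz).
  apply Rmult_lt_compat_r with (r := M) in HN; [|exact HM1].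
  replace (Cmod (G z) / M * M) with (Cmod (G z)) in HN by (field; lra). lra.
Qed.

Lemma vanishing (c : nat -> C) (G : C -> C) : QS c G -> c 0%nat = 0%C ->
  (forall z, inH z -> Cmod (G (z + 1)%C) = Cmod (G z)) ->
  (forall z, inH z -> Cmod (G (fr z)) = Cmod (G z)) ->
  forall z, inH z -> G z = 0%C.
Proof.
  intros H c0 HT HW z Hz.
  assert (E : (G z * G z)%C = 0%C).
  { apply (vanishing_order2 (conv c c) (fun z => G z * G z)%C); auto.
    - apply QS_mult; exact H.
    - rewrite conv_0, c0. ring.
    - unfold conv. simpl. rewrite c0. ring.
    - intros x Hx. rewrite !Cmod_mult, HT by auto. reflexivity.
    - intros x Hx. rewrite !Cmod_mult, HW by auto. reflexivity. }
  destruct (Cmult_integral _ _ E); auto.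
Qed.

Lemma h3_T (z : C) : inH z -> h3 (z + 1)%C = (zeta * h3 z)%C.
Proof.
  intros Hz. rewrite !h3_eprod by auto using inH_T. rewrite W_T.
  rewrite (QS_T 0 _ _ (QS_eprod (-2) (-2)) (supp_ecoef _ _) z Hz). simpl. ring.
Qed.

(** Division by [h3] makes [a 1] the constant term of [G]. It vanishes by the support for [r = 2]
    and by hypothesis for the minus sign with [r = 1]; the plus sign with [r = 1] is the case
    settled at the fixed point. *)
Lemma form_zero (s : bool) (r : nat) (a : nat -> C) (D : C -> C) :
  (r = 1 \/ r = 2)%nat -> QS a D -> supp r a -> wlaw (sgn s) D ->
  (s = false -> r = 1%nat -> a 1%nat = 0%C) -> forall z, inH z -> D z = 0%C.
Proof.
  intros Hr H Sa HW Hx.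
  assert (a0 : a 0%nat = 0%C) by (apply Sa; destruct Hr as [->| ->]; discriminate).
  set (G := fun z => (D z / h3 z)%C). set (c := conv (fun n => a (S n)) (ecoef 2 2)).
  assert (QG : QS c G).
  { eapply QS_ext; [reflexivity| |apply (QS_mult _ _ _ _ (QS_div_W _ _ H a0) (QS_eprod 2 2))].
    intros z Hz. unfold G, Cdiv. rewrite h3_inv by exact Hz. unfold Cdiv. ring. }
  assert (c0 : c 0%nat = a 1%nat) by (unfold c; rewrite conv_0, ecoef_0; ring).
  assert (GT : forall z, inH z -> G (z + 1)%C = (zeta ^ r / zeta * G z)%C).
  { intros z Hz. unfold G. rewrite (QS_T r a D H Sa z Hz), h3_T by exact Hz.
    field. split; [apply h3_neq_0, Hz | apply zeta_neq_0]. }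
  assert (GW : forall z, inH z -> G (fr z) = (- sgn s * G z)%C).
  { intros z Hz. unfold G. rewrite HW, h3_fr by exact Hz. field.
    repeat split; auto using h3_neq_0, inH_neq_0, three_neq_0;
    try (intros Q; apply RtoC_inj in Q; lra). }
  assert (Cs : Cmod (- sgn s) = 1) by (rewrite Cmod_opp; destruct s; simpl sgn;
    rewrite Cmod_R; [rewrite Rabs_R1; reflexivity | rewrite Rabs_left; lra]).
  assert (Cz : Cmod (zeta ^ r / zeta) = 1).
  { rewrite Cmod_div, Cmod_zeta_pow by apply zeta_neq_0.
    replace (Cmod zeta) with (Cmod (zeta ^ 1)) by (f_equal; simpl; ring).
    rewrite Cmod_zeta_pow. field. }
  assert (Fin : a 1%nat = 0%C -> forall z, inH z -> G z = 0%C).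
  { intros a1. apply (vanishing c G QG); [congruence | |]; intros z Hz.
    - rewrite GT, Cmod_mult, Cz by exact Hz. ring.
    - rewrite GW, Cmod_mult, Cs by exact Hz. ring. }
  assert (a1 : a 1%nat = 0%C).
  { destruct Hr as [->| ->]; [|apply Sa; discriminate].
    destruct s; [|apply Hx; reflexivity].
    assert (GT1 : forall z, inH z -> G (z + 1)%C = G z).
    { intros z Hz. rewrite GT by exact Hz. field. apply zeta_neq_0. }
    assert (X : forall z, inH z -> (G z * G z - a 1%nat * a 1%nat)%C = 0%C).
    { pose proof (QS_minus _ _ _ _ (QS_mult _ _ _ _ QG QG) (QS_const (a 1%nat * a 1%nat)%C)) as QX.
      apply (vanishing _ _ QX).
      - cbv beta. rewrite conv_0, c0. simpl. ring.
      - intros z Hz. rewrite GT1 by exact Hz. reflexivity.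
      - intros z Hz. rewrite GW by exact Hz. f_equal. simpl sgn. ring. }
    (* [i / sqrt 3] is fixed by [W] *)
    set (z0 := (RtoC (/ sqrt 3) * Ci)%C).
    assert (S3 : 0 < sqrt 3) by (apply sqrt_lt_R0; lra).
    assert (H0 : inH z0) by (apply inH_Ci, Rinv_0_lt_compat, S3).
    assert (F0 : fr z0 = z0).
    { unfold fr, z0. assert (E : sqrt 3 * sqrt 3 = 3) by (apply sqrt_sqrt; lra).
      rewrite RtoC_inv by lra.
      assert (E' : (sqrt 3 * sqrt 3 = 3)%C) by (rewrite <- RtoC_mult, E; reflexivity).
      assert (NS : RtoC (sqrt 3) <> 0%C) by (intros Q; apply RtoC_inj in Q; lra).
      rewrite <- E'. pose proof Ci_nz as NI. transitivity (-1 / (sqrt 3 * Ci))%C; [field; auto|].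
      rewrite <- CiCi. field. auto. }
    pose proof (GW z0 H0) as E. rewrite F0 in E. simpl sgn in E.
    assert (G0 : G z0 = 0%C).
    { replace (G z0) with ((G z0 - - (1) * G z0) / 2)%C by field. rewrite <- E. field. }
    specialize (X z0 H0). rewrite G0 in X.
    assert (Y : (a 1%nat * a 1%nat)%C = 0%C).
    { replace (a 1%nat * a 1%nat)%C with (- (0 * 0 - a 1%nat * a 1%nat))%C by ring. rewrite X. ring. }
    destruct (Cmult_integral _ _ Y); auto. }
  intros z Hz. pose proof (Fin a1 z Hz) as E. unfold G in E.
  replace (D z) with (D z / h3 z * h3 z)%C by (field; apply h3_neq_0, Hz). rewrite E. ring.
Qed.

(** For [d] prime to 3 this is the class of [-d]: all exponents must agree modulo 3 with that of
    [q^(-d/3)]. *)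
Definition res (d : nat) : nat := if (d mod 3 =? 1)%nat then 2%nat else 1%nat.

Lemma res_12 (d : nat) : (res d = 1 \/ res d = 2)%nat.
Proof. unfold res. destruct (d mod 3 =? 1)%nat; auto. Qed.

Lemma is_f_elim (s : bool) (d : nat) (f : C -> C) (a : nat -> C) : is_f s d f a ->
  wlaw (sgn s) f /\ QS a (fun z => f z - / W z ^ d)%C /\ supp (res d) a /\
  (s = false -> (d mod 3 = 2)%nat -> a 1%nat = 0%C).
Proof.
  intros [[_ [_ [_ HW]]] [a0 [Sa [Hx HS]]]]. split; [|split; [|split]].
  - apply slash2_W_wlaw. exact HW.
  - intros z Hz. specialize (HS z Hz). apply is_series_cser in HS.
    replace (- INR d / 3) with (- (INR d / 3)) in HS by field. rewrite qpow_opp, qpow_W in HS.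
    eapply cser_ext; [|exact HS]. intros n. cbv beta. rewrite qpow_W. reflexivity.
  - intros n Hn. apply Sa. fold (res d). rewrite (Nat.mod_small (res d)) in Hn; [exact Hn|].
    destruct (res_12 d); lia.
  - intros E1 E2. apply Hx; [auto | lia].
Qed.

Lemma supp_minus (r : nat) (x : C) (a b : nat -> C) :
  supp r a -> supp r b -> supp r (fun n => a n - x * b n)%C.
Proof. intros Ha Hb n Hn. rewrite Ha, Hb by auto. ring. Qed.

Lemma is_f_unique (s : bool) (d : nat) (f g : C -> C) (a b : nat -> C) :
  is_f s d f a -> is_f s d g b -> (d mod 3 <> 0)%nat -> forall z, inH z -> g z = f z.
Proof.
  intros Hf Hg Hd z Hz.
  destruct (is_f_elim _ _ _ _ Hf) as [Lf [Qf [Sf Xf]]].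
  destruct (is_f_elim _ _ _ _ Hg) as [Lg [Qg [Sg Xg]]].
  apply Ceq_minus.
  assert (E : (g z - 1 * f z)%C = 0%C).
  { apply (form_zero s (res d) (fun n => b n - 1 * a n)%C (fun z => g z - 1 * f z)%C); auto.
    - apply res_12.
    - eapply QS_ext; [reflexivity| |apply (QS_minus _ _ _ _ Qg (QS_scal 1 _ _ Qf))].
      intros x Hx. cbv beta. ring.
    - apply supp_minus; auto.
    - apply wlaw_lin; auto.
    - intros Es Er. assert (d mod 3 = 2)%nat.
      { unfold res in Er. destruct (Nat.eqb_spec (d mod 3) 1); [discriminate|].
        pose proof (Nat.mod_upper_bound d 3 ltac:(lia)). lia. }
      rewrite Xf, Xg by auto. ring. }
  rewrite <- E. ring.
Qed.

(** * Hecke operators *)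

Lemma slash2_hecke_l (p l : nat) (F : C -> C) (z : C) : (0 < p)%nat ->
  slash2 1 (3 * Z.of_nat l) 0 (Z.of_nat p) F z
  = (/ INR p * F ((z + 3 * INR l) / INR p)%C)%C.
Proof.
  intros Hp. pose proof (INR_neq_0 p Hp) as N. unfold slash2.
  replace (1 * Z.of_nat p - 3 * Z.of_nat l * 0)%Z with (Z.of_nat p) by lia.
  rewrite mult_IZR, <- !INR_IZR_INZ, RtoC_mult.
  replace ((1 * z + 3 * INR l) / (0 * z + INR p))%C with ((z + 3 * INR l) / INR p)%C
    by (generalize dependent (RtoC (INR p)); intros; field; auto).
  generalize dependent (F ((z + 3 * INR l) / INR p)%C). intros.
  generalize dependent (RtoC (INR p)). intros. field. auto.
Qed.

Lemma heckeT_eq (p : nat) (F : C -> C) (z : C) : (0 < p)%nat ->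
  heckeT p F z = (/ INR p * csum (fun l => F ((z + 3 * INR l) / INR p)%C) p
                  + INR p * F (INR p * z)%C)%C.
Proof.
  intros Hp. unfold heckeT. f_equal.
  - assert (H : forall L, hsum (Z.of_nat p) L F z
      = (/ INR p * csum (fun l => F ((z + 3 * INR l) / INR p)%C) L)%C).
    { induction L as [|L IH]; [simpl; ring|].
      cbn [hsum csum]. rewrite IH, slash2_hecke_l by exact Hp. ring. }
    apply H.
  - unfold slash2. replace (Z.of_nat p * 1 - 0 * 0)%Z with (Z.of_nat p) by lia.
    rewrite <- INR_IZR_INZ.
    replace ((INR p * z + 0) / (0 * z + 1))%C with (INR p * z)%C
      by (generalize (RtoC (INR p)); intros; field).
    generalize (F (INR p * z)%C) (RtoC (INR p)). intros. field.
Qed.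

Lemma inH_hecke (p l : nat) (z : C) : (0 < p)%nat -> inH z -> inH ((z + 3 * INR l) / INR p).
Proof.
  intros Hp Hz. assert (P : 0 < INR p) by (apply lt_0_INR; lia).
  replace ((z + 3 * INR l) / INR p)%C with (RtoC (/ INR p) * (z + IZR (3 * Z.of_nat l)))%C.
  - apply inH_scal; [apply Rinv_0_lt_compat, P | apply inH_addZ, Hz].
  - rewrite RtoC_inv, mult_IZR, <- INR_IZR_INZ, RtoC_mult by lra. unfold Cdiv. ring.
Qed.

Lemma inH_INR (p : nat) (z : C) : (0 < p)%nat -> inH z -> inH (INR p * z).
Proof. intros Hp Hz. apply inH_scal; [apply lt_0_INR; lia | exact Hz]. Qed.

Lemma heckeT_ext (p : nat) (F G : C -> C) (z : C) : (0 < p)%nat -> inH z ->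
  (forall x, inH x -> F x = G x) -> heckeT p F z = heckeT p G z.
Proof.
  intros Hp Hz E. rewrite !heckeT_eq by exact Hp. rewrite E by (apply inH_INR; auto).
  f_equal. f_equal. apply csum_ext. intros l _. apply E, inH_hecke; auto.
Qed.

Lemma heckeT_lin (p : nat) (x : C) (F G : C -> C) (z : C) : (0 < p)%nat ->
  heckeT p (fun u => F u + x * G u)%C z = (heckeT p F z + x * heckeT p G z)%C.
Proof. intros Hp. rewrite !heckeT_eq by exact Hp. rewrite csum_plus, csum_scal. ring. Qed.

Lemma root_of_unity (p m : nat) : (0 < p)%nat ->
  (qpow 1 (INR m / INR p)%R ^ p)%C = 1%C /\
  ((m mod p = 0)%nat -> qpow 1 (INR m / INR p)%R = 1%C) /\
  ((m mod p <> 0)%nat -> qpow 1 (INR m / INR p)%R <> 1%C).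
Proof.
  intros Hp. assert (P : 0 < INR p) by (apply lt_0_INR; lia).
  assert (E1 : forall k, qpow 1 (INR k) = 1%C).
  { intros k. replace (qpow 1 (INR k)) with (qpow 1 1 ^ k)%C.
    - rewrite qpow1_1. apply Cpow_1_l.
    - rewrite <- qpow_INR. unfold qpow. f_equal. rewrite !Rmult_1_r, !RtoC_mult. ring. }
  split; [|split].
  - rewrite <- qpow_INR, Rmult_1_r. rewrite <- (E1 m). unfold qpow. f_equal.
    rewrite RtoC_div, Rmult_1_r, RtoC_mult by lra.
    pose proof (INR_neq_0 p Hp) as N. revert N. generalize (RtoC (INR p)). intros v N.
    gen_RtoC. field. auto.
  - intros H. replace (INR m / INR p) with (INR (m / p)); [apply E1|].
    pose proof (Nat.div_mod_eq m p) as D. rewrite H, Nat.add_0_r in D.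
    rewrite D at 2. rewrite mult_INR. field. lra.
  - intros H. pose proof (Nat.div_mod_eq m p) as D.
    pose proof (Nat.mod_upper_bound m p ltac:(lia)) as U.
    replace (INR m / INR p) with (INR (m / p) + INR (m mod p) / INR p).
    + rewrite RtoC_plus, qpow_arg_add, E1, Cmult_1_l. apply qpow1_real_neq_1.
      apply lt_INR in U. assert (0 < INR (m mod p)) by (apply lt_0_INR; lia).
      split; [apply Rdiv_lt_0_compat; lra|]. apply Rmult_lt_reg_r with (INR p); [lra|].
      unfold Rdiv. rewrite Rmult_assoc, Rinv_l; lra.
    + rewrite D at 3. rewrite plus_INR, mult_INR. field. lra.
Qed.

Lemma sum_roots (p : nat) (x : C) : (x ^ p)%C = 1%C ->
  csum (fun l => x ^ l)%C p = if Ceq_dec x 1 then RtoC (INR p) else 0%C.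
Proof.
  intros H. destruct (Ceq_dec x 1) as [->|N].
  - rewrite (csum_ext _ (fun _ => 1%C)) by (intros; apply Cpow_1_l). apply csum_ones.
  - pose proof (csum_geom x p) as G. rewrite H in G.
    replace (1 - 1)%C with (RtoC 0) in G by ring.
    destruct (Cmult_integral _ _ G) as [Q|Q]; [|exact Q].
    exfalso. apply N. apply Ceq_minus. exact Q.
Qed.

Lemma W_hecke (p l m : nat) (z : C) : (0 < p)%nat ->
  (W ((z + 3 * INR l) / INR p) ^ m)%C = (W (z / INR p) ^ m * qpow 1 (INR m / INR p)%R ^ l)%C.
Proof.
  intros Hp. assert (P : 0 < INR p) by (apply lt_0_INR; lia).
  pose proof (INR_neq_0 p Hp) as N.
  replace ((z + 3 * INR l) / INR p)%C with (z / INR p + 3 * INR l / INR p)%C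
    by (unfold Cdiv; ring).
  unfold W at 1. rewrite qpow_arg_add, Cpow_mult_l. fold (W (z / INR p)). f_equal.
  rewrite <- !qpow_INR. unfold qpow. f_equal. rewrite RtoC_div, !RtoC_mult by lra.
  replace (RtoC (1 / 3)) with (/ 3)%C by (rewrite RtoC_div by lra; unfold Cdiv; ring).
  revert N. generalize (RtoC (INR p)). intros v N. gen_RtoC. field. auto.
Qed.

Lemma W_div_pow (p k : nat) (z : C) : (0 < p)%nat -> (W (z / INR p) ^ (p * k))%C = (W z ^ k)%C.
Proof.
  intros Hp. pose proof (INR_neq_0 p Hp) as N. rewrite Cpow_mult_r, <- W_INR. f_equal. f_equal.
  generalize dependent (RtoC (INR p)). intros; field; auto.
Qed.

Definition hcoef (p : nat) (a : nat -> C) (n : nat) : C :=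
  (a (p * n)%nat + INR p * dilate p a n)%C.

(** The sum over the translates by [3 l] retains the exponents divisible by [p], because the powers
    of a nontrivial [p]-th root of unity sum to 0. *)
Lemma QS_hecke (p : nat) (a : nat -> C) (A : C -> C) : (0 < p)%nat -> QS a A ->
  QS (hcoef p a) (heckeT p A).
Proof.
  intros Hp H. pose proof (INR_neq_0 p Hp) as N.
  eapply QS_ext with (F := fun z => (/ INR p * csum (fun l => A ((z + 3 * INR l) / INR p)%C) p
    + INR p * A (INR p * z)%C)%C); [reflexivity| |].
  { intros z Hz. symmetry. apply heckeT_eq, Hp. }
  apply QS_plus; [|apply QS_scal, QS_dilate; auto].
  intros z Hz.
  assert (S : forall L, cser (fun m => a m * (W (z / INR p) ^ m * csum (fun l => qpow 1 (INR m / INR p)%R ^ l)%C L))%C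
    (csum (fun l => A ((z + 3 * INR l) / INR p)%C) L)).
  { induction L as [|L IH].
    - apply clim_ext with (fun _ => 0%C); [|apply clim_const].
      intros n. symmetry. apply csum_zero. intros; simpl; ring.
    - cbn [csum]. eapply cser_ext; [|apply (cser_plus _ _ _ _ IH (H _ (inH_hecke p L z Hp Hz)))].
      intros m. cbv beta. rewrite W_hecke by exact Hp. ring. }
  pose proof (cser_scal (/ INR p) _ _ (S p)) as P.
  refine (proj2 (cser_sparse p _ _ _ Hp _ _) P).
  - intros k. cbv beta. destruct (root_of_unity p (p * k) Hp) as [R1 [R2 _]].
    rewrite (sum_roots p _ R1). rewrite R2 by (rewrite Nat.mul_comm; apply Nat.Div0.mod_mul).
    destruct (Ceq_dec 1 1) as [_|Q]; [|contradiction]. rewrite W_div_pow by exact Hp.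
    generalize dependent (RtoC (INR p)). intros; field; auto.
  - intros n Hn. cbv beta. destruct (root_of_unity p n Hp) as [R1 [_ R3]].
    rewrite (sum_roots p _ R1). destruct (Ceq_dec _ 1) as [Q|_]; [exfalso; apply (R3 Hn Q)|]. ring.
Qed.

(** Negative exponents lie outside [QS], so the polar term is treated apart, by the same
    orthogonality. *)
Lemma hecke_polar (p e : nat) (z : C) : (0 < p)%nat ->
  heckeT p (fun u => / W u ^ e)%C z =
  ((if (e mod p =? 0)%nat then / W z ^ (e / p) else 0) + INR p * / W z ^ (p * e))%C.
Proof.
  intros Hp. pose proof (INR_neq_0 p Hp) as N. rewrite heckeT_eq by exact Hp. f_equal.
  - destruct (root_of_unity p e Hp) as [R1 [R2 R3]].
    set (x := qpow 1 (INR e / INR p)%R) in *.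
    assert (Nx : x <> 0%C) by apply qpow_neq_0.
    rewrite (csum_ext _ (fun l => / W (z / INR p) ^ e * (/ x) ^ l)%C).
    + rewrite csum_scal, sum_roots by (rewrite Cpow_inv, R1 by exact Nx; field).
      destruct (Nat.eqb_spec (e mod p) 0) as [E|E].
      * rewrite (R2 E). destruct (Ceq_dec (/ 1) 1) as [_|Q]; [|exfalso; apply Q; field].
        pose proof (Nat.div_mod_eq e p) as D. rewrite E, Nat.add_0_r in D.
        rewrite D at 1. rewrite W_div_pow by exact Hp.
        pose proof (Cpow_nz _ (e / p) (W_neq_0 z)).
        generalize dependent (RtoC (INR p)). intros; field; auto.
      * destruct (Ceq_dec (/ x) 1) as [Q|Q]; [|ring].
        exfalso. apply (R3 E). replace x with (/ / x)%C by (field; auto). rewrite Q. field.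
    + intros l _. rewrite W_hecke by exact Hp. fold x. rewrite Cpow_inv by exact Nx.
      field. split; apply Cpow_nz; auto using W_neq_0.
  - rewrite W_INR, <- Cpow_mult_r. reflexivity.
Qed.

(** The factor 27 collects the 3 of [3 l], of [3 l'] and of [W_3]; it is invertible modulo [p]
    because [p >= 5]. *)
Lemma hecke_inverse (p l : nat) : prime (Z.of_nat p) -> (5 <= p)%nat -> (0 < l < p)%nat ->
  exists l', (0 < l' < p)%nat /\ (Z.of_nat p | 27 * Z.of_nat l * Z.of_nat l' + 1)%Z /\
    forall m, (m < p)%nat -> (Z.of_nat p | 27 * Z.of_nat l * Z.of_nat m + 1)%Z -> m = l'.
Proof.
  intros Hp Hp5 Hl. set (P := Z.of_nat p) in *.
  assert (R : rel_prime (27 * Z.of_nat l) P).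
  { apply rel_prime_sym, prime_rel_prime; [exact Hp|]. intros D.
    apply prime_mult in D; [|exact Hp]. destruct D as [D|D].
    - replace 27%Z with (3 * (3 * 3))%Z in D by reflexivity.
      assert (D3 : (P | 3)%Z).
      { apply prime_mult in D as [D|D]; auto. apply prime_mult in D as [D|D]; auto. }
      apply Z.divide_pos_le in D3; lia.
    - apply Z.divide_pos_le in D; lia. }
  destruct (rel_prime_bezout _ _ R) as [u v E].
  set (m := ((- u) mod P)%Z).
  pose proof (Z.mod_pos_bound (- u) P ltac:(lia)) as B. fold m in B.
  pose proof (Z.div_mod (- u) P ltac:(lia)) as D. fold m in D.
  set (q := ((- u) / P)%Z) in *.
  assert (Hm : (P | 27 * Z.of_nat l * m + 1)%Z).
  { exists (v - 27 * Z.of_nat l * q)%Z.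
    replace m with (- u - P * q)%Z by lia.
    replace (27 * Z.of_nat l * (- u - P * q) + 1)%Z
      with (- (u * (27 * Z.of_nat l)) - 27 * Z.of_nat l * P * q + 1)%Z by ring.
    replace (u * (27 * Z.of_nat l))%Z with (1 - v * P)%Z by lia. ring. }
  assert (Hm0 : m <> 0%Z).
  { intros E0. rewrite E0, Z.mul_0_r in Hm. simpl in Hm. apply Z.divide_pos_le in Hm; lia. }
  exists (Z.to_nat m). split; [lia|]. rewrite Z2Nat.id by lia. split; [exact Hm|].
  intros k Hk Dk.
  assert (D2 : (P | (27 * Z.of_nat l) * (Z.of_nat k - m))%Z).
  { replace ((27 * Z.of_nat l) * (Z.of_nat k - m))%Z
      with ((27 * Z.of_nat l * Z.of_nat k + 1) - (27 * Z.of_nat l * m + 1))%Z by ring.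
    apply Z.divide_sub_r; auto. }
  apply Gauss in D2; [|apply rel_prime_sym; exact R].
  destruct D2 as [t Ht]. assert (t = 0)%Z by nia. lia.
Qed.

(* The cosets [[1, 3l; 0, p]] with [l <> 0] are permuted by [W] through [27 l l' = -1 mod p],
   with an element of [Gamma_0(3)] on which the multiplier is trivial. *)
Lemma hecke_coset (k : Z) (e : C) (F : C -> C) (p l l' : nat) (z : C) :
  (e * e = 1)%C -> tlaw k F -> wlaw e F -> (0 < p)%nat -> inH z ->
  (Z.of_nat p | 27 * Z.of_nat l * Z.of_nat l' + 1)%Z ->
  F ((fr z + 3 * INR l) / INR p)%C = (e * (3 * z * z) * F ((z + 3 * INR l') / INR p)%C)%C.
Proof.
  intros He HT HW Hp Hz [q Hq].
  pose proof (inH_neq_0 z Hz) as Nz. pose proof (INR_neq_0 p Hp) as Np. pose proof three_neq_0 as N3.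
  set (w := ((z + 3 * INR l') / INR p)%C).
  assert (Hw : inH w) by (apply inH_hecke; auto).
  assert (HG : Gamma0_3 (Z.of_nat p) (- 3 * Z.of_nat l') (- 9 * Z.of_nat l) q).
  { split; [lia | exists (- 3 * Z.of_nat l)%Z; ring]. }
  pose proof (Gamma0_law k e F He HT HW _ _ _ _ HG w Hw) as E1.
  pose proof (det_denom _ _ _ _ w Hw (proj1 HG)) as ND.
  pose proof (inH_act _ _ _ _ w Hw (proj1 HG)) as Hy.
  replace (zeta3pow (k * nuexp (Z.of_nat p) (- 3 * Z.of_nat l') (- 9 * Z.of_nat l) q)) with (RtoC 1) in E1.
  2:{ replace (- 9 * Z.of_nat l)%Z with (3 * (- 3 * Z.of_nat l))%Z by ring. rewrite nuexp_3.
      symmetry. rewrite <- zeta3pow_0.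
      apply zeta3pow_cong with (m := (k * (- Z.of_nat l * (Z.of_nat p + q) - Z.of_nat l' * q))%Z). ring. }
  set (y := act (Z.of_nat p) (- 3 * Z.of_nat l') (- 9 * Z.of_nat l) q w) in *.
  assert (Eq : (INR p * IZR q = 27 * INR l * INR l' + 1)%C).
  { rewrite !INR_IZR_INZ. rewrite <- !RtoC_mult, <- RtoC_plus. f_equal.
    rewrite <- !mult_IZR, <- plus_IZR. f_equal. lia. }
  unfold act in y. rewrite !mult_IZR, <- !INR_IZR_INZ, !RtoC_mult in *.
  set (P := RtoC (INR p)) in *. set (L := RtoC (INR l)) in *. set (L' := RtoC (INR l')) in *.
  set (Q := RtoC (IZR q)) in *.
  assert (EQ : Q = ((27 * L * L' + 1) / P)%C) by (rewrite <- Eq; field; auto).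
  assert (Ed : (-9 * L * w + Q = (1 - 9 * L * z) / P)%C) by (unfold w; rewrite EQ; field; auto).
  rewrite Ed in *.
  assert (N1 : (1 - 9 * L * z)%C <> 0%C).
  { intros Z0. apply ND. rewrite Z0. field. auto. }
  assert (Ey : y = (P * z / (1 - 9 * L * z))%C).
  { unfold y. rewrite !mult_IZR, <- !INR_IZR_INZ, !RtoC_mult. fold P L L' Q.
    rewrite Ed. unfold w. field. auto. }
  replace ((fr z + 3 * L) / P)%C with (fr y).
  2:{ rewrite Ey. unfold fr. field. repeat split; auto. }
  rewrite HW by exact Hy. rewrite E1, Ey. field. auto.
Qed.

(** The involution exchanges the terms of [[[1, 0], [0, p]]] and [[[p, 0], [0, 1]]] and permutes the
    others as in [hecke_coset]. *)
Lemma heckeT_wlaw (k : Z) (e : C) (F : C -> C) (p : nat) :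
  (e * e = 1)%C -> tlaw k F -> wlaw e F -> prime (Z.of_nat p) -> (5 <= p)%nat ->
  wlaw e (heckeT p F).
Proof.
  intros He HT HW Hpr Hp5 z Hz.
  assert (Hp : (0 < p)%nat) by lia.
  pose proof (inH_neq_0 z Hz) as Nz. pose proof (INR_neq_0 p Hp) as Np. pose proof three_neq_0 as N3.
  rewrite !heckeT_eq by exact Hp.
  set (g := fun l => F ((z + 3 * INR l) / INR p)%C).
  set (h := fun l => F ((fr z + 3 * INR l) / INR p)%C).
  destruct p as [|p']; [lia|]. set (p := S p') in *.
  assert (Sm : csum (fun l => h (S l)) p' = (e * (3 * z * z) * csum (fun l => g (S l)) p')%C).
  (* The permutation [l -> l'] is represented by its symmetric graph, so that reindexing becomes an
     exchange of two finite sums. *)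
  { set (R := fun l l' : nat => if Zdivide_dec (Z.of_nat p) (27 * Z.of_nat (S l) * Z.of_nat (S l') + 1)
      then true else false).
    assert (HR : forall l l', R l l' = true <-> (Z.of_nat p | 27 * Z.of_nat (S l) * Z.of_nat (S l') + 1)%Z).
    { intros l l'. unfold R. destruct (Zdivide_dec _ _); split; intros; auto; discriminate. }
    assert (Uq : forall l, (l < p')%nat -> exists l', (l' < p')%nat /\ R l l' = true /\
      forall m, (m < p')%nat -> m <> l' -> R l m = false).
    { intros l Hl. destruct (hecke_inverse p (S l) Hpr Hp5 ltac:(unfold p; lia)) as [l' [Hl' [D U]]].
      destruct l' as [|l']; [lia|]. exists l'. split; [unfold p in *; lia|]. split; [apply HR; exact D|].
      intros m Hm Hne. destruct (R l m) eqn:Em; [|reflexivity]. exfalso. apply Hne.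
      apply HR in Em. specialize (U (S m) ltac:(unfold p; lia) Em). lia. }
    assert (Rs : forall l l', R l l' = R l' l).
    { intros l l'. unfold R. replace (27 * Z.of_nat (S l') * Z.of_nat (S l))%Z
        with (27 * Z.of_nat (S l) * Z.of_nat (S l'))%Z by ring. reflexivity. }
    rewrite (csum_ext (fun l => h (S l)) (fun l => csum (fun l' =>
      if R l l' then e * (3 * z * z) * g (S l') else 0)%C p')).
    - rewrite csum_swap, <- csum_scal. apply csum_ext. intros l' Hl'.
      destruct (Uq l' Hl') as [l [Hl [E U]]]. rewrite (csum_delta _ p' l Hl).
      + rewrite Rs, E. reflexivity.
      + intros m Hm Hne. rewrite Rs, U by auto. reflexivity.
    - intros l Hl. destruct (Uq l Hl) as [l' [Hl' [E U]]]. rewrite (csum_delta _ p' l' Hl').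
      + rewrite E. apply (hecke_coset k e F p (S l) (S l') z He HT HW Hp Hz). apply HR, E.
      + intros m Hm Hne. rewrite U by auto. reflexivity. }
  assert (Eg : csum g p = (g 0%nat + csum (fun l => g (S l)) p')%C) by apply csum_Sl.
  assert (Eh : csum h p = (h 0%nat + csum (fun l => h (S l)) p')%C) by apply csum_Sl.
  rewrite Eg, Eh, Sm.
  assert (E0 : h 0%nat = (e * (3 * (INR p * z) * (INR p * z)) * F (INR p * z)%C)%C).
  { unfold h. rewrite <- HW by (apply inH_INR; auto). f_equal. unfold fr. simpl (INR 0).
    generalize dependent (RtoC (INR p)). intros; field; auto. }
  assert (E1 : F (INR p * fr z)%C = (e * (3 * (z / INR p) * (z / INR p)) * g 0%nat)%C).
  { unfold g. simpl (INR 0). replace ((z + 3 * 0) / INR p)%C with (z / INR p)%C by (unfold Cdiv; ring).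
    assert (Hzp : inH (z / INR p)).
    { replace (z / INR p)%C with ((z + 3 * INR 0) / INR p)%C by (simpl (INR 0); unfold Cdiv; ring).
      apply inH_hecke; auto. }
    rewrite <- HW by exact Hzp. f_equal. unfold fr.
    generalize dependent (RtoC (INR p)). intros; field; auto. }
  rewrite E0, E1.
  generalize dependent (RtoC (INR p)). intros. field. auto.
Qed.

(** The nonpolar coefficients of [f | T(p^n)], by the recursion of [heckeTpow]. *)
Fixpoint hpow (p n : nat) (a : nat -> C) {struct n} : nat -> C :=
  match n with
  | O => a
  | S m => match m with
    | O => hcoef p a
    | S k => fun j => (hcoef p (hpow p m a) j - INR p * hpow p k a j)%C
    end
  end.

Lemma hpow_SS (p k : nat) (a : nat -> C) (j : nat) :
  hpow p (S (S k)) a j = (hcoef p (hpow p (S k) a) j - INR p * hpow p k a j)%C.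
Proof. reflexivity. Qed.

Lemma heckeTpow_SS (p k : nat) (f : C -> C) (z : C) :
  heckeTpow p (S (S k)) f z = (heckeT p (heckeTpow p (S k) f) z - INR p * heckeTpow p k f z)%C.
Proof. reflexivity. Qed.

Lemma supp_mod (r s : nat) (a : nat -> C) : (r mod 3 = s mod 3)%nat -> supp r a -> supp s a.
Proof. intros E H n Hn. apply H. rewrite E. exact Hn. Qed.

Lemma mod3_cases (n : nat) : (n mod 3 <> 0)%nat -> (n mod 3 = 1 \/ n mod 3 = 2)%nat.
Proof. pose proof (Nat.mod_upper_bound n 3 ltac:(lia)). lia. Qed.

Lemma supp_hcoef (p r : nat) (a : nat -> C) : (0 < p)%nat -> (p mod 3 <> 0)%nat ->
  supp r a -> supp (p * r) (hcoef p a).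
Proof.
  intros Hp Hp3 H n Hn. unfold hcoef, dilate. rewrite H.
  - destruct (Nat.eqb_spec (n mod p) 0) as [E|E]; [|ring].
    rewrite H; [ring|]. intros E'. apply Hn.
    rewrite (Nat.div_mod_eq n p), E, Nat.add_0_r, Nat.Div0.mul_mod, E', <- Nat.Div0.mul_mod. reflexivity.
  - intros E. apply Hn. rewrite Nat.Div0.mul_mod in E. rewrite (Nat.Div0.mul_mod p r).
    pose proof (Nat.mod_upper_bound n 3 ltac:(lia)). pose proof (Nat.mod_upper_bound r 3 ltac:(lia)).
    destruct (mod3_cases p Hp3) as [Q|Q]; rewrite Q in *;
    (assert (A : (n mod 3 = 0 \/ n mod 3 = 1 \/ n mod 3 = 2)%nat) by lia;
     assert (B : (r mod 3 = 0 \/ r mod 3 = 1 \/ r mod 3 = 2)%nat) by lia;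
     destruct A as [A|[A|A]]; destruct B as [B|[B|B]]; rewrite A, B in *; simpl in *; lia).
Qed.

Lemma sq_mod3 (p x : nat) : (p mod 3 <> 0)%nat -> ((p * (p * x)) mod 3 = x mod 3)%nat.
Proof.
  intros H. rewrite Nat.mul_assoc, Nat.Div0.mul_mod, (Nat.Div0.mul_mod p p).
  destruct (mod3_cases p H) as [->| ->];
    change ((1 * 1) mod 3)%nat with 1%nat; change ((2 * 2) mod 3)%nat with 1%nat;
    rewrite Nat.mul_1_l; apply Nat.Div0.mod_mod.
Qed.

(** Two consecutive powers are carried along because the recursion has depth two; [p^2 = 1] modulo 3
    puts its two terms into the same class. *)
Lemma supp_hpow (p r n : nat) (a : nat -> C) : (0 < p)%nat -> (p mod 3 <> 0)%nat ->
  supp r a -> supp (p ^ n * r) (hpow p n a) /\ supp (p ^ S n * r) (hpow p (S n) a).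
Proof.
  intros Hp Hp3 H. induction n as [|n [IH1 IH2]].
  - split.
    + simpl. rewrite Nat.add_0_r. exact H.
    + simpl. rewrite Nat.mul_1_r. apply supp_hcoef; auto.
  - split; [exact IH2|]. intros j Hj. rewrite hpow_SS.
    rewrite (supp_hcoef p _ _ Hp Hp3 IH2), IH1; [ring| |].
    + intros E. apply Hj. rewrite E. simpl. rewrite <- !Nat.mul_assoc. symmetry. apply sq_mod3, Hp3.
    + intros E. apply Hj. rewrite E. f_equal. simpl. ring.
Qed.

(* [u(n,j) = hpow n a (p^j)] satisfies [u(n+1,j) - p u(n,j-1) = u(n,j+1) - p u(n-1,j)]. *)
Lemma hpow_diag (p n : nat) (a : nat -> C) : (2 <= p)%nat ->
  forall j, hpow p (S n) a (p ^ S j)%nat = (a (p ^ (S n + S j))%nat + INR p * hpow p n a (p ^ j)%nat)%C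
    /\ hpow p n a (p ^ 0)%nat = a (p ^ n)%nat /\ hpow p (S n) a (p ^ 0)%nat = a (p ^ S n)%nat.
Proof.
  intros Hp.
  assert (D0 : forall b, dilate p b (p ^ 0)%nat = 0%C).
  { intros b. unfold dilate. simpl. rewrite Nat.mod_small by lia. reflexivity. }
  assert (DS : forall b j, dilate p b (p ^ S j)%nat = b (p ^ j)%nat).
  { intros b j. unfold dilate. simpl. rewrite Nat.mul_comm, Nat.Div0.mod_mul, Nat.div_mul by lia. reflexivity. }
  induction n as [|n IH]; intros j.
  - split; [|split].
    + change (hpow p 1 a) with (hcoef p a). unfold hcoef. rewrite DS. reflexivity.
    + reflexivity.
    + change (hpow p 1 a) with (hcoef p a). unfold hcoef. rewrite D0. simpl Nat.pow. ring.
  - destruct (IH j) as [A [B C]]. split; [|split].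
    + rewrite hpow_SS. unfold hcoef. rewrite DS.
      replace (p * p ^ S j)%nat with (p ^ S (S j))%nat by reflexivity.
      rewrite (proj1 (IH (S j))). replace (S n + S (S j))%nat with (S (S n) + S j)%nat by lia. ring.
    + exact C.
    + rewrite hpow_SS. unfold hcoef. rewrite D0.
      replace (p * p ^ 0)%nat with (p ^ 1)%nat by (simpl; lia).
      rewrite (proj1 (IH 0%nat)). replace (S n + 1)%nat with (S (S n)) by lia. ring.
Qed.

(** The congruence says that the polar exponent [-e] lies in the class [r] of the other
    exponents. *)
Lemma tlaw_of_expansion (F : C -> C) (x : C) (e r : nat) (a : nat -> C) :
  ((e + r) mod 3 = 0)%nat -> supp r a -> QS a (fun z => F z - x * / W z ^ e)%C ->
  tlaw (Z.of_nat r) F.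
Proof.
  intros Her Sa Q z Hz. pose proof (QS_T r a _ Q Sa z Hz) as E. cbv beta in E.
  rewrite zeta3pow_nat. rewrite W_T, Cpow_mult_l in E.
  replace (F (z + 1)%C) with ((F (z + 1)%C - x * / (zeta ^ e * W z ^ e)) + x * / (zeta ^ e * W z ^ e))%C by ring.
  rewrite E. assert (Z1 : (zeta ^ e * zeta ^ r)%C = 1%C).
  { rewrite <- Cpow_add_r, zeta_pow_mod, Her. reflexivity. }
  pose proof (Cpow_nz _ e zeta_neq_0) as Ne. pose proof (Cpow_nz _ e (W_neq_0 z)) as Nw.
  replace (/ (zeta ^ e * W z ^ e))%C with ((zeta ^ e * zeta ^ r) / (zeta ^ e * W z ^ e))%C
    by (rewrite Z1; field; auto).
  field. auto.
Qed.

Lemma res_pow (p n : nat) : (p mod 3 <> 0)%nat -> ((p ^ n) mod 3 <> 0)%nat.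
Proof.
  intros H. induction n as [|n IH]; [simpl; lia|].
  change (p ^ S n)%nat with (p * p ^ n)%nat. rewrite Nat.Div0.mul_mod.
  destruct (mod3_cases _ H) as [->| ->]; destruct (mod3_cases _ IH) as [->| ->]; simpl; lia.
Qed.

(** For [m >= 1], [T(p)] sends [p^m q^(-p^m/3)] to [p^(m+1) q^(-p^(m+1)/3) + p^m q^(-p^(m-1)/3)];
    the second term is the polar term of [p f | T(p^(m-1))] and cancels in the recursion. The law
    under [T] required by [heckeT_wlaw] is read off the expansion at each stage. *)
Lemma heckeTpow_expansion (s : bool) (p : nat) (f : C -> C) (a : nat -> C) (n : nat) :
  prime (Z.of_nat p) -> (5 <= p)%nat -> (p mod 3 <> 0)%nat -> is_f s 1 f a ->
  (wlaw (sgn s) (heckeTpow p n f) /\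
   QS (hpow p n a) (fun z => heckeTpow p n f z - INR (p ^ n) * / W z ^ (p ^ n))%C) /\
  (wlaw (sgn s) (heckeTpow p (S n) f) /\
   QS (hpow p (S n) a) (fun z => heckeTpow p (S n) f z - INR (p ^ S n) * / W z ^ (p ^ S n))%C).
Proof.
  intros Hpr Hp5 Hp3 Hf.
  assert (Hp : (0 < p)%nat) by lia.
  destruct (is_f_elim _ _ _ _ Hf) as [L [Q [S0 _]]]. change (res 1) with 2%nat in S0.
  assert (TL : forall m, supp (p ^ m * 2) (hpow p m a) ->
    QS (hpow p m a) (fun z => heckeTpow p m f z - INR (p ^ m) * / W z ^ (p ^ m))%C ->
    tlaw (Z.of_nat (p ^ m * 2)) (heckeTpow p m f)).
  { intros m Sm Qm. apply (tlaw_of_expansion _ (INR (p ^ m)) (p ^ m) _ (hpow p m a)); auto.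
    replace (p ^ m + p ^ m * 2)%nat with (p ^ m * 3)%nat by lia. apply Nat.Div0.mod_mul. }
  assert (HT : forall m, QS (hpow p m a) (fun z => heckeTpow p m f z - INR (p ^ m) * / W z ^ (p ^ m))%C ->
    QS (hcoef p (hpow p m a)) (fun z => heckeT p (heckeTpow p m f) z
      - INR (p ^ m) * ((if (p ^ m mod p =? 0)%nat then / W z ^ (p ^ m / p) else 0) + INR p * / W z ^ (p * p ^ m)))%C).
  { intros m Qm. eapply QS_ext; [reflexivity| |apply (QS_hecke p _ _ Hp Qm)].
    intros z Hz. rewrite <- hecke_polar by exact Hp.
    rewrite (heckeT_ext p (heckeTpow p m f) (fun u => (heckeTpow p m f u - INR (p ^ m) * / W u ^ (p ^ m))
      + INR (p ^ m) * / W u ^ (p ^ m))%C z Hp Hz) by (intros; ring).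
    rewrite (heckeT_lin p (INR (p ^ m))
      (fun u => heckeTpow p m f u - INR (p ^ m) * / W u ^ (p ^ m))%C
      (fun u => / W u ^ (p ^ m))%C z Hp). ring. }
  induction n as [|n [[L1 Q1] [L2 Q2]]].
  - assert (Q0 : QS (hpow p 0 a) (fun z => heckeTpow p 0 f z - INR (p ^ 0) * / W z ^ (p ^ 0))%C).
    { eapply QS_ext; [reflexivity| |exact Q]. intros z Hz. simpl. ring. }
    split; [split; [exact L | exact Q0]|]. split.
    + apply (heckeT_wlaw (Z.of_nat (p ^ 0 * 2)) (sgn s) f p (sgn_sq s)); auto.
    + eapply QS_ext; [reflexivity| |apply (HT 0%nat Q0)].
      intros z Hz. cbv beta. simpl (p ^ 0)%nat. rewrite (Nat.mod_small 1 p) by lia.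
      change (p ^ 1)%nat with (p * 1)%nat. rewrite !Nat.mul_1_r. simpl. ring.
  - split; [split; [exact L2 | exact Q2]|].
    destruct (supp_hpow p 2 n a Hp Hp3 S0) as [S1 S2].
    split.
    + intros z Hz. rewrite !heckeTpow_SS.
      rewrite (heckeT_wlaw _ (sgn s) _ p (sgn_sq s) (TL (S n) S2 Q2) L2 Hpr Hp5 z Hz), L1 by exact Hz.
      ring.
    + eapply QS_ext; [| |apply (QS_minus _ _ _ _ (HT (S n) Q2) (QS_scal (INR p) _ _ Q1))].
      * intros j. reflexivity.
      * intros z Hz. cbv beta. rewrite heckeTpow_SS.
        replace (p ^ S n mod p)%nat with 0%nat
          by (simpl; rewrite Nat.mul_comm; symmetry; apply Nat.Div0.mod_mul).
        replace (p ^ S n / p)%nat with (p ^ n)%nat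
          by (simpl; rewrite Nat.mul_comm; symmetry; apply Nat.div_mul; lia).
        simpl (0 =? 0)%nat. cbv iota.
        change (p ^ S (S n))%nat with (p * p ^ S n)%nat.
        assert (I1 : INR (p ^ S n) = INR p * INR (p ^ n)) by apply mult_INR.
        rewrite (mult_INR p (p ^ S n)), I1, !RtoC_mult. ring.
Qed.

Lemma prime_mod3 (p : nat) : prime (Z.of_nat p) -> (5 <= p)%nat -> (p mod 3 <> 0)%nat.
Proof.
  intros Hp H5 E. apply Nat.Div0.mod_divides in E as [k E].
  assert (D : (3 | Z.of_nat p)%Z) by (exists (Z.of_nat k); lia).
  apply prime_divisors in D; [|exact Hp]. lia.
Qed.

Definition h3_coef (n : nat) : C :=
  match n with O => 0%C | S k => ecoef (-2) (-2) k end.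

Lemma QS_h3 : QS h3_coef h3.
Proof.
  eapply QS_ext; [reflexivity| |apply (QS_mul_W _ _ (QS_eprod (-2) (-2)))].
  intros z Hz. symmetry. apply h3_eprod, Hz.
Qed.

Lemma supp_h3 : supp 1 h3_coef.
Proof.
  intros [|n] Hn; [reflexivity|]. apply supp_ecoef. intros E. apply Hn.
  replace (S n) with (n + 1)%nat by lia. rewrite Nat.Div0.add_mod, E. reflexivity.
Qed.

(** One statement for the three cases of (c), with [x] the multiple of [h3]. The polar parts cancel
    in the difference; for the minus sign and [p^n = 2] modulo 3 its coefficient at [q^(1/3)] is
    [a1 (p^n) - x] by [hpow_diag], so [form_zero] applies. *)
Lemma hecke_main (s : bool) (p n : nat) (f1 g : C -> C) (a1 a : nat -> C) (x : C) :
  prime (Z.of_nat p) -> (5 <= p)%nat -> is_f s 1 f1 a1 -> is_f s (p ^ n)%nat g a ->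
  (x = 0%C \/ s = false /\ ((p ^ n) mod 3 = 2)%nat) ->
  (s = false -> ((p ^ n) mod 3 = 2)%nat -> x = a1 (p ^ n)%nat) ->
  forall z, inH z -> heckeTpow p n f1 z = (INR (p ^ n) * g z + x * h3 z)%C.
Proof.
  intros Hpr Hp5 H1 Hg Hx Hx1 z Hz.
  pose proof (prime_mod3 p Hpr Hp5) as Hp3. pose proof (res_pow p n Hp3) as Hn3.
  destruct (heckeTpow_expansion s p f1 a1 n Hpr Hp5 Hp3 H1) as [[L Q] _].
  destruct (is_f_elim _ _ _ _ H1) as [_ [_ [S1 _]]]. change (res 1) with 2%nat in S1.
  destruct (supp_hpow p 2 n a1 ltac:(lia) Hp3 S1) as [Sn _].
  destruct (is_f_elim _ _ _ _ Hg) as [Lg [Qg [Sg Xg]]].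
  assert (Sn' : supp (res (p ^ n)) (hpow p n a1)).
  { refine (supp_mod _ _ _ _ Sn). unfold res. rewrite Nat.Div0.mul_mod.
    destruct (mod3_cases _ Hn3) as [->| ->]; reflexivity. }
  apply Ceq_minus.
  assert (E : (heckeTpow p n f1 z - INR (p ^ n) * g z - x * h3 z)%C = 0%C).
  { apply (form_zero s (res (p ^ n))
      (fun j => hpow p n a1 j - INR (p ^ n) * a j - x * h3_coef j)%C
      (fun z => heckeTpow p n f1 z - INR (p ^ n) * g z - x * h3 z)%C); auto.
    - apply res_12.
    - eapply QS_ext; [reflexivity| |
        apply (QS_minus _ _ _ _ (QS_minus _ _ _ _ Q (QS_scal (INR (p ^ n)) _ _ Qg)) (QS_scal x _ _ QS_h3))].
      intros u Hu. cbv beta. ring.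
    - intros j Hj. rewrite Sn', Sg by exact Hj. destruct Hx as [->|[Es E2]]; [ring|].
      rewrite supp_h3; [ring|]. intros E. apply Hj. rewrite E.
      unfold res. rewrite E2. reflexivity.
    - destruct Hx as [->|[Es E2]].
      + intros u Hu. rewrite L, Lg by exact Hu. ring.
      + subst s. apply wlaw_lin; [apply wlaw_lin; auto | exact h3_fr].
    - intros Es Er.
      assert (E2 : ((p ^ n) mod 3 = 2)%nat).
      { destruct (mod3_cases _ Hn3) as [M|M]; [|exact M].
        unfold res in Er. rewrite M in Er. discriminate. }
      rewrite (Xg Es E2), (Hx1 Es E2). simpl h3_coef. rewrite ecoef_0.
      pose proof (proj1 (proj2 (hpow_diag p n a1 ltac:(lia) 0%nat))) as D. simpl (p ^ 0)%nat in D.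
      rewrite D. ring. }
  rewrite <- E. ring.
Qed.

Theorem theorem5p1 :
  (* (a) and (b): existence and uniqueness (on H) of f_d^{+-} *)
  (forall (s : bool) (d : nat), (0 < d)%nat -> (d mod 3 <> 0)%nat ->
     exists f : C -> C, (exists a, is_f s d f a) /\
       forall g : C -> C, (exists a, is_f s d g a) -> forall z, inH z -> g z = f z) /\
  (* (c) *)
  (forall (p n : nat), prime (Z.of_nat p) -> (5 <= p)%nat -> (1 <= n)%nat ->
     (forall f1 a1 g a, is_f true 1 f1 a1 -> is_f true (p ^ n)%nat g a ->
        forall z, inH z -> heckeTpow p n f1 z = (RtoC (INR (p ^ n)%nat) * g z)%C) /\
     (forall f1 a1 g a, is_f false 1 f1 a1 -> is_f false (p ^ n)%nat g a ->
        (((p ^ n) mod 3) = 1)%nat ->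
        forall z, inH z -> heckeTpow p n f1 z = (RtoC (INR (p ^ n)%nat) * g z)%C) /\
     (forall f1 a1 g a, is_f false 1 f1 a1 -> is_f false (p ^ n)%nat g a ->
        (((p ^ n) mod 3) = 2)%nat ->
        forall z, inH z ->
          heckeTpow p n f1 z = (RtoC (INR (p ^ n)%nat) * g z + a1 (p ^ n)%nat * h3 z)%C)).
Proof.
  split.
  - intros s d Hd0 Hd. destruct (is_f_exists s d Hd0 Hd) as [f [a Hf]].
    exists f. split; [exists a; exact Hf|]. intros g [b Hg] z Hz.
    exact (is_f_unique s d f g a b Hf Hg Hd z Hz).
  - intros p n Hpr Hp5 _. split; [|split].
    + intros f1 a1 g a H1 Hg z Hz.
      rewrite (hecke_main true p n f1 g a1 a 0 Hpr Hp5 H1 Hg); auto; [ring | discriminate].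
    + intros f1 a1 g a H1 Hg E z Hz.
      rewrite (hecke_main false p n f1 g a1 a 0 Hpr Hp5 H1 Hg); auto; [ring |].
      intros _ E2. rewrite E in E2. discriminate.
    + intros f1 a1 g a H1 Hg E z Hz.
      apply (hecke_main false p n f1 g a1 a (a1 (p ^ n)%nat) Hpr Hp5 H1 Hg); auto.
Qed.
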